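(* Let $q\in\mathcal{L}_2[0,L]$, $h\in\mathbb{C}$, $x\in(0,L]$. Then \[ S'(\rho,x)=\cos(\rho x)+\frac{\omega(x)}{\rho}\sin(\rho x)+\frac{1}{2\rho\sin(\rho x)}\sum_{n=0}^{\infty}\mathring{s}_n(x)\Bigl(\operatorname{sinc}\Bigl(\tfrac{2\rho x}{\pi}-2n-1\Bigr)+\operatorname{sinc}\Bigl(\tfrac{2\rho x}{\pi}+2n+1\Bigr)\Bigr), \] \[ \mathring{s}_n(x)=\frac{(-1)^n(2n+1)\pi}{x}S'\Bigl(\frac{(2n+1)\pi}{2x},x\Bigr)-2\omega(x),\quad n\ge0, \] and \[ \phi'(\rho,x)=-\rho\sin(\rho x)-(h+\omega(x))\rho x\,j_1(\rho x)+\sum_{n=0}^{\infty}\mathring{\phi}_n(x)\Bigl(\operatorname{sinc}\Bigl(\tfrac{\rho x}{\pi}-n\Bigr)+\operatorname{sinc}\Bigl(\tfrac{\rho x}{\pi}+n\Bigr)\Bigr), \] \[ \mathring{\phi}_0(x)=\tfrac12\phi'(0,x),\qquad\mathring{\phi}_n(x)=\phi'\Bigl(\frac{n\pi}{x},x\Bigr)-(-1)^n(h+\omega(x)),\ n\ge1. \] The series converge uniformly on compact subsets of the complex $\rho$-plane, and for $\rho\in\mathbb{R}$ absolutely, uniformly, and in $\mathcal{L}_2(\mathbb{R})$.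
   Context: Let $L>0$, $q$ complex valued, $h\in\mathbb{C}$. $S(\rho,x)$, $\phi(\rho,x)$ are the solutions of $-y''+q(x)y=\rho^2y$ with $S(\rho,0)=0,S'(\rho,0)=1$, $\phi(\rho,0)=1,\phi'(\rho,0)=h$; prime denotes $d/dx$. $\omega(x)=\frac12\int_0^xq(s)ds$. $\operatorname{sinc}(z)=\frac{\sin\pi z}{\pi z}$, $\operatorname{sinc}(0)=1$; $j_1(z)=\frac{\sin z}{z^2}-\frac{\cos z}{z}$. *)

(* Defs.v *)
From HB Require Import structures.
From mathcomp Require Import all_boot all_order all_algebra.
From mathcomp Require Import all_classical all_reals all_analysis.
From mathcomp Require Import complex.
Set Implicit Arguments. Unset Strict Implicit. Unset Printing Implicit Defensive.
Import Order.TTheory GRing.Theory Num.Theory numFieldNormedType.Exports.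
Local Open Scope ring_scope.
Local Open Scope classical_set_scope.

Section Defs.
Variable R : realType.
Local Notation C := (R[i]).
Local Notation mu := (@lebesgue_measure R).

Definition cR (r : R) : C := Complex r 0.

Definition cabs (z : C) : R := Num.sqrt (complex.Re z ^+ 2 + complex.Im z ^+ 2).

Definition cint (f : R -> C) (a b : R) : C :=
  Complex (Rintegral mu `[a, b] (fun t => complex.Re (f t)))
          (Rintegral mu `[a, b] (fun t => complex.Im (f t))).

Definition coshR (b : R) : R := (expR b + expR (- b)) / 2.
Definition sinhR (b : R) : R := (expR b - expR (- b)) / 2.
Definition csin (z : C) : C :=
  Complex (sin (complex.Re z) * coshR (complex.Im z)) (cos (complex.Re z) * sinhR (complex.Im z)).
Definition ccos (z : C) : C :=
  Complex (cos (complex.Re z) * coshR (complex.Im z)) (- (sin (complex.Re z) * sinhR (complex.Im z))).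

Definition csinc (z : C) : C :=
  if z == 0 then 1 else csin (cR pi * z) / (cR pi * z).

(* spherical Bessel j_1(z) = sin z / z^2 - cos z / z, extended by its limit
   j_1(0) = 0 *)
Definition cj1 (z : C) : C :=
  if z == 0 then 0 else csin z / z ^+ 2 - ccos z / z.

Definition L2_on (L : R) (q : R -> C) : Prop :=
  measurable_fun `[0, L] (fun t => complex.Re (q t)) /\
  measurable_fun `[0, L] (fun t => complex.Im (q t)) /\
  (\int[mu]_(t in `[0%R, L]) ((complex.Re (q t)) ^+ 2 + (complex.Im (q t)) ^+ 2)%:E < +oo)%E.

Definition ccont_on (L : R) (f : R -> C) : Prop :=
  {within (`[0, L] : set R), continuous (fun t : R => complex.Re (f t))} /\
  {within (`[0, L] : set R), continuous (fun t : R => complex.Im (f t))}.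

(* (y, dy) is the (Caratheodory) solution of -y'' + q y = rho^2 y on [0,L]
   with y(0) = y0, y'(0) = y1:  y, dy continuous and
   y(x) = y0 + int_0^x dy,  dy(x) = y1 + int_0^x (q - rho^2) y. *)
Definition is_solution (L : R) (q : R -> C) (rho : C) (y0 y1 : C)
  (y dy : R -> C) : Prop :=
  ccont_on L y /\ ccont_on L dy /\
  forall x, 0 <= x <= L ->
    y x = y0 + cint dy 0 x /\
    dy x = y1 + cint (fun t => (q t - rho ^+ 2) * y t) 0 x.

Definition omega (q : R -> C) (x : R) : C := cint q 0 x / 2.

(* uniform convergence of the partial sums of sum_n u n rho to F
   on compact subsets of C (equivalently, on every closed disc |rho| <= r) *)
Definition unif_cvg_compacts (u : nat -> C -> C) (F : C -> C) : Prop :=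
  forall r : R, 0 < r -> forall e : R, 0 < e -> exists N0 : nat,
    forall N, (N0 <= N)%N -> forall rho, cabs rho <= r ->
      cabs (\sum_(n < N) u n rho - F rho) < e.

Definition real_line_cvg (u : nat -> C -> C) (F : C -> C) : Prop :=
  (forall t : R, exists M : R, forall N,
      \sum_(n < N) cabs (u n (cR t)) <= M) /\
  (forall e : R, 0 < e -> exists N0 : nat,
    forall N, (N0 <= N)%N -> forall t : R,
      cabs (\sum_(n < N) u n (cR t) - F (cR t)) < e) /\
  ((fun N : nat => (\int[mu]_(t in [set: R])
      ((cabs (\sum_(n < N) u n (cR t) - F (cR t))) ^+ 2)%:E)%E) @ \oo --> 0%E).

End Defs.

(* Main.v *)
Require Import Defs.
From HB Require Import structures.
From mathcomp Require Import all_boot all_order all_algebra.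
From mathcomp Require Import all_classical all_reals all_analysis.
From mathcomp Require Import complex measurable_realfun ring lra zify.
Import Order.TTheory GRing.Theory Num.Theory numFieldNormedType.Exports.
Local Open Scope ring_scope.
Local Open Scope classical_set_scope.
Set Implicit Arguments.
Unset Strict Implicit.

(** Both remainders F (= the sums of the two series) satisfy
      |sum_j b_j F(r_j)| <= K sup_(|s| <= tau) |sum_j b_j cos (r_j s)|
    for all finite families of weights b_j and complex nodes r_j, with tau = x
    for phi' and tau = 2x for S'.  This replaces a Paley-Wiener representation
    by a transmutation operator: it follows from the Volterra equation of the
    solution, tested against the functional, and a Gronwall argument.  Feeding
    into it the expansion of cos (z t) in the cosines cos (n t) on [0, pi],
    whose coefficients are sinc (z - n) + sinc (z + n) (sinc z for n = 0), gives
    the interpolation series and its uniform convergence on discs.  For S' the remainder vanishes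
    at the even nodes, so only the odd ones survive.

    The samples are square summable, by Bessel's inequality for q times the free
    solution and an O(1/n) bound for the rest.  Since sinc is positive definite,
    with sinc (i - j) = delta_ij, the sums of |F - partial sum|^2 over all the
    translates t + k of a real point are bounded by the tail of the squares of
    the samples.  One translate gives uniform convergence on the real line,
    and integration over a period gives convergence in L_2. *)

(** * Integration on [0, x] *)

(** By duality the estimate says that F is the cosine transform of a finite measure on [0, tau].
    Such a measure may have atoms (cos (rho x) itself satisfies the estimate), so the estimate
    yields the series on discs but no decay of the samples. Decay rests on q in L_2 and on the exact
    shape of the subtracted terms.

    For phi', the integral of q(t) phi(t) cos (rho (x - t)) has a part that does not decay: with phi
    replaced by cos (rho t), the product of cosines contains cos (rho x) / 2, which integrates
    against q to omega(x) cos (rho x). Together with h cos (rho x) it is taken away by the j_1 term,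
    because - z j_1(z) = cos z - sin z / z. This term vanishes at 0 and equals (-1)^n at z = n pi,
    which is where the special form of the coefficient at n = 0 comes from.

    For S', the rest after the two explicit terms is multiplied by 2 rho sin (rho x). Since 2 sin
    (rho x) cos (rho (x - t)) = sin (rho (2x - t)) + sin (rho t), cosines up to 2x are needed and
    the mesh is halved; the factor sin (rho x) creates the zeros at every second node. *)

Section RealIntegral.
Context {R : realType}.
Local Notation mu := (@lebesgue_measure R).
Local Notation Int x f := (Rintegral mu `[0%R, x] f).
Implicit Types (x M : R) (f g : R -> R).

Definition intble x f := mu.-integrable `[0%R, x] (EFin \o f).

Definition bmeas x f :=
  measurable_fun `[0%R, x] f /\ exists M, forall t, 0 <= t <= x -> `|f t| <= M.

Lemma itv0xP x t : (`[0%R, x]%classic : set R) t <-> 0 <= t <= x.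
Proof. by rewrite /= in_itv. Qed.

Lemma mu_itv0 x : mu `[0%R, x] = (Num.max 0 x)%:E.
Proof.
transitivity (if (0%:E < x%:E)%E then (x%:E - 0%:E)%E else 0%E).
  exact: (@lebesgue_measure_itv R `[0%R, x]%R).
rewrite lte_fin; case: ltP => h; first by rewrite sube0.
by [].
Qed.

Lemma intbleD x f g : intble x f -> intble x g -> intble x (fun t => f t + g t).
Proof. by rewrite /intble => hf hg; exact: (integrableD _ hf hg). Qed.

Lemma intbleZ x k f : intble x f -> intble x (fun t => k * f t).
Proof. by rewrite /intble => hf; exact: (integrableZl _ _ hf). Qed.

Lemma intbleN x f : intble x f -> intble x (fun t => - f t).
Proof. by move=> hf; have := intbleZ (-1) hf; rewrite /intble; apply: eq_integrable => // t _ /=; rewrite mulN1r. Qed.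

Lemma bmeas_intble x f : bmeas x f -> intble x f.
Proof.
move=> [mf [M hM]]; apply: measurable_bounded_integrable => //.
  have h : (mu `[0%R, x] < +oo)%E by rewrite mu_itv0 ltry.
  exact: h.
exists M; split; rewrite ?num_real// => K MK t /itv0xP tx.
by apply: le_trans (ltW MK); apply: hM.
Qed.

Lemma intbleM x f g : intble x f -> bmeas x g -> intble x (fun t => f t * g t).
Proof.
move=> hf [mg [M hM]].
rewrite /intble in hf *.
apply: (integrableMl _ hf mg) => //.
exists M; split; rewrite ?num_real// => K MK t /itv0xP tx.
by apply: le_trans (ltW MK); apply: hM.
Qed.

Lemma intbleW x y f : y <= x -> intble x f -> intble y f.
Proof.
move=> yx; apply: integrableS => //.
by apply: subset_itvl; rewrite bnd_simp.
Qed.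

Lemma bmeasW x y f : y <= x -> bmeas x f -> bmeas y f.
Proof.
move=> yx [mf [M hM]]; split.
  apply: measurable_funS mf => //.
  by apply: subset_itvl; rewrite bnd_simp.
by exists M => t /andP[t0 ty]; apply: hM; rewrite t0 (le_trans ty).
Qed.

Lemma bmeasD x f g : bmeas x f -> bmeas x g -> bmeas x (fun t => f t + g t).
Proof.
move=> [mf [M hM]] [mg [N hN]]; split; first exact: measurable_funD.
exists (M + N) => t tx; apply: le_trans (ler_normD _ _) _.
by apply: lerD; [exact: hM | exact: hN].
Qed.

Lemma bmeasM x f g : bmeas x f -> bmeas x g -> bmeas x (fun t => f t * g t).
Proof.
move=> [mf [M hM]] [mg [N hN]]; split; first exact: measurable_funM.
exists (M * N) => t tx; rewrite normrM.
by apply: ler_pM => //; [exact: hM | exact: hN].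
Qed.

Lemma bmeas_within x f : {within `[0%R, x], continuous f} -> bmeas x f.
Proof.
move=> cf; split.
  by apply: subspace_continuous_measurable_fun.
have [M [_ hM]] := @compact_bounded _ _ _ (continuous_compact cf (@segment_compact _ 0 x)).
exists (M + 1) => t tx; by apply: (hM _ (ltr_pwDr _ (lexx _))) => //; exists t => //; apply/itv0xP.
Qed.

Lemma bmeas_continuous x f : continuous f -> bmeas x f.
Proof. by move=> cf; apply: bmeas_within; apply: continuous_subspaceT. Qed.

Lemma IntD x f g : intble x f -> intble x g ->
  Int x (fun t => f t + g t) = Int x f + Int x g.
Proof. by move=> hf hg; rewrite RintegralD. Qed.

Lemma IntZ x k f : intble x f -> Int x (fun t => k * f t) = k * Int x f.
Proof. by move=> hf; rewrite RintegralZl. Qed.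

Lemma IntB x f g : intble x f -> intble x g ->
  Int x (fun t => f t - g t) = Int x f - Int x g.
Proof. by move=> hf hg; rewrite RintegralB. Qed.

Lemma eq_Int x f g : (forall t, 0 <= t <= x -> f t = g t) -> Int x f = Int x g.
Proof. by move=> h; apply: eq_Rintegral => t; rewrite inE => /itv0xP /h. Qed.

Lemma le_Int x f g : intble x f -> intble x g ->
  (forall t, 0 <= t <= x -> f t <= g t) -> Int x f <= Int x g.
Proof. by move=> hf hg h; apply: le_Rintegral => // t /itv0xP /h. Qed.

Lemma norm_Int x f : intble x f -> `|Int x f| <= Int x (fun t => `|f t|).
Proof. by move=> hf; apply: le_normr_Rintegral. Qed.

Lemma intble_norm x f : intble x f -> intble x (fun t => `|f t|).
Proof. by move=> hf; apply: integrable_norm. Qed.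

Lemma Int_cst x k : 0 <= x -> Int x (fun=> k) = k * x.
Proof.
move=> x0; rewrite Rintegral_cst//; congr (_ * _).
have /= h : fine (mu `[0%R, x]) = x by rewrite mu_itv0 /=; apply/max_idPr.
exact: h.
Qed.

Lemma eq_intble x f g : (forall t, 0 <= t <= x -> f t = g t) -> intble x f -> intble x g.
Proof.
move=> h; apply: eq_integrable => // t; rewrite inE => /itv0xP tx /=.
by rewrite h.
Qed.

Lemma Int_FTC x F f : 0 <= x -> continuous f ->
  (forall t : R, is_derive t 1 F (f t)) -> Int x f = F x - F 0.
Proof.
move=> + cf dF; rewrite le_eqVlt => /predU1P[<-|x0].
  by rewrite set_itv1 Rintegral_set1 subrr.
have dbl t : derivable F t 1 by [].
have cF : continuous F by move=> t; apply: differentiable_continuous; apply/derivable1_diffP.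
rewrite /Rintegral (@continuous_FTC2 _ f F)//.
- exact: continuous_subspaceT.
- split=> //.
  + exact/cvg_at_right_filter/cF.
  + exact/cvg_at_left_filter/cF.
- by move=> t _; rewrite derive1E derive_val.
Qed.

Lemma Int_within x f : 0 <= x -> intble x f ->
  {within `[0%R, x], continuous (fun t => Int t f)}.
Proof. by move=> x0 hf; apply: parameterized_integral_continuous. Qed.

Lemma Int0 f : Int 0 f = 0.
Proof. by rewrite set_itv1 Rintegral_set1. Qed.

Lemma le_Int_itv x y f : y <= x -> intble x f -> (forall t, 0 <= f t) ->
  Int y f <= Int x f.
Proof.
move=> yx hf f0; have hy := intbleW yx hf.
rewrite /Rintegral fine_le//.
- by have := integrable_fin_num _ hy; apply.
- by have := integrable_fin_num _ hf; apply.
apply: ge0_subset_integral => //.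
- by case/integrableP: hf.
- by move=> t _; rewrite lee_fin.
- by apply: subset_itvl; rewrite bnd_simp.
Qed.

Lemma dense_continuous_Int x f (e : R) : 0 < e -> intble x f ->
  exists h, [/\ continuous h & Int x (fun t => `|f t - h t|) < e].
Proof.
move=> e0 hf.
have muoo : (mu `[0%R, x] < +oo)%E by rewrite mu_itv0 ltry.
have [g [cg ig]] := @approximation_continuous_integrable R _ _ (measurable_itv _) muoo hf.
move=> /fine_cvgP[_ /cvgrPdist_lt /(_ e e0) [N _ /(_ N (leqnn N))]] /=.
rewrite sub0r normrN => h; exists (g N); split=> //.
by apply: le_lt_trans h; rewrite /Rintegral /=; apply: ler_norm.
Qed.

Lemma Int_by_parts_continuous x f g g' : 0 < x -> continuous f -> continuous g' ->
  (forall t : R, is_derive t 1 g (g' t)) ->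
  Int x (fun t => f t * g t) + Int x (fun t => Int t f * g' t) = g x * Int x f.
Proof.
have ltt1 (t : R) : t < t + 1 by rewrite ltrDl.
move=> x0 cf cg' dg.
have dbg t : derivable g t 1 by [].
have cg : continuous g by move=> t; apply: differentiable_continuous; apply/derivable1_diffP.
have hf y : intble y f by apply/bmeas_intble/bmeas_continuous.
have := @Rintegration_by_parts R (fun t => Int t f) g f g' 0 x x0 _ _ _ _ _ _ => ->.
- by rewrite Int0 mul0r subr0 addrC subrK mulrC.
- exact: continuous_subspaceT.
- split.
  + move=> t; rewrite in_itv /= => /andP[t0 tx].
    by have [] := @continuous_FTC1_closed R f 0 t (t + 1) (ltt1 t) (hf _) t0 (cf t).
  + have := @parameterized_integral_cvg_left R 0 x f x0 (hf _).
    rewrite Int0; exact: cvg_at_right_filter.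
  + exact: (@parameterized_integral_cvg_at_left R 0 x f x0 (hf _)).
- move=> t; rewrite in_itv /= => /andP[t0 tx].
  by have [] := @continuous_FTC1_closed R f 0 t (t + 1) (ltt1 t) (hf _) t0 (cf t).
- exact: continuous_subspaceT.
- split=> //.
  + exact/cvg_at_right_filter/cg.
  + exact/cvg_at_left_filter/cg.
- by move=> t _; rewrite derive1E derive_val.
Qed.

Lemma ler_eps_mul (a c : R) : 0 <= c -> (forall e, 0 < e -> a <= c * e) -> a <= 0.
Proof.
move=> c0 h; apply/ler_addgt0Pr => e e0; rewrite add0r.
have c1 : 0 < c + 1 by rewrite ltr_wpDl.
have := h (e / (c + 1)) (divr_gt0 e0 c1); move/le_trans; apply.
by rewrite mulrCA ger_pMr// ler_pdivrMr// mul1r lerDl.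
Qed.

(** For merely integrable [f] the primitive need not be differentiable at every point. Both sides
    are linear in [f] and continuous for the L_1 norm on [[0, x]], with constant [M + M' * x + M],
    so the identity passes from continuous [h] to [f] by density. *)
Lemma Int_by_parts x f g g' : 0 <= x -> intble x f -> continuous g' ->
  (forall t : R, is_derive t 1 g (g' t)) ->
  Int x (fun t => f t * g t) + Int x (fun t => Int t f * g' t) = g x * Int x f.
Proof.
rewrite le_eqVlt => /predU1P[<- _ _ _|x0 hf cg' dg].
  by rewrite !Int0 mulr0 addr0.
have dbg t : derivable g t 1 by [].
have cg : continuous g by move=> t; apply: differentiable_continuous; apply/derivable1_diffP.
have [_ [M hM]] := bmeas_continuous x cg.
have [_ [M' hM']] := bmeas_continuous x cg'.
have x0' := ltW x0.
have M0 : 0 <= M by apply: le_trans (hM 0 _); rewrite ?lexx ?x0' ?normr_ge0.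
have M'0 : 0 <= M' by apply: le_trans (hM' 0 _); rewrite ?lexx ?x0' ?normr_ge0.
apply/eqP; rewrite -subr_eq0 -normr_eq0 eq_le normr_ge0 andbT.
apply: (@ler_eps_mul _ (M + M' * x + M)).
  by rewrite !addr_ge0// mulr_ge0.
move=> e e0; have [h [ch he]] := dense_continuous_Int e0 hf.
have hh y : intble y h by apply/bmeas_intble/bmeas_continuous.
pose d t := f t - h t.
have hd : intble x d by apply: intbleD => //; apply: intbleN.
have hdn := intble_norm hd.
have Id t : t <= x -> Int t d = Int t f - Int t h.
  by move=> tx; rewrite IntB//; apply: intbleW hf.
have dle t : t <= x -> `|Int t d| <= Int x (fun t => `|d t|).
  move=> tx; apply: le_trans (norm_Int (intbleW tx hd)) _.
  exact: le_Int_itv.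
have bI k : intble x k -> bmeas x (fun t => Int t k).
  by move=> hk; apply: bmeas_within; apply: Int_within.
have bg := bmeas_continuous x cg; have bg' := bmeas_continuous x cg'.
have E := Int_by_parts_continuous x0 ch cg' dg.
have -> : Int x (fun t => f t * g t) + Int x (fun t => Int t f * g' t) - g x * Int x f
   = Int x (fun t => d t * g t) + Int x (fun t => Int t d * g' t) - g x * Int x d.
  rewrite Id//.
  have -> : Int x (fun t => d t * g t) = Int x (fun t => f t * g t) - Int x (fun t => h t * g t).
    rewrite -IntB; try exact: intbleM.
    by apply: eq_Int => t _; rewrite mulrBl.
  have -> : Int x (fun t => Int t d * g' t) =
     Int x (fun t => Int t f * g' t) - Int x (fun t => Int t h * g' t).
    rewrite -IntB; try by apply/bmeas_intble/bmeasM => //; exact: bI.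
    by apply: eq_Int => t /andP[_ tx]; rewrite Id// mulrBl.
  rewrite mulrBr -E; ring.
have hde : Int x (fun t => `|d t|) <= e := ltW he.
have hdge : 0 <= Int x (fun t => `|d t|) by apply: Rintegral_ge0 => *; apply: normr_ge0.
rewrite !mulrDl; apply: le_trans (ler_normB _ _) _; apply: lerD; last first.
  rewrite normrM; apply: ler_pM => //; first by apply: hM; rewrite x0' lexx.
  by apply: le_trans hde; apply: dle.
apply: le_trans (ler_normD _ _) _; apply: lerD.
  apply: le_trans (norm_Int (intbleM hd bg)) _.
  apply: (@le_trans _ _ (Int x (fun t => M * `|d t|))).
    apply: le_Int; [exact/intble_norm/intbleM|exact: intbleZ|].
    by move=> t tx; rewrite normrM mulrC ler_wpM2r// hM.
  by rewrite IntZ// ler_wpM2l.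
have hId : intble x (fun t => Int t d * g' t).
  by apply/bmeas_intble/bmeasM => //; exact: bI.
apply: le_trans (norm_Int hId) _.
apply: (@le_trans _ _ (Int x (fun t => M' * e))).
  apply: le_Int; [exact/intble_norm|exact/bmeas_intble/bmeas_continuous/cst_continuous|].
  move=> t /andP[t0 tx]; rewrite normrM mulrC; apply: ler_pM => //.
    by apply: hM'; rewrite t0.
  by apply: le_trans (dle _ tx) _.
by rewrite Int_cst// mulrAC.
Qed.

Lemma mvt_bound (f df : R -> R) b M : 0 <= b ->
  (forall t : R, 0 <= t <= b -> is_derive t 1 f (df t)) ->
  (forall t : R, 0 <= t <= b -> `|df t| <= M) -> `|f b - f 0| <= M * b.
Proof.
move=> b0 dfd hM.
have cf : {within `[0%R, b], continuous f}.
  apply: derivable_within_continuous => t; rewrite in_itv /= => tb.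
  by have := dfd t tb => -[].
have [c cb ->] := @MVT_segment R f df 0 b b0 (fun t tb => dfd t (subset_itv_oo_cc tb)) cf.
rewrite subr0 normrM (ger0_norm b0); apply: ler_wpM2r => //; apply: hM.
by move: cb; rewrite in_itv.
Qed.

End RealIntegral.

(** * Complex trigonometric functions, and calculus for complex functions of a real variable *)

Section ComplexReal.
Context {R : realType}.
Local Notation C := R[i].
Local Notation Rez := (@complex.Re R).
Local Notation Imz := (@complex.Im R).
Implicit Types (z w : C) (x t : R).

Lemma is_derive_cast (f : R -> R) (v d d' : R) : is_derive v 1 f d -> d = d' -> is_derive v 1 f d'.
Proof. by move=> h <-. Qed.

Lemma is_derive_cosZ (a v : R) : is_derive v 1 (fun t : R => cos (a * t)) (- (a * sin (a * v))).
Proof.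
have h : is_derive v 1 (fun t : R => a * t) a.
  by apply: is_derive_eq; rewrite /= -[RHS]mulr1.
have := @is_derive1_comp _ cos _ v _ _ (is_derive_cos _) h.
by rewrite mulNr mulrC.
Qed.

Lemma is_derive_sinZ (a v : R) : is_derive v 1 (fun t : R => sin (a * t)) (a * cos (a * v)).
Proof.
have h : is_derive v 1 (fun t : R => a * t) a.
  by apply: is_derive_eq; rewrite /= -[RHS]mulr1.
have := @is_derive1_comp _ sin _ v _ _ (is_derive_sin _) h.
by rewrite mulrC.
Qed.

Lemma is_derive_expZ (a v : R) : is_derive v 1 (fun t : R => expR (a * t)) (a * expR (a * v)).
Proof.
have h : is_derive v 1 (fun t : R => a * t) a.
  by apply: is_derive_eq; rewrite /= -[RHS]mulr1.
have := @is_derive1_comp _ expR _ v _ _ (is_derive_expR _) h.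
by rewrite mulrC.
Qed.

Lemma is_derive_coshZ (a v : R) : is_derive v 1 (fun t : R => coshR (a * t)) (a * sinhR (a * v)).
Proof.
have h1 := is_derive_expZ a v; have h2 := is_derive_expZ (- a) v.
rewrite /coshR /sinhR.
have -> : (fun t => (expR (a * t) + expR (- (a * t))) / 2)
   = (fun t => 2^-1 * (expR (a * t) + expR (- a * t))).
  by apply/funext => t; rewrite mulrC mulNr.
apply: is_derive_eq; rewrite /GRing.scale /= !mulNr; ring.
Qed.

Lemma is_derive_sinhZ (a v : R) : is_derive v 1 (fun t : R => sinhR (a * t)) (a * coshR (a * v)).
Proof.
have h1 := is_derive_expZ a v; have h2 := is_derive_expZ (- a) v.
rewrite /coshR /sinhR.
have -> : (fun t => (expR (a * t) - expR (- (a * t))) / 2)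
   = (fun t => 2^-1 * (expR (a * t) - expR (- a * t))).
  by apply/funext => t; rewrite mulrC mulNr.
apply: is_derive_eq; rewrite /GRing.scale /= !mulNr; ring.
Qed.

Lemma coshRD (a b : R) : coshR (a + b) = coshR a * coshR b + sinhR a * sinhR b.
Proof. by rewrite /coshR /sinhR opprD !expRD; field. Qed.

Lemma sinhRD (a b : R) : sinhR (a + b) = sinhR a * coshR b + coshR a * sinhR b.
Proof. by rewrite /coshR /sinhR opprD !expRD; field. Qed.

Lemma coshRN (a : R) : coshR (- a) = coshR a.
Proof. by rewrite /coshR opprK addrC. Qed.

Lemma sinhRN (a : R) : sinhR (- a) = - sinhR a.
Proof. by rewrite /sinhR opprK; field. Qed.

Lemma coshR0 : coshR (0 : R) = 1.
Proof. by rewrite /coshR oppr0 expR0; field. Qed.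

Lemma sinhR0 : sinhR (0 : R) = 0.
Proof. by rewrite /sinhR oppr0 expR0 subrr mul0r. Qed.

Lemma ccosD z w : ccos (z + w) = ccos z * ccos w - csin z * csin w.
Proof.
case: z => a b; case: w => c d; rewrite /ccos /csin /=.
rewrite cosD sinD coshRD sinhRD; apply/eqP; rewrite eq_complex /=.
by apply/andP; split; apply/eqP; ring.
Qed.

Lemma csinD z w : csin (z + w) = csin z * ccos w + ccos z * csin w.
Proof.
case: z => a b; case: w => c d; rewrite /ccos /csin /=.
rewrite cosD sinD coshRD sinhRD; apply/eqP; rewrite eq_complex /=.
by apply/andP; split; apply/eqP; ring.
Qed.

Lemma ccosN z : ccos (- z) = ccos z.
Proof.
case: z => a b; rewrite /ccos /= cosN sinN coshRN sinhRN; apply/eqP; rewrite eq_complex /=.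
by rewrite eqxx mulrNN eqxx.
Qed.

Lemma csinN z : csin (- z) = - csin z.
Proof.
case: z => a b; rewrite /csin /= cosN sinN coshRN sinhRN; apply/eqP; rewrite eq_complex /=.
by rewrite mulNr mulrN !eqxx.
Qed.

Lemma ccos0 : ccos (0 : C) = 1.
Proof. by rewrite /ccos /= cos0 sin0 coshR0 sinhR0 mul1r mulr0 oppr0. Qed.

Lemma csin0 : csin (0 : C) = 0.
Proof. by rewrite /csin /= cos0 sin0 coshR0 sinhR0 mul0r mulr0. Qed.

Lemma cRD x t : cR (x + t) = cR x + cR t.
Proof. by apply/eqP; rewrite eq_complex /= addr0 !eqxx. Qed.

Lemma cRM x t : cR (x * t) = cR x * cR t.
Proof. by apply/eqP; rewrite eq_complex /= !(mulr0, mul0r) subr0 addr0 !eqxx. Qed.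

Lemma cRN x : cR (- x) = - cR x.
Proof. by apply/eqP; rewrite eq_complex /= oppr0 !eqxx. Qed.

Lemma cR0 : cR (0 : R) = 0.
Proof. by []. Qed.

Lemma cR1 : cR (1 : R) = 1.
Proof. by []. Qed.

Lemma cR_eq0 x : (cR x == 0) = (x == 0).
Proof. by rewrite eq_complex /= eqxx andbT. Qed.

Lemma cRV x : cR (x^-1) = (cR x)^-1.
Proof.
have [->|x0] := eqVneq x 0; first by rewrite invr0 cR0 invr0.
have c0 : cR x != 0 by rewrite cR_eq0.
by apply: (mulfI c0); rewrite mulfV// -cRM mulfV.
Qed.

Lemma cRn n : cR (n%:R : R) = n%:R.
Proof. by elim: n => [//|n IH]; rewrite -!natr1 cRD IH. Qed.

Lemma cR_sum n (f : nat -> R) : cR (\sum_(i < n) f i) = \sum_(i < n) cR (f i).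
Proof. by elim: n => [|n IH]; rewrite ?big_ord0// !big_ord_recr /= cRD IH. Qed.

Lemma cR_sign n : cR ((-1) ^+ n : R) = (-1) ^+ n.
Proof. by elim: n => [//|n IH]; rewrite !exprS cRM IH cRN. Qed.

Lemma ccos_cR x : ccos (cR x) = cR (cos x).
Proof. by rewrite /ccos /= coshR0 sinhR0 mulr1 mulr0 oppr0. Qed.

Lemma csin_cR x : csin (cR x) = cR (sin x).
Proof. by rewrite /csin /= coshR0 sinhR0 mulr1 mulr0. Qed.

Lemma mul_cR z x : z * cR x = Complex (Rez z * x) (Imz z * x).
Proof. by case: z => a b; apply/eqP; rewrite eq_complex /= !mulr0 subr0 add0r !eqxx. Qed.

Lemma ccos2Dcsin2 z : ccos z ^+ 2 + csin z ^+ 2 = 1.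
Proof. by rewrite -ccos0 -(subrr z) ccosD ccosN csinN; ring. Qed.

(* N1 is additive in the two real integrals that make up [cint], which [cabs] is not. *)
Definition N1 z : R := `|Rez z| + `|Imz z|.

Lemma N1_ge0 z : 0 <= N1 z. Proof. exact: addr_ge0. Qed.

Lemma N1D z w : N1 (z + w) <= N1 z + N1 w.
Proof.
case: z w => [a b] [c d]; rewrite /N1 /= addrACA.
by apply: lerD; apply: ler_normD.
Qed.

Lemma N1M z w : N1 (z * w) <= N1 z * N1 w.
Proof.
case: z w => [a b] [c d]; rewrite /N1 /=.
apply: (le_trans (lerD (ler_normB _ _) (ler_normD _ _))).
by rewrite !normrM le_eqVlt; apply/orP; left; apply/eqP; ring.
Qed.

Lemma N1N z : N1 (- z) = N1 z.
Proof. by case: z => a b; rewrite /N1 /= !normrN. Qed.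

Lemma N1B z w : N1 (z - w) <= N1 z + N1 w.
Proof. by rewrite -(N1N w) N1D. Qed.

Lemma N10 : N1 0 = 0. Proof. by rewrite /N1 /= normr0 addr0. Qed.

Lemma N1_cR x : N1 (cR x) = `|x|.
Proof. by rewrite /N1 /= normr0 addr0. Qed.

Lemma N1_cRM x z : N1 (cR x * z) = `|x| * N1 z.
Proof. by rewrite mulrC mul_cR /N1 /= !normrM -mulrDl mulrC. Qed.

Lemma N1_sum n (f : nat -> C) : N1 (\sum_(i < n) f i) <= \sum_(i < n) N1 (f i).
Proof.
elim: n => [|n IH]; first by rewrite !big_ord0 N10.
by rewrite !big_ord_recr /=; apply: le_trans (N1D _ _) _; rewrite lerD2r.
Qed.

Lemma cabs_le_N1 z : cabs z <= N1 z.
Proof.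
case: z => a b; rewrite /cabs /N1 /= -[leRHS]ger0_norm ?addr_ge0// -sqrtr_sqr.
rewrite ler_wsqrtr// sqrrD !real_normK ?num_real// lerD2r lerDl.
by rewrite mulrn_wge0// mulr_ge0.
Qed.

Lemma cabs_ge0 z : 0 <= cabs z. Proof. exact: sqrtr_ge0. Qed.

Lemma N1_le_cabs z : N1 z <= 2 * cabs z.
Proof.
case: z => a b; rewrite /cabs /N1 /=.
have h c d : `|c| <= Num.sqrt (c ^+ 2 + d ^+ 2) :> R.
  by rewrite -sqrtr_sqr ler_wsqrtr// lerDl sqr_ge0.
have := h a b; have := h b a; rewrite [b ^+ 2 + _]addrC; lra.
Qed.

Definition cintble x (f : R -> C) := intble x (Rez \o f) /\ intble x (Imz \o f).
Definition cbmeas x (f : R -> C) := bmeas x (Rez \o f) /\ bmeas x (Imz \o f).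
Definition ccontinuous (f : R -> C) := continuous (Rez \o f) /\ continuous (Imz \o f).
Definition is_cderive (F : R -> C) t (d : C) :=
  is_derive t 1 (Rez \o F) (Rez d) /\ is_derive t 1 (Imz \o F) (Imz d).

Lemma cReD z w : Rez (z + w) = Rez z + Rez w. Proof. by case: z w => [? ?] []. Qed.
Lemma cImD z w : Imz (z + w) = Imz z + Imz w. Proof. by case: z w => [? ?] []. Qed.
Lemma cReN z : Rez (- z) = - Rez z. Proof. by case: z. Qed.
Lemma cImN z : Imz (- z) = - Imz z. Proof. by case: z. Qed.
Lemma cReM z w : Rez (z * w) = Rez z * Rez w - Imz z * Imz w.
Proof. by case: z w => [? ?] []. Qed.
Lemma cImM z w : Imz (z * w) = Rez z * Imz w + Imz z * Rez w.
Proof. by case: z w => [? ?] []. Qed.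

Lemma cintbleD x f g : cintble x f -> cintble x g -> cintble x (fun t => f t + g t).
Proof.
move=> [f1 f2] [g1 g2]; split.
  by apply: eq_intble (intbleD f1 g1) => t _ /=; rewrite cReD.
by apply: eq_intble (intbleD f2 g2) => t _ /=; rewrite cImD.
Qed.

Lemma cbmeasD x f g : cbmeas x f -> cbmeas x g -> cbmeas x (fun t => f t + g t).
Proof.
move=> [f1 f2] [g1 g2]; split.
  by have := bmeasD f1 g1; congr bmeas; apply/funext => t /=; rewrite cReD.
by have := bmeasD f2 g2; congr bmeas; apply/funext => t /=; rewrite cImD.
Qed.

Lemma bmeas_cst x (k : R) : bmeas x (fun=> k).
Proof. exact/bmeas_continuous/cst_continuous. Qed.

Lemma cbmeas_cst x c : cbmeas x (fun=> c).
Proof. by split; exact: bmeas_cst. Qed.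

Lemma bmeasN x (f : R -> R) : bmeas x f -> bmeas x (fun t => - f t).
Proof.
move=> hf; have := bmeasM (bmeas_cst x (-1)) hf; congr bmeas.
by apply/funext => t; rewrite mulN1r.
Qed.

Lemma cbmeasM x f g : cbmeas x f -> cbmeas x g -> cbmeas x (fun t => f t * g t).
Proof.
move=> [f1 f2] [g1 g2]; split.
  have := bmeasD (bmeasM f1 g1) (bmeasN (bmeasM f2 g2)).
  by congr bmeas; apply/funext => t /=; rewrite cReM.
have := bmeasD (bmeasM f1 g2) (bmeasM f2 g1).
by congr bmeas; apply/funext => t /=; rewrite cImM.
Qed.

Lemma cbmeas_cintble x f : cbmeas x f -> cintble x f.
Proof. by move=> [? ?]; split; apply: bmeas_intble. Qed.

Lemma ccontinuous_cbmeas x f : ccontinuous f -> cbmeas x f.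
Proof. by move=> [? ?]; split; apply: bmeas_continuous. Qed.

Lemma cintbleM x f g : cintble x f -> cbmeas x g -> cintble x (fun t => f t * g t).
Proof.
move=> [f1 f2] [g1 g2]; split.
  apply: eq_intble (intbleD (intbleM f1 g1) (intbleN (intbleM f2 g2))) => t _ /=.
  by rewrite cReM.
apply: eq_intble (intbleD (intbleM f1 g2) (intbleM f2 g1)) => t _ /=.
by rewrite cImM.
Qed.

Lemma cintbleZ x c f : cintble x f -> cintble x (fun t => c * f t).
Proof.
move=> hf; have := cintbleM hf (cbmeas_cst x c).
by congr cintble; apply/funext => t; rewrite mulrC.
Qed.

Lemma cintbleN x f : cintble x f -> cintble x (fun t => - f t).
Proof.
move=> hf; have := cintbleZ (-1) hf.
by congr cintble; apply/funext => t; rewrite mulN1r.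
Qed.

Lemma cintble_sum x n (f : nat -> R -> C) : (forall i, (i < n)%N -> cintble x (f i)) ->
  cintble x (fun t => \sum_(i < n) f i t).
Proof.
elim: n => [|n IH] h.
  have := cbmeas_cintble (cbmeas_cst x 0).
  by congr cintble; apply/funext => t; rewrite big_ord0.
have := cintbleD (IH (fun i hi => h i (ltnW hi))) (h n (ltnSn n)).
by congr cintble; apply/funext => t; rewrite big_ord_recr.
Qed.

Lemma cbmeas_sum x n (f : nat -> R -> C) : (forall i, (i < n)%N -> cbmeas x (f i)) ->
  cbmeas x (fun t => \sum_(i < n) f i t).
Proof.
elim: n => [|n IH] h.
  have := cbmeas_cst x 0.
  by congr cbmeas; apply/funext => t; rewrite big_ord0.
have := cbmeasD (IH (fun i hi => h i (ltnW hi))) (h n (ltnSn n)).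
by congr cbmeas; apply/funext => t; rewrite big_ord_recr.
Qed.

Lemma cintbleW x y f : y <= x -> cintble x f -> cintble y f.
Proof. by move=> yx [? ?]; split; apply: intbleW yx _. Qed.

Lemma cbmeasW x y f : y <= x -> cbmeas x f -> cbmeas y f.
Proof. by move=> yx [? ?]; split; apply: bmeasW yx _. Qed.

Lemma eq_cint x f g : (forall t, 0 <= t <= x -> f t = g t) -> cint f 0 x = cint g 0 x.
Proof.
by move=> h; rewrite /cint; congr Complex; apply: eq_Int => t tx; rewrite h.
Qed.

Lemma cintD x f g : cintble x f -> cintble x g ->
  cint (fun t => f t + g t) 0 x = cint f 0 x + cint g 0 x.
Proof.
move=> [f1 f2] [g1 g2]; rewrite /cint; apply/eqP; rewrite eq_complex /=.
rewrite -!IntD//; apply/andP; split; apply/eqP; apply: eq_Int => t _.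
  by rewrite cReD.
by rewrite cImD.
Qed.

Lemma cintZ x c f : cintble x f -> cint (fun t => c * f t) 0 x = c * cint f 0 x.
Proof.
move=> [f1 f2]; case: c => a b; rewrite /cint; apply/eqP; rewrite eq_complex /=.
rewrite -!IntZ// -IntB -?IntD; try exact: intbleZ.
by apply/andP; split; apply/eqP; apply: eq_Int => t _; rewrite ?cReM ?cImM.
Qed.

Lemma cintN x f : cintble x f -> cint (fun t => - f t) 0 x = - cint f 0 x.
Proof.
move=> hf; rewrite -mulN1r -cintZ//.
by apply: eq_cint => t _; rewrite mulN1r.
Qed.

Lemma cintB x f g : cintble x f -> cintble x g ->
  cint (fun t => f t - g t) 0 x = cint f 0 x - cint g 0 x.
Proof. by move=> hf hg; rewrite cintD ?cintN//; apply: cintbleN. Qed.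

Lemma cint_sum x n (f : nat -> R -> C) : (forall i, (i < n)%N -> cintble x (f i)) ->
  cint (fun t => \sum_(i < n) f i t) 0 x = \sum_(i < n) cint (f i) 0 x.
Proof.
elim: n => [|n IH] h.
  rewrite big_ord0 (@eq_cint _ _ (fun t => 0 * 0)); last by move=> t _; rewrite big_ord0 mulr0.
  by rewrite (@cintZ x 0 (fun=> 0)) ?mul0r//; apply/cbmeas_cintble/cbmeas_cst.
rewrite big_ord_recr /= -IH; last by move=> i hi; apply: h; exact: ltnW.
rewrite -cintD; [|by apply: cintble_sum => i hi; apply: h; exact: ltnW|exact: h].
by apply: eq_cint => t _; rewrite big_ord_recr.
Qed.

Lemma intble_N1 x f : cintble x f -> intble x (fun t => N1 (f t)).
Proof. by move=> [f1 f2]; exact: intbleD (intble_norm f1) (intble_norm f2). Qed.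

Lemma N1_cint x f : cintble x f -> N1 (cint f 0 x) <= Rintegral (@lebesgue_measure R) `[0%R, x] (fun t => N1 (f t)).
Proof.
move=> [f1 f2]; rewrite /N1 /= IntD; try exact: intble_norm.
by apply: lerD; exact: norm_Int.
Qed.

Lemma is_cderiveN F t d : is_cderive F t d -> is_cderive (fun t => - F t) t (- d).
Proof.
move=> [h1 h2]; split.
  rewrite cReN; have := is_deriveN h1; congr is_derive; apply/funext => s /=; by rewrite cReN.
rewrite cImN; have := is_deriveN h2; congr is_derive; apply/funext => s /=; by rewrite cImN.
Qed.

Lemma is_cderiveD F G t d e : is_cderive F t d -> is_cderive G t e ->
  is_cderive (fun t => F t + G t) t (d + e).
Proof.
move=> [h1 h2] [g1 g2]; split.
  rewrite cReD; have := is_deriveD h1 g1; congr is_derive; apply/funext => s /=; by rewrite cReD.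
rewrite cImD; have := is_deriveD h2 g2; congr is_derive; apply/funext => s /=; by rewrite cImD.
Qed.

Lemma is_cderiveZ F t d c : is_cderive F t d -> is_cderive (fun t => c * F t) t (c * d).
Proof.
move=> [h1 h2]; split.
  rewrite cReM; have := is_deriveB (is_deriveZ (Rez c) h1) (is_deriveZ (Imz c) h2).
  by congr is_derive; apply/funext => s /=; rewrite cReM.
rewrite cImM; have := is_deriveD (is_deriveZ (Rez c) h2) (is_deriveZ (Imz c) h1).
by congr is_derive; apply/funext => s /=; rewrite cImM.
Qed.

Lemma is_cderive_cos z t : is_cderive (fun t => ccos (z * cR t)) t (- (z * csin (z * cR t))).
Proof.
have -> : (fun t => ccos (z * cR t)) = (fun t => Complex (cos (Rez z * t) * coshR (Imz z * t))
   (- (sin (Rez z * t) * sinhR (Imz z * t)))).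
  by apply/funext => s; rewrite mul_cR.
have h1 := is_derive_cosZ (Rez z) t; have h2 := is_derive_sinZ (Rez z) t.
have h3 := is_derive_coshZ (Imz z) t; have h4 := is_derive_sinhZ (Imz z) t.
rewrite mul_cR /csin; case: z h1 h2 h3 h4 => a b h1 h2 h3 h4; split.
  by apply: (is_derive_cast (is_deriveM h1 h3)); rewrite /GRing.scale /=; ring.
by apply: (is_derive_cast (is_deriveN (is_deriveM h2 h4))); rewrite /GRing.scale /=; ring.
Qed.

Lemma is_cderive_sin z t : is_cderive (fun t => csin (z * cR t)) t (z * ccos (z * cR t)).
Proof.
have -> : (fun t => csin (z * cR t)) = (fun t => Complex (sin (Rez z * t) * coshR (Imz z * t))
   (cos (Rez z * t) * sinhR (Imz z * t))).
  by apply/funext => s; rewrite mul_cR.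
have h1 := is_derive_cosZ (Rez z) t; have h2 := is_derive_sinZ (Rez z) t.
have h3 := is_derive_coshZ (Imz z) t; have h4 := is_derive_sinhZ (Imz z) t.
rewrite mul_cR /ccos; case: z h1 h2 h3 h4 => a b h1 h2 h3 h4; split.
  by apply: (is_derive_cast (is_deriveM h2 h3)); rewrite /GRing.scale /=; ring.
by apply: (is_derive_cast (is_deriveM h1 h4)); rewrite /GRing.scale /=; ring.
Qed.

Lemma is_cderive_continuous F f : (forall t, is_cderive F t (f t)) -> ccontinuous F.
Proof.
move=> h; split => t; have [[h1 _] [h2 _]] := h t;
  by apply: differentiable_continuous; apply/derivable1_diffP.
Qed.

Lemma cint_FTC x F f : 0 <= x -> ccontinuous f -> (forall t, is_cderive F t (f t)) ->
  cint f 0 x = F x - F 0.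
Proof.
move=> x0 [c1 c2] h.
have E1 := Int_FTC x0 c1 (fun t => proj1 (h t)).
have E2 := Int_FTC x0 c2 (fun t => proj2 (h t)).
rewrite /cint; apply/eqP; rewrite eq_complex /= cReD cImD cReN cImN.
by apply/andP; split; apply/eqP.
Qed.

Lemma cint_cbmeas x f : 0 <= x -> cintble x f -> cbmeas x (fun t => cint f 0 t).
Proof. by move=> x0 [f1 f2]; split; apply: bmeas_within; apply: Int_within. Qed.

Lemma cint_by_parts x f g g' : 0 <= x -> cintble x f -> ccontinuous g' ->
  (forall t, is_cderive g t (g' t)) ->
  cint (fun t => f t * g t) 0 x + cint (fun t => cint f 0 t * g' t) 0 x = g x * cint f 0 x.
Proof.
move=> x0 hf hg' dg.
have [cg1 cg2] := is_cderive_continuous dg.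
have [cg'1 cg'2] := hg'; have [f1 f2] := hf.
have d1 := fun t => proj1 (dg t); have d2 := fun t => proj2 (dg t).
have A := Int_by_parts x0 f1 cg'1 d1; have B := Int_by_parts x0 f2 cg'2 d2.
have D := Int_by_parts x0 f1 cg'2 d2; have E := Int_by_parts x0 f2 cg'1 d1.
have b1 := bmeas_continuous x cg1; have b2 := bmeas_continuous x cg2.
have b'1 := bmeas_continuous x cg'1; have b'2 := bmeas_continuous x cg'2.
have [F1 F2] := cint_cbmeas x0 hf.
apply/eqP; rewrite eq_complex cReD cImD cReM cImM /=.
apply/andP; split; apply/eqP.
  rewrite (@eq_Int _ _ _ (fun t => Rez (f t) * Rez (g t) - Imz (f t) * Imz (g t))); last first.
    by move=> t _; rewrite cReM.
  rewrite IntB; [|exact: (intbleM f1 b1)|exact: (intbleM f2 b2)].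
  rewrite [X in _ + X](@eq_Int _ _ _ (fun t => Rez (cint f 0 t) * Rez (g' t) - Imz (cint f 0 t) * Imz (g' t))); last first.
    by move=> t _; rewrite cReM.
  rewrite IntB; [|exact: (bmeas_intble (bmeasM F1 b'1))|exact: (bmeas_intble (bmeasM F2 b'2))].
  by rewrite addrACA -opprD; congr (_ - _).
rewrite (@eq_Int _ _ _ (fun t => Rez (f t) * Imz (g t) + Imz (f t) * Rez (g t))); last first.
  by move=> t _; rewrite cImM.
rewrite IntD; [|exact: (intbleM f1 b2)|exact: (intbleM f2 b1)].
rewrite [X in _ + X](@eq_Int _ _ _ (fun t => Rez (cint f 0 t) * Imz (g' t) + Imz (cint f 0 t) * Rez (g' t))); last first.
  by move=> t _; rewrite cImM.
rewrite IntD; [|exact: (bmeas_intble (bmeasM F1 b'2))|exact: (bmeas_intble (bmeasM F2 b'1))].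
by rewrite addrACA [RHS]addrC; congr (_ + _).
Qed.

End ComplexReal.

(** * Variation of constants *)

Section VariationOfConstants.
Context {R : realType}.
Local Notation C := R[i].
Implicit Types (z rho : C) (x t v : R).

(** The free solution sin (rho v) / rho with data 0, 1, extended by its limit [v] at rho = 0, so
    that the formulas below need no exception at 0. *)
Definition sn rho v : C := if rho == 0 then cR v else csin (rho * cR v) / rho.

Lemma mul_sn rho v : rho * sn rho v = csin (rho * cR v).
Proof.
rewrite /sn; case: eqVneq => [->|r0]; first by rewrite !mul0r csin0.
by rewrite mulrC divfK.
Qed.

Lemma sn0 rho : sn rho 0 = 0.
Proof. by rewrite /sn cR0 mulr0 csin0 mul0r; case: ifP. Qed.

Lemma is_cderive_sn rho t : is_cderive (sn rho) t (ccos (rho * cR t)).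
Proof.
rewrite /sn; case: eqVneq => [->|r0].
  by rewrite mul0r ccos0; split=> /=; [exact: is_derive_id|exact: is_derive_cst].
have := is_cderiveZ rho^-1 (is_cderive_sin rho t); rewrite mulKf//.
by congr is_cderive; apply/funext => s; rewrite mulrC.
Qed.

Lemma is_cderive_cos_sn rho t : is_cderive (fun t => ccos (rho * cR t)) t (- (rho ^+ 2 * sn rho t)).
Proof. by have := is_cderive_cos rho t; rewrite expr2 -mulrA mul_sn. Qed.

Lemma ccontinuous_cos rho : ccontinuous (fun t => ccos (rho * cR t)).
Proof. by apply: is_cderive_continuous => t; exact: is_cderive_cos. Qed.

Lemma ccontinuous_sn rho : ccontinuous (sn rho).
Proof. by apply: is_cderive_continuous => t; exact: is_cderive_sn. Qed.

Lemma is_cderive_rev (F : R -> C) x t d : is_cderive F (x - t) d ->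
  is_cderive (fun t => F (x - t)) t (- d).
Proof.
have h : is_derive t 1 (fun t : R => x - t) (-1).
  by apply: (is_derive_cast (is_deriveB (is_derive_cst x t 1) (is_derive_id t 1))); rewrite sub0r.
move=> [h1 h2]; split; rewrite ?cReN ?cImN.
  apply: (is_derive_cast (@is_derive1_comp R (complex.Re (R:=R) \o F) (fun t => x - t) t _ _ h1 h)).
  exact: mulrN1.
apply: (is_derive_cast (@is_derive1_comp R (complex.Im (R:=R) \o F) (fun t => x - t) t _ _ h2 h)).
exact: mulrN1.
Qed.

Lemma is_cderive_revN (F : R -> C) x t d : is_cderive F (x - t) (- d) ->
  is_cderive (fun t => F (x - t)) t d.
Proof. by move=> /is_cderive_rev; rewrite opprK. Qed.

Lemma ccontinuous_comp (F : R -> C) (u : R -> R) : ccontinuous F -> continuous u -> ccontinuous (F \o u).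
Proof.
move=> [c1 c2] cu; split => t.
  by apply: (@continuous_comp _ _ _ u (complex.Re (R:=R) \o F)); [exact: cu|exact: c1].
by apply: (@continuous_comp _ _ _ u (complex.Im (R:=R) \o F)); [exact: cu|exact: c2].
Qed.

Lemma continuous_subr x : continuous (fun t : R => x - t).
Proof. by move=> t; apply: cvgB; [exact: cvg_cst|exact: cvg_id]. Qed.

Lemma ccontinuous_rev (F : R -> C) x : ccontinuous F -> ccontinuous (fun t => F (x - t)).
Proof. by move=> cF; exact: ccontinuous_comp cF (@continuous_subr x). Qed.

Lemma ccontinuousZ (F : R -> C) c : ccontinuous F -> ccontinuous (fun t => c * F t).
Proof.
have lin a b (f g : R -> R) : continuous f -> continuous g -> continuous (fun t => a * f t + b * g t).
  move=> cf cg t; apply: cvgD; apply: cvgM; [exact: cvg_cst|exact: cf|exact: cvg_cst|exact: cg].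
move=> [c1 c2]; split.
  rewrite (_ : _ \o _ = (fun t => complex.Re c * complex.Re (F t) + (- complex.Im c) * complex.Im (F t))).
    exact: lin.
  by apply/funext => t; rewrite /= cReM mulNr.
rewrite (_ : _ \o _ = (fun t => complex.Re c * complex.Im (F t) + complex.Im c * complex.Re (F t))).
  exact: lin.
by apply/funext => t; rewrite /= cImM.
Qed.

Lemma cint_cos rho x : 0 <= x -> cint (fun t => ccos (rho * cR t)) 0 x = sn rho x.
Proof.
move=> x0; rewrite (cint_FTC x0 (ccontinuous_cos rho) (is_cderive_sn rho)).
by rewrite sn0 subr0.
Qed.

Lemma cint_by_parts_gen x f (g g' G : R -> C) G0 : 0 <= x -> cintble x f -> ccontinuous g' ->
  (forall t, is_cderive g t (g' t)) -> (forall t, 0 <= t <= x -> G t = G0 + cint f 0 t) ->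
  cint (fun t => f t * g t) 0 x + cint (fun t => G t * g' t) 0 x = g x * G x - g 0 * G0.
Proof.
move=> x0 hf cg' dg hG.
have hc := cint_cbmeas x0 hf; have hg' := ccontinuous_cbmeas x cg'.
rewrite (@eq_cint _ _ (fun t => G t * g' t) (fun t => G0 * g' t + cint f 0 t * g' t)); last first.
  by move=> t /hG ->; rewrite mulrDl.
rewrite cintD; [|exact/cintbleZ/cbmeas_cintble|exact/cbmeas_cintble/cbmeasM].
rewrite addrCA (cint_by_parts x0 hf cg' dg) cintZ; last exact: cbmeas_cintble.
by rewrite (cint_FTC x0 cg' dg) hG ?x0 ?lexx//; ring.
Qed.

(** Only the integrated equations are available: [dy] need not be differentiable at every point. The
    formulas therefore come from integrating by parts against the reversed free solutions in
    [x - t], with the boundary terms supplied by their values at 0 and [x]. *)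
Lemma variation_of_constants L rho y0 y1 (y dy f : R -> C) :
  cbmeas L y -> cbmeas L dy -> cintble L f ->
  (forall x, 0 <= x <= L -> y x = y0 + cint dy 0 x) ->
  (forall x, 0 <= x <= L -> dy x = y1 + cint (fun t => f t - rho ^+ 2 * y t) 0 x) ->
  forall x, 0 <= x <= L ->
   y x = y0 * ccos (rho * cR x) + y1 * sn rho x + cint (fun t => f t * sn rho (x - t)) 0 x /\
   dy x = - (rho ^+ 2 * sn rho x * y0) + y1 * ccos (rho * cR x)
          + cint (fun t => f t * ccos (rho * cR (x - t))) 0 x.
Proof.
move=> by_ bdy hf Hy Hdy x /andP[x0 xL].
pose k t := f t - rho ^+ 2 * y t.
have by' := cbmeasW xL by_; have bdy' := cbmeasW xL bdy; have hf' := cintbleW xL hf.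
have iy := cbmeas_cintble by'; have idy := cbmeas_cintble bdy'.
have ik : cintble x k by apply: cintbleD => //; apply/cintbleN/cintbleZ.
pose cs t := ccos (rho * cR (x - t)); pose sx t := sn rho (x - t).
have ccs : ccontinuous cs by exact: (ccontinuous_rev x (ccontinuous_cos rho)).
have csx : ccontinuous sx by exact: (ccontinuous_rev x (ccontinuous_sn rho)).
have dcs t : is_cderive cs t (rho ^+ 2 * sx t).
  exact: (is_cderive_revN (is_cderive_cos_sn rho (x - t))).
have dsx t : is_cderive sx t (-1 * cs t).
  by rewrite mulN1r; exact: (is_cderive_rev (is_cderive_sn rho (x - t))).
have Hy' t : 0 <= t <= x -> y t = y0 + cint dy 0 t.
  by move=> /andP[t0 tx]; rewrite -Hy// t0 (le_trans tx).
have Hdy' t : 0 <= t <= x -> dy t = y1 + cint k 0 t.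
  by move=> /andP[t0 tx]; rewrite -Hdy// t0 (le_trans tx).
(* [P1] and [P2] give the formula for [y], where the integral of [dy * cs] cancels. [P3] and [P4]
   give the one for [dy], where the integrals of [y * cs] and [dy * sx] are traded for a boundary
   term. *)
have P1 := cint_by_parts_gen x0 idy (ccontinuousZ (rho ^+ 2) csx) dcs Hy'.
have P2 := cint_by_parts_gen x0 ik (ccontinuousZ (-1) ccs) dsx Hdy'.
have P3 := cint_by_parts_gen x0 ik (ccontinuousZ (rho ^+ 2) csx) dcs Hdy'.
have P4 := cint_by_parts_gen x0 idy (ccontinuousZ (-1) ccs) dsx Hy'.
have bcs := ccontinuous_cbmeas x ccs; have bsx := ccontinuous_cbmeas x csx.
have csxx : cs x = 1 by rewrite /cs subrr mulr0 ccos0.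
have cs0 : cs 0 = ccos (rho * cR x) by rewrite /cs subr0.
have sxx : sx x = 0 by rewrite /sx subrr sn0.
have sx0 : sx 0 = sn rho x by rewrite /sx subr0.
rewrite csxx cs0 in P1 P3; rewrite sxx sx0 in P2 P4.
have Z (c : C) (u v : R -> C) : cintble x u -> cbmeas x v ->
    cint (fun t => u t * (c * v t)) 0 x = c * cint (fun t => u t * v t) 0 x.
  move=> hu hv; rewrite -cintZ; last exact: cintbleM.
  by apply: eq_cint => t _; rewrite mulrCA.
have K (v : R -> C) : cbmeas x v -> cint (fun t => k t * v t) 0 x =
    cint (fun t => f t * v t) 0 x - rho ^+ 2 * cint (fun t => y t * v t) 0 x.
  move=> hv; rewrite -cintZ; last exact: cintbleM.
  rewrite -cintB; [|exact: cintbleM|exact/cintbleZ/cintbleM].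
  by apply: eq_cint => t _; rewrite /k mulrBl mulrA.
rewrite !Z ?K// in P1 P2 P3 P4; rewrite -/cs -/sx.
rewrite mul1r in P1; rewrite mul1r in P3; rewrite mul0r sub0r mulN1r in P2; rewrite mul0r sub0r mulN1r in P4.
split.
  have -> : y x = y x - ccos (rho * cR x) * y0 + ccos (rho * cR x) * y0 by rewrite subrK.
  rewrite -P1.
  move: P2; set A := cint _ _ _; set B := cint _ _ _; set D := cint _ _ _ => P2.
  have -> : y1 * sn rho x = - (A - rho ^+ 2 * B - D) by rewrite P2; ring.
  ring.
have -> : dy x = dy x - ccos (rho * cR x) * y1 + ccos (rho * cR x) * y1 by rewrite subrK.
rewrite -P3.
move: P4; set A := cint _ _ _; set B := cint _ _ _; set D := cint _ _ _ => P4.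
have -> : rho ^+ 2 * sn rho x * y0 = - (rho ^+ 2 * (A - B)) by rewrite P4; ring.
ring.
Qed.

End VariationOfConstants.

(** * The Volterra equation tested against finite families of frequencies *)

Section FiniteFunctionals.
Context {R : realType}.
Local Notation C := R[i].
Local Notation mu := (@lebesgue_measure R).
Local Notation Int x f := (Rintegral mu `[0%R, x] f).
Implicit Types (z rho : C) (x t v : R).

Lemma N1_cint_le x f (g : R -> R) : cintble x f -> intble x g ->
  (forall t, 0 <= t <= x -> N1 (f t) <= g t) -> N1 (cint f 0 x) <= Int x g.
Proof.
move=> hf hg h; apply: le_trans (N1_cint hf) _.
by apply: le_Int => //; exact: intble_N1.
Qed.

Lemma cbmeas_bound x f : cbmeas x f -> exists M, forall t, 0 <= t <= x -> N1 (f t) <= M.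
Proof.
move=> [[_ [M hM]] [_ [N hN]]]; exists (M + N) => t tx.
by apply: lerD; [exact: hM|exact: hN].
Qed.

Lemma ler_geometric (a b c : R) : (forall m, a <= b + c / 2 ^+ m) -> a <= b.
Proof.
move=> h; apply/ler_addgt0Pr => e e0.
have [c0|c0] := leP c 0.
  apply: le_trans (h 0%N) _; rewrite expr0 divr1 lerD2l.
  exact: le_trans c0 (ltW e0).
have [m hm] : exists m, c / e < m%:R.
  exists (Num.bound (c / e)); have := archi_boundP (ltW (divr_gt0 c0 e0)).
  by apply: le_lt_trans.
apply: le_trans (h m) _; rewrite lerD2l ler_pdivrMr ?exprn_gt0//.
rewrite -ler_pdivrMl// mulrC; apply: le_trans (ltW hm) _.
by rewrite -natrX ler_nat ltnW// ltn_expl.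
Qed.

(** In the norm weighted by exp (lam t) a Volterra operator becomes as small as desired for large
    lam. Square integrability of [p] makes this quantitative, since the integral of exp (2 lam u)
    gains a factor 1 / lam. *)
Lemma weighted_Int_le L (p : R -> R) : intble L p -> intble L (fun t => p t ^+ 2) ->
  (forall t, 0 <= p t) ->
  forall eta, 0 < eta -> exists2 lam, 0 < lam &
    forall t, 0 <= t <= L -> Int t (fun u => p u * expR (lam * u)) <= eta * expR (lam * t).
Proof.
move=> hp hp2 p0 eta eta0.
pose B := Int L (fun t => p t ^+ 2).
have B0 : 0 <= B by apply: Rintegral_ge0 => t _; exact: sqr_ge0.
(* [d] and [lam] balance the two halves of the AM-GM bound: the part in [p ^+ 2] contributes d B / 2
   <= eta / 2, and the exponential part 1 / (4 d lam) = eta / 4. *)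
pose d := eta / (B + 1).
have d0 : 0 < d by rewrite divr_gt0// ltr_wpDl.
pose lam := (d * eta)^-1.
have lam0 : 0 < lam by rewrite invr_gt0 mulr_gt0.
exists lam => // t /andP[t0 tL].
have cexp (a : R) : continuous (fun u : R => expR (a * u)).
  move=> u; apply: differentiable_continuous; apply/derivable1_diffP.
  by have [] := is_derive_expZ a u.
have iexp a : intble t (fun u => expR (a * u)) by apply/bmeas_intble/bmeas_continuous.
have Iexp : Int t (fun u => expR (2 * lam * u)) <= expR (2 * lam * t) / (2 * lam).
  have l20 : 2 * lam != 0 by rewrite mulf_neq0 ?gt_eqF.
  have dE (u : R) : is_derive u 1 (fun u : R => (2 * lam)^-1 * expR (2 * lam * u)) (expR (2 * lam * u)).
    apply: (is_derive_cast (is_deriveZ (2 * lam)^-1 (is_derive_expZ (2 * lam) u))).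
    by rewrite /GRing.scale /= mulKf.
  rewrite (Int_FTC t0 (cexp (2 * lam)) dE).
  by rewrite mulrC lerBlDr lerDl mulr_ge0 ?expR_ge0// invr_ge0 mulr_ge0// ltW.
have hp2t := intbleW tL hp2.
pose a1 := 2^-1 * d * expR (lam * t); pose a2 := 2^-1 / d * expR (- (lam * t)).
have d0' := ltW d0.
have di0 : 0 <= d^-1 by rewrite invr_ge0.
have a10 : 0 <= a1 by apply: mulr_ge0 => //; apply: mulr_ge0.
have a20 : 0 <= a2 by apply: mulr_ge0 => //; apply: mulr_ge0.
apply: (@le_trans _ _ (Int t (fun u => a1 * p u ^+ 2 + a2 * expR (2 * lam * u)))).
  apply: le_Int.
  - apply: intbleM; first exact: intbleW hp.
    exact: bmeas_continuous.
  - by apply: intbleD; exact: intbleZ.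
  - move=> u _; set E := expR (lam * u).
    have -> : expR (2 * lam * u) = E ^+ 2 by rewrite expr2 -expRD; congr expR; ring.
    have e0 := expR_gt0 (lam * t); rewrite /a1 /a2 expRN; set T := expR (lam * t) in e0 *.
    (* AM-GM: 2 p E <= d T p^2 + E^2 / (d T) *)
    rewrite -subr_ge0.
    have -> : 2^-1 * d * T * p u ^+ 2 + 2^-1 / d * T^-1 * E ^+ 2 - p u * E
      = 2^-1 * (d * T)^-1 * (d * T * p u - E) ^+ 2.
      by field; rewrite !gt_eqF.
    by rewrite mulr_ge0 ?sqr_ge0// mulr_ge0// invr_ge0 mulr_ge0// ltW.
rewrite IntD ?IntZ//; try exact: intbleZ.
have hB : Int t (fun u => p u ^+ 2) <= B.
  by apply: le_Int_itv => // u; exact: sqr_ge0.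
apply: le_trans (lerD (ler_wpM2l a10 hB) (ler_wpM2l a20 Iexp)) _.
rewrite /a1 /a2 expRN.
have -> : expR (2 * lam * t) = expR (lam * t) ^+ 2.
  by rewrite expr2 -expRD; congr expR; ring.
have e0 := expR_gt0 (lam * t); set T := expR (lam * t) in e0 *.
have -> : 2^-1 * d * T * B + 2^-1 / d / T * (T ^+ 2 / (2 * lam)) = T * (2^-1 * (d * B) + 4^-1 * eta).
  rewrite /lam; field; rewrite !gt_eqF//.
rewrite mulrC ler_wpM2r// ?ltW//.
have : d * B <= eta.
  by rewrite /d mulrAC ler_pdivrMr ?ltr_wpDl// ler_wpM2l ?lerDl// ltW.
by move: eta0; clear; lra.
Qed.

Lemma ccosM rho a b : ccos (rho * cR a) * ccos (rho * cR b) =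
  cR 2^-1 * (ccos (rho * cR (a + b)) + ccos (rho * cR (a - b))).
Proof.
rewrite !cRD !mulrDr !ccosD cRN mulrN ccosN csinN cRV.
have -> : cR (2 : R) = 2 by exact: (cRn 2).
by field.
Qed.

(** Since [sn (r j)] is the primitive of the cosine of frequency [r j], the bound on the cosines is
    integrated over [[0, w]]. *)
Lemma sum_sn_le J (d r : nat -> C) w M : 0 <= w ->
  (forall v, 0 <= v <= w -> N1 (\sum_(j < J) d j * ccos (r j * cR v)) <= M) ->
  N1 (\sum_(j < J) d j * sn (r j) w) <= M * w.
Proof.
move=> w0 h.
have ic j : cintble w (fun v => ccos (r j * cR v)).
  exact/cbmeas_cintble/ccontinuous_cbmeas/ccontinuous_cos.
have -> : \sum_(j < J) d j * sn (r j) w = cint (fun v => \sum_(j < J) d j * ccos (r j * cR v)) 0 w.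
  rewrite (@cint_sum _ w J (fun j v => d j * ccos (r j * cR v))).
    by apply: eq_bigr => j _; rewrite cintZ// cint_cos.
  by move=> j _; exact: cintbleZ.
rewrite -Int_cst//; apply: N1_cint_le => //.
- by apply: (@cintble_sum _ w J (fun j v => d j * ccos (r j * cR v))) => j _; exact: cintbleZ.
- exact/bmeas_intble/bmeas_cst.
Qed.

(* If the left side is at most E exp (l t), with l large depending on q only,
   the Volterra equation improves this to (A e + E / 2) exp (l t); iterate. *)
Lemma functional_bound L (q : R -> C) y0 y1 (y : C -> R -> C) tau : 0 < L -> cintble L q ->
  intble L (fun t => N1 (q t) ^+ 2) -> (forall rho, cbmeas L (y rho)) ->
  (forall rho x, 0 <= x <= L -> y rho x = y0 * ccos (rho * cR x) + y1 * sn rho x +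
     cint (fun t => q t * y rho t * sn rho (x - t)) 0 x) ->
  exists2 K, 0 <= K & forall J (b r : nat -> C) e, 0 <= e ->
    (forall s, `|s| <= tau -> N1 (\sum_(j < J) b j * ccos (r j * cR s)) <= e) ->
    forall t s, 0 <= t <= L -> t + `|s| <= tau ->
      N1 (\sum_(j < J) b j * (y (r j) t * ccos (r j * cR s))) <= K * e.
Proof.
move=> L0 hq hq2 hy Hy.
have hqn := intble_N1 hq.
have L0' := ltW L0.
(* Passing from cosines to [sn] costs a factor at most L; this eta absorbs it, as L * eta <= 1 / 2,
   and produces the term [E / 2] of [rec]. *)
have eta0 : 0 < (2 * (L + 1))^-1 by rewrite invr_gt0 mulr_gt0// addr_gt0.
have [lam lam0 hlam] := weighted_Int_le hqn hq2 (fun t => N1_ge0 (q t)) eta0.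
pose A0 := N1 y0 + N1 y1 * L.
have A00 : 0 <= A0 by rewrite addr_ge0 ?N1_ge0// mulr_ge0 ?N1_ge0.
exists (2 * A0 * expR (lam * L)); first by rewrite !mulr_ge0// expR_ge0.
move=> J b r e e0 he.
pose D t s := \sum_(j < J) b j * (y (r j) t * ccos (r j * cR s)).
have exp1 t : 0 <= t -> 1 <= expR (lam * t).
  by move=> t0; rewrite -expR0 ler_expR mulr_ge0// ltW.
(* A crude bound that depends on the weights and nodes. It only starts the iteration, whose halvings
   remove it. *)
have [K K0 hK] : exists2 K, 0 <= K & forall t s, 0 <= t <= L -> t + `|s| <= tau -> N1 (D t s) <= K.
  rewrite /D; elim: J {he D} => [|J [K K0 IH]].
    by exists 0 => // t s _ _; rewrite big_ord0 N10.
  have [M hM] := cbmeas_bound (hy (r J)).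
  have [M' hM'] := cbmeas_bound (ccontinuous_cbmeas tau (ccontinuous_cos (r J))).
  exists (K + N1 (b J) * (`|M| * `|M'|)).
    by rewrite addr_ge0 ?mulr_ge0 ?N1_ge0.
  move=> t s tL ts; rewrite big_ord_recr /=.
  apply: le_trans (N1D _ _) _; apply: lerD; first exact: IH.
  apply: le_trans (N1M _ _) _; apply: ler_wpM2l; first exact: N1_ge0.
  apply: le_trans (N1M _ _) _; apply: ler_pM; rewrite ?N1_ge0//.
    by apply: le_trans (hM _ tL) (ler_norm _).
  apply: le_trans (ler_norm _).
  have -> : ccos (r J * cR s) = ccos (r J * cR `|s|).
    by case: ler0P => // _; rewrite cRN mulrN ccosN.
  apply: hM'; rewrite normr_ge0 /=; apply: le_trans ts.
  by case/andP: tL => t0 _; rewrite lerDr.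
have rec E : 0 <= E ->
    (forall t s, 0 <= t <= L -> t + `|s| <= tau -> N1 (D t s) <= E * expR (lam * t)) ->
    forall t s, 0 <= t <= L -> t + `|s| <= tau -> N1 (D t s) <= (A0 * e + E / 2) * expR (lam * t).
  move=> E0 hE t s /andP[t0 tL] ts.
  have cc v : 0 <= v <= t -> N1 (\sum_(j < J) b j * ccos (r j * cR s) * ccos (r j * cR v)) <= e.
    move=> /andP[v0 vt].
    have -> : \sum_(j < J) b j * ccos (r j * cR s) * ccos (r j * cR v) = cR 2^-1 *
       (\sum_(j < J) b j * ccos (r j * cR (s + v)) + \sum_(j < J) b j * ccos (r j * cR (s - v))).
      rewrite -big_split /= mulr_sumr; apply: eq_bigr => j _.
      by rewrite -mulrA ccosM; ring.
    rewrite N1_cRM ger0_norm ?invr_ge0// mulrC ler_pdivrMr// mulr_natr mulr2n.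
    apply: le_trans (N1D _ _) _; apply: lerD; apply: he; apply: le_trans ts.
      by apply: le_trans (ler_normD _ _) _; rewrite (ger0_norm v0) addrC lerD2r.
    by apply: le_trans (ler_normB _ _) _; rewrite (ger0_norm v0) addrC lerD2r.
  pose h u := \sum_(j < J) (b j * y (r j) u * ccos (r j * cR s)) * sn (r j) (t - u).
  have bh : cbmeas t h.
    apply: (@cbmeas_sum _ t J (fun j u => (b j * y (r j) u * ccos (r j * cR s)) * sn (r j) (t - u))) => j _.
    apply: cbmeasM.
      apply: cbmeasM; last exact: cbmeas_cst.
      apply: cbmeasM; first exact: cbmeas_cst.
      exact: cbmeasW (hy _).
    exact/ccontinuous_cbmeas/ccontinuous_rev/ccontinuous_sn.
  have iqs := cintbleW tL hq.
  have -> : D t s = y0 * (\sum_(j < J) b j * ccos (r j * cR s) * ccos (r j * cR t))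
     + y1 * (\sum_(j < J) b j * ccos (r j * cR s) * sn (r j) t)
     + cint (fun u => q u * h u) 0 t.
    have -> : cint (fun u => q u * h u) 0 t = \sum_(j < J) b j * ccos (r j * cR s) *
        cint (fun u => q u * y (r j) u * sn (r j) (t - u)) 0 t.
      rewrite (@eq_cint _ _ _ (fun u => \sum_(j < J) b j * ccos (r j * cR s) *
         (q u * y (r j) u * sn (r j) (t - u)))); last first.
        by move=> u _; rewrite mulr_sumr; apply: eq_bigr => j _; ring.
      have ii j : cintble t (fun u => q u * y (r j) u * sn (r j) (t - u)).
        apply: cintbleM; last exact/ccontinuous_cbmeas/ccontinuous_rev/ccontinuous_sn.
        by apply: cintbleM => //; exact: cbmeasW (hy _).
      rewrite (@cint_sum _ t J (fun j u => b j * ccos (r j * cR s) *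
         (q u * y (r j) u * sn (r j) (t - u)))).
        by apply: eq_bigr => j _; rewrite cintZ.
      by move=> j _; exact: cintbleZ.
    rewrite !mulr_sumr -!big_split /=; apply: eq_bigr => j _.
    by rewrite Hy ?t0//; ring.
  have I1 : N1 (y0 * (\sum_(j < J) b j * ccos (r j * cR s) * ccos (r j * cR t))) <= N1 y0 * e.
    apply: le_trans (N1M _ _) _; apply: ler_wpM2l; first exact: N1_ge0.
    by apply: cc; rewrite t0 lexx.
  have I2 : N1 (y1 * (\sum_(j < J) b j * ccos (r j * cR s) * sn (r j) t)) <= N1 y1 * L * e.
    apply: le_trans (N1M _ _) _; rewrite -mulrA; apply: ler_wpM2l; first exact: N1_ge0.
    apply: le_trans (@sum_sn_le J (fun j => b j * ccos (r j * cR s)) r t e t0 cc) _.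
    by rewrite mulrC; apply: ler_wpM2r.
  have I3 : N1 (cint (fun u => q u * h u) 0 t) <= E / 2 * expR (lam * t).
    have bexp : bmeas t (fun u => expR (lam * u)).
      apply: bmeas_continuous => u; apply: differentiable_continuous; apply/derivable1_diffP.
      by have [] := is_derive_expZ lam u.
    have iqe : intble t (fun u => N1 (q u) * expR (lam * u)).
      by apply: intbleM => //; exact: intbleW hqn.
    apply: (@le_trans _ _ (Int t (fun u => (L * E) * (N1 (q u) * expR (lam * u))))).
      apply: N1_cint_le; [exact: cintbleM|exact: intbleZ|].
      move=> u /andP[u0 ut]; apply: le_trans (N1M _ _) _; rewrite mulrCA.
      apply: ler_wpM2l; first exact: N1_ge0.
      apply: (@le_trans _ _ (E * expR (lam * u) * (t - u))).
        apply: (@sum_sn_le J (fun j => b j * y (r j) u * ccos (r j * cR s)) r).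
          by rewrite subr_ge0.
        (* The product of cosines moves [s] to [s + v] and [s - v] with [v <= t - u], so
           [u + |s +- v| <= t + |s| <= tau]: the domain of dependence is preserved and [hE] applies
           at the earlier time [u]. *)
        move=> v /andP[v0 vt].
        have -> : \sum_(j < J) b j * y (r j) u * ccos (r j * cR s) * ccos (r j * cR v) =
            cR 2^-1 * (D u (s + v) + D u (s - v)).
          rewrite /D -big_split /= mulr_sumr; apply: eq_bigr => j _.
          by rewrite -mulrA ccosM; ring.
        rewrite N1_cRM ger0_norm ?invr_ge0// mulrC ler_pdivrMr// mulr_natr mulr2n.
        have uL : 0 <= u <= L by rewrite u0 (le_trans ut tL).
        apply: le_trans (N1D _ _) _; apply: lerD; apply: hE => //; apply: le_trans ts.
          have := ler_normD s v; rewrite (ger0_norm v0) => hsv.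
          by move: hsv vt; clear; lra.
        have := ler_normB s v; rewrite (ger0_norm v0) => hsv.
        by move: hsv vt; clear; lra.
      have -> : L * E * expR (lam * u) = E * expR (lam * u) * L by ring.
      apply: ler_wpM2l; first by rewrite mulr_ge0 ?expR_ge0.
      by apply: le_trans tL; rewrite lerBlDr lerDl.
    rewrite IntZ//.
    apply: le_trans (ler_wpM2l _ (hlam t _)) _; rewrite ?mulr_ge0 ?t0//.
    rewrite mulrA; apply: ler_wpM2r; first exact: expR_ge0.
    have L1 : 0 < L + 1 by rewrite addr_gt0.
    have -> : L * E * (2 * (L + 1))^-1 = E / 2 * (L / (L + 1)) by field; rewrite gt_eqF.
    by rewrite ler_piMr ?divr_ge0// ler_pdivrMr// mul1r lerDl.
  apply: le_trans (N1D _ _) _; rewrite mulrDl; apply: lerD => //.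
  apply: le_trans (N1D _ _) _.
  apply: (@le_trans _ _ (A0 * e)); first by rewrite /A0 mulrDl; exact: lerD.
  by rewrite ler_peMr ?exp1// mulr_ge0.
(* [2 * A0 * e] is the fixed point of E |-> A0 * e + E / 2, and the distance [K] to it is halved at
   each step. *)
have iter m : forall t s, 0 <= t <= L -> t + `|s| <= tau ->
    N1 (D t s) <= (2 * A0 * e + K / 2 ^+ m) * expR (lam * t).
  elim: m => [|m IH] t s tL ts.
    rewrite expr0 divr1; apply: le_trans (hK _ _ tL ts) _.
    case/andP: tL => t0 _.
    apply: (@le_trans _ _ (K * expR (lam * t))); first by rewrite ler_peMr// exp1.
    by rewrite ler_wpM2r ?expR_ge0// lerDr !mulr_ge0.
  apply: le_trans (rec _ _ IH _ _ tL ts) _.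
    by rewrite addr_ge0 ?mulr_ge0// invr_ge0 exprn_ge0.
  apply: ler_wpM2r; first exact: expR_ge0.
  rewrite le_eqVlt; apply/orP; left; apply/eqP; rewrite exprS; field.
  by rewrite expf_neq0// pnatr_eq0.
move=> t s tL ts.
have h2 m : N1 (D t s) <= (2 * A0 * e + K / 2 ^+ m) * expR (lam * L).
  apply: le_trans (iter m t s tL ts) _; apply: ler_wpM2l.
    by rewrite addr_ge0 ?mulr_ge0// invr_ge0 exprn_ge0.
  rewrite ler_expR; apply: ler_wpM2l; first exact: ltW.
  by case/andP: tL.
rewrite -/(D t s) mulrAC; apply: (@ler_geometric _ _ (K * expR (lam * L))) => m.
by apply: le_trans (h2 m) _; rewrite mulrDl lerD2l mulrAC.
Qed.

End FiniteFunctionals.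

(** * Expansion of cos (z t) in the cosines cos (n t) *)

Section QuadraticSeries.
Context {R : realType}.
Implicit Types (t v b : R) (n N M k : nat).

Lemma is_derive_bigsum n (f : nat -> R -> R) (d : nat -> R) t :
  (forall i, is_derive t 1 (f i) (d i)) ->
  is_derive t 1 (fun s => \sum_(i < n) f i s) (\sum_(i < n) d i).
Proof.
move=> h; elim: n => [|n IH].
  rewrite big_ord0 (_ : (fun _ => _) = cst 0); first exact: is_derive_cst.
  by apply/funext => s; rewrite big_ord0.
rewrite big_ord_recr /= (_ : (fun _ => _) = (fun s => \sum_(i < n) f i s) + f n).
  exact: is_deriveD.
by apply/funext => s; rewrite big_ord_recr.
Qed.

(* Partial sums of the Fourier series of the sawtooth -t/2 on ]-pi, pi[, minus the limit. *)
Definition osc_sum N t : R := \sum_(i < N) (-1) ^+ i.+1 * (sin (i.+1%:R * t) / i.+1%:R) + t / 2.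
(** The primitive of [osc_sum N] that vanishes at 0. Its coefficients are summable, so it tends to 0
    uniformly up to [pi], whereas [osc_sum N] keeps the value pi / 2 at [pi]. *)
Definition quad_sum N t : R :=
  \sum_(i < N) (-1) ^+ i.+1 * ((1 - cos (i.+1%:R * t)) / i.+1%:R ^+ 2) + t ^+ 2 / 4.

Lemma is_derive_osc N t :
  is_derive t 1 (osc_sum N) (\sum_(i < N) (-1) ^+ i.+1 * cos (i.+1%:R * t) + 2^-1).
Proof.
apply: is_deriveD; last first.
  rewrite (_ : (fun t0 => t0 / 2) = (fun t0 => 2^-1 * t0)); last by apply/funext => s; rewrite mulrC.
  by apply: (is_derive_cast (is_deriveZ 2^-1 (is_derive_id t 1))); rewrite /GRing.scale /= mulr1.
apply: (is_derive_bigsum N (f := fun i t => (-1) ^+ i.+1 * (sin (i.+1%:R * t) / i.+1%:R))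
   (d := fun i => (-1) ^+ i.+1 * cos (i.+1%:R * t))) => i.
rewrite (_ : (fun _ => _) = (fun t => ((-1) ^+ i.+1 / i.+1%:R) * sin (i.+1%:R * t))).
  apply: (is_derive_cast (is_deriveZ ((-1) ^+ i.+1 / i.+1%:R) (is_derive_sinZ i.+1%:R t))).
  have : i.+1%:R != 0 :> R by rewrite pnatr_eq0.
  by rewrite /GRing.scale /=; set c := i.+1%:R => c0; field.
by apply/funext => s; rewrite mulrCA mulrC.
Qed.

Lemma is_derive_quad N t : is_derive t 1 (quad_sum N) (osc_sum N t).
Proof.
rewrite /osc_sum; apply: is_deriveD; last first.
  rewrite (_ : (fun t0 => t0 ^+ 2 / 4) = (fun t0 => 4^-1 * (t0 * t0))); last by apply/funext => s; rewrite mulrC.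
  apply: (is_derive_cast (is_deriveZ 4^-1 (is_deriveM (is_derive_id t 1) (is_derive_id t 1)))).
  by rewrite /GRing.scale /= mulr1; field.
apply: (is_derive_bigsum N (f := fun i t => (-1) ^+ i.+1 * ((1 - cos (i.+1%:R * t)) / i.+1%:R ^+ 2))
   (d := fun i => (-1) ^+ i.+1 * (sin (i.+1%:R * t) / i.+1%:R))) => i.
rewrite (_ : (fun _ => _) = (fun t => ((-1) ^+ i.+1 / i.+1%:R ^+ 2) * (1 - cos (i.+1%:R * t)))).
  have h1 : is_derive t 1 (fun t => 1 - cos (i.+1%:R * t)) (i.+1%:R * sin (i.+1%:R * t)).
    by apply: (is_derive_cast (is_deriveB (is_derive_cst (1 : R) t 1) (is_derive_cosZ i.+1%:R t))); rewrite sub0r opprK.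
  apply: (is_derive_cast (is_deriveZ ((-1) ^+ i.+1 / i.+1%:R ^+ 2) h1)).
  have : i.+1%:R != 0 :> R by rewrite pnatr_eq0.
  by rewrite /GRing.scale /=; set c := i.+1%:R => c0; field.
by apply/funext => s; rewrite mulrCA mulrC.
Qed.

Lemma dirichlet_kernel N t :
  2 * cos (t / 2) * (\sum_(i < N) (-1) ^+ i.+1 * cos (i.+1%:R * t) + 2^-1) =
  (-1) ^+ N * cos ((N%:R + 2^-1) * t).
Proof.
elim: N => [|N IH].
  by rewrite big_ord0 !add0r expr0 mul1r mulrAC mulfV// mul1r mulrC.
rewrite big_ord_recr /= addrAC mulrDr IH.
have -> : cos ((N%:R + 2^-1) * t) = cos (N.+1%:R * t - t / 2).
  by congr cos; rewrite -natr1; field.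
have -> : cos ((N.+1%:R + 2^-1) * t) = cos (N.+1%:R * t + t / 2).
  by congr cos; field.
by rewrite cosB cosD exprS; ring.
Qed.

Lemma quad_sum0 N : quad_sum N 0 = 0.
Proof.
rewrite /quad_sum expr0n /= mul0r addr0 big1// => i _.
by rewrite mulr0 cos0 subrr mul0r mulr0.
Qed.

Lemma osc_sum0 N : osc_sum N 0 = 0.
Proof.
rewrite /osc_sum mul0r addr0 big1// => i _.
by rewrite mulr0 sin0 mul0r mulr0.
Qed.

(** The derivative of [osc_sum N] is the kernel (-1)^N cos (m s) / (2 cos (s / 2)), which is
    singular only at [pi]. One integration by parts gains the factor 1 / m: [E] is [osc_sum N] minus
    the boundary term, and its derivative [dE] is already O(1 / m) as long as cos (s / 2) >= cos (b
    / 2) > 0. *)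
Lemma osc_sum_le b N t : 0 <= t <= b -> b < pi ->
  `|osc_sum N t| <= ((cos (b / 2))^-1 + (cos (b / 2)) ^- 2 * b) / (N%:R + 2^-1).
Proof.
move=> /andP[t0 tb] bpi; set k := cos (b / 2); set m := N%:R + 2^-1 : R.
have b0 : 0 <= b by exact: le_trans tb.
have hpi : b / 2 < pi / 2 by rewrite ltr_pM2r.
have k0 : 0 < k.
  apply: cos_gt0_pihalf; rewrite hpi andbT.
  by rewrite (lt_le_trans (_ : _ < 0)) ?oppr_lt0 ?divr_ge0// divr_gt0// pi_gt0.
have m0 : 0 < m by rewrite /m ltr_wpDl.
have ck s : 0 <= s <= t -> k <= cos (s / 2).
  move=> /andP[s0 st].
  have pp := @pi_gt0 R.
  have sb : s / 2 <= b / 2 by rewrite ler_pM2r// (le_trans st).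
  move: sb; rewrite le_eqVlt => /predU1P[->//|sb].
  apply/ltW; rewrite ltr_cos// ?in_itv /=.
    by rewrite divr_ge0//=; move: pp hpi sb; clear; lra.
  by rewrite divr_ge0//=; move: pp hpi sb; clear; lra.
pose w (s : R) := (cos (s / 2))^-1.
pose E (s : R) := osc_sum N s - (2 * m)^-1 * ((-1) ^+ N * (sin (m * s) * w s)).
pose dE (s : R) := - ((4 * m)^-1 * ((-1) ^+ N * (sin (m * s) * sin (s / 2) * (w s) ^+ 2))).
have cn0 s : 0 <= s <= t -> cos (s / 2) != 0 by move=> /ck h; rewrite gt_eqF// (lt_le_trans k0).
have dEP s : 0 <= s <= t -> is_derive s 1 E (dE s).
  move=> st; have c0 := cn0 s st.
  have dw : is_derive s 1 w (2^-1 * sin (s / 2) * (w s) ^+ 2).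
    have hc : is_derive s 1 (fun s => cos (s / 2)) (- (2^-1 * sin (s / 2))).
      rewrite (_ : (fun _ => _) = (fun s => cos (2^-1 * s))); last by apply/funext => u; rewrite mulrC.
      by rewrite [s / 2]mulrC; exact: is_derive_cosZ.
    apply: (is_derive_cast (@realfun.is_deriveV R (fun s => cos (s / 2)) s _ 1 c0 hc)).
    by rewrite /GRing.scale /= /w -exprVn; ring.
  have := is_deriveB (is_derive_osc N s) (is_deriveZ (2 * m)^-1
    (is_deriveZ ((-1) ^+ N) (is_deriveM (is_derive_sinZ m s) dw))).
  move/is_derive_cast; apply; rewrite /GRing.scale /= /dE.
  have D : \sum_(i < N) (-1) ^+ i.+1 * cos (i.+1%:R * s) + 2^-1 = 2^-1 * w s * ((-1) ^+ N * cos (m * s)).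
    by rewrite -dirichlet_kernel /w; field.
  by rewrite D /w; field; rewrite c0 /= gt_eqF.
have wk s : 0 <= s <= t -> `|w s| <= k^-1.
  move=> st; have h := ck s st; have c0 := lt_le_trans k0 h.
  by rewrite ger0_norm ?invr_ge0 ?(ltW c0)// lef_pV2.
have sgn1 : `|(-1) ^+ N| = 1 :> R by rewrite normrX normrN normr1 expr1n.
have dEb s : 0 <= s <= t -> `|dE s| <= (4 * m)^-1 * k ^- 2.
  move=> st; rewrite /dE normrN normrM ger0_norm ?invr_ge0 ?mulr_ge0 ?(ltW m0)//.
  rewrite ler_wpM2l ?invr_ge0 ?mulr_ge0 ?(ltW m0)//.
  rewrite !normrM sgn1 mul1r -exprVn -[leRHS]mul1r.
  apply: ler_pM => //; first by rewrite mulr_ile1 ?sin_max.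
  by rewrite expr2; apply: ler_pM => //; exact: wk.
have := mvt_bound t0 dEP dEb.
have -> : E 0 = 0 by rewrite /E osc_sum0 mulr0 sin0 mul0r !mulr0 subrr.
rewrite subr0 => hE.
have -> : osc_sum N t = E t + (2 * m)^-1 * ((-1) ^+ N * (sin (m * t) * w t)) by rewrite /E subrK.
apply: le_trans (ler_normD _ _) _.
have h2 : `|(2 * m)^-1 * ((-1) ^+ N * (sin (m * t) * w t))| <= (2 * m)^-1 * k^-1.
  rewrite normrM ger0_norm ?invr_ge0 ?mulr_ge0 ?(ltW m0)//.
  rewrite ler_wpM2l ?invr_ge0 ?mulr_ge0 ?(ltW m0)// !normrM sgn1 mul1r -[leRHS]mul1r.
  by apply: ler_pM => //; [exact: sin_max | apply: wk; rewrite t0 lexx].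
apply: le_trans (lerD hE h2) _.
have k2 : 0 <= k ^- 2 by rewrite -exprVn sqr_ge0.
have ki : 0 <= k^-1 by rewrite invr_ge0 ltW.
have mi : 0 <= m^-1 by rewrite invr_ge0 ltW.
rewrite -subr_ge0.
have -> : (k^-1 + k ^- 2 * b) / m - ((4 * m)^-1 * k ^- 2 * t + (2 * m)^-1 * k^-1)
   = m^-1 * (k ^- 2 * (b - t / 4) + k^-1 / 2).
  by field; rewrite !gt_eqF.
apply: mulr_ge0 => //; apply: addr_ge0; last by apply: mulr_ge0.
by apply: mulr_ge0 => //; move: t0 tb; clear; lra.
Qed.

Lemma inv_sqr_tail n k : (0 < n)%N ->
  \sum_(i < k) ((n + i).+1%:R ^- 2 : R) <= n%:R^-1 - (n + k)%:R^-1.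
Proof.
move=> n0; elim: k => [|k IH]; first by rewrite big_ord0 addn0 subrr.
rewrite big_ord_recr /= addnS; set a := (n + k)%N in IH *.
have a0 : (0 : R) < a%:R by rewrite ltr0n /a addn_gt0 n0.
have a1 : (0 : R) < a.+1%:R by rewrite ltr0n.
have h : a.+1%:R ^- 2 <= a%:R^-1 - a.+1%:R^-1 :> R.
  rewrite -natr1 in a1 *; set c := (a%:R : R) in a0 a1 *.
  have -> : c^-1 - (c + 1)^-1 = (c * (c + 1))^-1 by field; rewrite !gt_eqF.
  by rewrite lef_pV2 ?posrE ?mulr_gt0 ?exprn_gt0// expr2 ler_pM2r// lerDl.
by apply: le_trans (lerD IH h) _; rewrite addrA subrK.
Qed.

Lemma quad_sum_le b N : 0 <= b < pi ->
  `|quad_sum N b| <= ((cos (b / 2))^-1 + (cos (b / 2)) ^- 2 * b) / (N%:R + 2^-1) * b.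
Proof.
move=> /andP[b0 bpi]; rewrite -[quad_sum N b]subr0 -(quad_sum0 N).
apply: (@mvt_bound _ _ (osc_sum N)) => // t tb; first exact: is_derive_quad.
exact: osc_sum_le.
Qed.

Lemma quad_sum_diff t N k : (0 < N)%N -> `|quad_sum (N + k) t - quad_sum N t| <= 2 / N%:R.
Proof.
move=> N0; rewrite /quad_sum big_split_ord /=.
set A := \sum_(i < N) _; set B := \sum_(i < k) _.
have -> : A + B + t ^+ 2 / 4 - (A + t ^+ 2 / 4) = B by ring.
rewrite /B {A B}.
apply: le_trans (ler_norm_sum _ _ _) _.
apply: (@le_trans _ _ (\sum_(i < k) 2 * (N + i).+1%:R ^- 2)).
  apply: ler_sum => i _; rewrite normrM normrX normrN normr1 expr1n mul1r.
  rewrite normrM; apply: ler_pM => //.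
    by apply: le_trans (ler_normB _ _) _; rewrite normr1 (lerD2l 1 _ 1) cos_max.
  by rewrite ger0_norm// invr_ge0 exprn_ge0.
rewrite -mulr_sumr ler_wpM2l//; apply: le_trans (inv_sqr_tail k N0) _.
by rewrite gerBl.
Qed.

Lemma ler_inv_eps (a c : R) : (forall e, 0 < e -> exists2 b, b < e & a <= c + b) -> a <= c.
Proof.
move=> h; apply/ler_addgt0Pr => e e0; have [b be ab] := h e e0.
by apply: le_trans ab _; rewrite lerD2l ltW.
Qed.

Lemma inv_nat_small (c e : R) : 0 < e -> exists k, c / (k.+1)%:R < e.
Proof.
move=> e0; exists (Num.bound (`|c| / e)).
have h := archi_boundP (divr_ge0 (normr_ge0 c) (ltW e0)).
rewrite ltr_pdivrMr ?ltr0n// -ltr_pdivrMl// mulrC.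
apply: le_lt_trans (_ : `|c| / e < _); first by rewrite ler_wpM2r ?invr_ge0 ?ler_norm// ltW.
by apply: lt_trans h _; rewrite ltr_nat.
Qed.

(** On [[0, pi[] the limit in N is 0 by [quad_sum_le], with a constant that explodes at [pi]; the
    tails, however, are at most 2 / N whatever the point. Letting the upper index tend to infinity
    leaves the tail bound alone, and continuity of the fixed function [quad_sum N] carries it to
    [pi]. *)
Lemma quad_sum_bound t N : 0 <= t <= pi -> (0 < N)%N -> `|quad_sum N t| <= 2 / N%:R.
Proof.
move=> /andP[t0 tpi] N0.
have main s : 0 <= s -> s < pi -> `|quad_sum N s| <= 2 / N%:R.
  move=> s0 spi; apply: ler_inv_eps => e e0.
  set K := (cos (s / 2))^-1 + (cos (s / 2)) ^- 2 * s.
  have h k : `|quad_sum (N + k) s| <= K / ((N + k)%:R + 2^-1) * s.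
    by apply: quad_sum_le; rewrite s0.
  have [k hk] := inv_nat_small (`|K| * s) e0.
  exists (`|K| * s / k.+1%:R) => //.
  rewrite -[quad_sum N s](subKr (quad_sum (N + k.+1) s)).
  apply: le_trans (ler_normB _ _) _; rewrite addrC; apply: lerD; first exact: quad_sum_diff.
  apply: le_trans (h k.+1) _.
  rewrite [leRHS]mulrAC; apply: ler_wpM2r => //.
  apply: (@le_trans _ _ (`|K| / ((N + k.+1)%:R + 2^-1))).
    by apply: ler_wpM2r; rewrite ?ler_norm// invr_ge0 addr_ge0.
  apply: ler_wpM2l => //; rewrite lef_pV2 ?posrE ?ltr0n ?ltr_wpDl//.
  by apply: le_trans (_ : (N + k.+1)%:R <= _); rewrite ?lerDl// ler_nat leq_addl.
move: tpi; rewrite le_eqVlt => /predU1P[->|]; last exact: main.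
have cosc : continuous (osc_sum N).
  by move=> s; apply: differentiable_continuous; apply/derivable1_diffP; have [] := is_derive_osc N s.
have [_ [M hM]] := bmeas_continuous pi cosc.
have p0 := @pi_gt0 R.
have M0 : 0 <= M by apply: le_trans (hM 0 _); rewrite ?normr_ge0 ?lexx ?(ltW p0).
apply: ler_inv_eps => e e0.
have M1 : 0 < M + 1 by rewrite ltr_wpDl.
(* The point [pi - d] lies in [[0, pi[], where [main] applies; the step from there to [pi] changes
   [quad_sum N] by at most M d < e. *)
pose d := Num.min (e / (M + 1)) pi / 2.
have d0 : 0 < d by rewrite divr_gt0// lt_min p0 divr_gt0.
have dpi : d < pi.
  have : Num.min (e / (M + 1)) pi <= pi by rewrite ge_min lexx orbT.
  by rewrite /d; move: p0; clear; lra.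
have de : d < e / (M + 1).
  have : Num.min (e / (M + 1)) pi <= e / (M + 1) by rewrite ge_min lexx.
  have : 0 < e / (M + 1) by rewrite divr_gt0.
  by rewrite /d; clear; lra.
exists (M * d).
  rewrite mulrC; apply: le_lt_trans (_ : d * (M + 1) < _); last by rewrite -ltr_pdivlMr.
  by rewrite ler_wpM2l ?lerDl// ltW.
rewrite -[quad_sum N pi](subKr (quad_sum N (pi - d))).
apply: le_trans (ler_normB _ _) _; apply: lerD.
  by apply: main; [rewrite subr_ge0 ltW|rewrite gtrBl].
have := @mvt_bound R (fun u => quad_sum N (pi - u)) (fun u => - osc_sum N (pi - u)) d M (ltW d0).
rewrite subr0; apply.
  move=> u _.
  have hu : is_derive u 1 (fun u : R => pi - u) (-1).
    by apply: (is_derive_cast (is_deriveB (is_derive_cst (pi : R) u 1) (is_derive_id u 1))); rewrite sub0r.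
  apply: (is_derive_cast (@is_derive1_comp R (quad_sum N) (fun t => pi - t) u _ _ (is_derive_quad N _) hu)).
  exact: mulrN1.
move=> u /andP[u0 ud]; rewrite normrN; apply: hM; rewrite subr_ge0 gerBl u0 andbT.
exact: le_trans ud (ltW dpi).
Qed.

End QuadraticSeries.

(** * The partial sums of the cosine series of cos (z t), uniformly for z in a disc *)

Section CosineExpansion.
Context {R : realType}.
Local Notation C := R[i].
Implicit Types (z w : C) (t x r e : R) (n N M m k : nat).

Lemma cpi_neq0 : cR (pi : R) != 0.
Proof. by rewrite cR_eq0 gt_eqF// pi_gt0. Qed.

(** The common numerator of all the kernels: multiplied by its denominator, each [kc n z] becomes
    [spi z] up to sign and, for n > 0, the factor 2 z. *)
Definition spi z : C := csin (cR pi * z) / cR pi.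

Lemma mul_csinc z : csinc z * z = spi z.
Proof.
rewrite /csinc /spi; case: eqVneq => [->|z0]; first by rewrite !mulr0 csin0 mul0r.
by field; rewrite z0 cpi_neq0.
Qed.

Lemma cos_pin n : cos (pi * n%:R) = (-1) ^+ n :> R.
Proof.
elim: n => [|n IH]; first by rewrite mulr0 cos0.
by rewrite -natr1 mulrDr mulr1 cosDpi IH exprS mulN1r.
Qed.

Lemma sin_pin n : sin (pi * n%:R) = 0 :> R.
Proof.
elim: n => [|n IH]; first by rewrite mulr0 sin0.
by rewrite -natr1 mulrDr mulr1 sinDpi IH oppr0.
Qed.

Lemma spiD z n : spi (z + n%:R) = (-1) ^+ n * spi z.
Proof.
rewrite /spi mulrDr csinD -[n%:R]cRn -cRM ccos_cR csin_cR cos_pin sin_pin cR_sign.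
by rewrite cR0; field; exact: cpi_neq0.
Qed.

Lemma spiB z n : spi (z - n%:R) = (-1) ^+ n * spi z.
Proof. by rewrite -{2}(subrK n%:R z) spiD mulrA -exprMn mulrNN mulr1 expr1n mul1r. Qed.

Lemma spi0 : spi 0 = 0.
Proof. by rewrite /spi mulr0 csin0 mul0r. Qed.

Lemma spi_nat n : spi n%:R = 0.
Proof. by rewrite -[n%:R]add0r spiD spi0 mulr0. Qed.

Lemma csincN z : csinc (- z) = csinc z.
Proof.
rewrite /csinc oppr_eq0; case: eqVneq => // z0.
by rewrite mulrN csinN invrN mulrNN.
Qed.

Lemma csinc_nat n : csinc n%:R = (n == 0%N)%:R :> C.
Proof.
case: n => [|n]; first by rewrite /csinc /= eqxx.
have n0 : n.+1%:R != 0 :> C by rewrite pnatr_eq0.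
by apply: (mulIf n0); rewrite mul_csinc spi_nat mul0r.
Qed.

(** At n = 0 the two sincs coincide and only one is kept, as befits a mean value; this is why the
    coefficient of index 0 in the series for phi' carries a factor 1 / 2. *)
Definition kc n z : C := if n == 0%N then csinc z else csinc (z - n%:R) + csinc (z + n%:R).

Lemma kc0_mul z : kc 0 z * z = spi z. Proof. exact: mul_csinc. Qed.

Lemma kc_mul n z : kc n.+1 z * (z ^+ 2 - n.+1%:R ^+ 2) = (-1) ^+ n.+1 * (2 * z * spi z).
Proof.
rewrite /kc /=; set c := n.+1%:R.
have -> : (csinc (z - c) + csinc (z + c)) * (z ^+ 2 - c ^+ 2) =
  (csinc (z - c) * (z - c)) * (z + c) + (csinc (z + c) * (z + c)) * (z - c) by ring.
by rewrite !mul_csinc /c spiB spiD; ring.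
Qed.

Lemma kcN n z : kc n (- z) = kc n z.
Proof.
rewrite /kc csincN; case: ifP => // _.
by rewrite -opprD csincN addrC -csincN opprD opprK.
Qed.

Definition cos_sum N z t : C := \sum_(n < N) kc n z * cR (cos (n%:R * t)).

Lemma is_cderive_cR (f : R -> R) t d : is_derive t 1 f d -> is_cderive (fun s => cR (f s)) t (cR d).
Proof. by move=> h; split=> //=; exact: is_derive_cst. Qed.

Lemma is_cderive_bigsum n (f : nat -> R -> C) (d : nat -> C) t :
  (forall i, is_cderive (f i) t (d i)) ->
  is_cderive (fun s => \sum_(i < n) f i s) t (\sum_(i < n) d i).
Proof.
move=> h; elim: n => [|n IH].
  rewrite big_ord0 (_ : (fun _ => _) = fun=> cR 0).
    by apply: is_cderive_cR; exact: is_derive_cst.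
  by apply/funext => s; rewrite big_ord0.
rewrite big_ord_recr /= (_ : (fun _ => _) = (fun s => \sum_(i < n) f i s + f n s)).
  exact: is_cderiveD.
by apply/funext => s; rewrite big_ord_recr.
Qed.

Lemma osc_sum_pi N : osc_sum N (pi : R) = pi / 2.
Proof.
rewrite /osc_sum big1 ?add0r// => i _.
by rewrite mulrC [_ * pi]mulrC sin_pin !(mul0r, mulr0).
Qed.

(** By [kc_mul] the partial sum [G] satisfies G'' + z^2 G = c (1/2 + sum of (-1)^i cos (i t)) with c
    = 2 z [spi z], and the right side is the second derivative of c [quad_sum]. So F = G - c
    [quad_sum] solves F'' + z^2 F = - z^2 c [quad_sum], a forcing of size O(1 / M), with F'(0) = 0.
    Variation of constants gives F = G(0) cos (z t) + O(1 / M). The same formula for F' at [pi] then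
    identifies G(0) without summing any numerical series, except where z [spi z] = 0. *)
Lemma cos_sum_error z : exists2 K, 0 <= K & forall M, (0 < M)%N ->
  N1 (z * cR pi * spi z * (cos_sum M.+1 z 0 - 1)) <= K / M%:R /\
  forall t, 0 <= t <= pi ->
    N1 (cos_sum M.+1 z t - cos_sum M.+1 z 0 * ccos (z * cR t)) <= K / M%:R.
Proof.
have p0 := @pi_gt0 R; have p0' := ltW p0.
pose c := 2 * z * spi z.
have [B hB] := cbmeas_bound (ccontinuous_cbmeas pi (ccontinuous_sn z)).
have [B' hB'] := cbmeas_bound (ccontinuous_cbmeas pi (ccontinuous_cos z)).
pose A := 2 * N1 (- z ^+ 2 * c) * (`|B| + `|B'|) * pi.
have A0 : 0 <= A.
  apply: mulr_ge0 => //; apply: mulr_ge0; last exact: addr_ge0.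
  by apply: mulr_ge0 => //; exact: N1_ge0.
exists (A + 2 * N1 c); first by rewrite addr_ge0// mulr_ge0// N1_ge0.
move=> M M0.
have Mi0 : (0 : R) <= M%:R^-1 by rewrite invr_ge0.
pose a (i : nat) : R := i.+1%:R.
pose G t := cos_sum M.+1 z t.
have GE t : G t = kc 0 z + \sum_(i < M) kc i.+1 z * cR (cos (a i * t)).
  rewrite /G /cos_sum big_ord_recl /=.
  have -> : cR (cos (0 * t)) = 1 by rewrite mul0r cos0.
  by rewrite mulr1.
pose F t := G t - c * cR (quad_sum M t).
pose dF t := \sum_(i < M) kc i.+1 z * cR (- (a i * sin (a i * t))) - c * cR (osc_sum M t).
pose f t := (- z ^+ 2 * c) * cR (quad_sum M t).
have dG t : is_cderive G t (\sum_(i < M) kc i.+1 z * cR (- (a i * sin (a i * t)))).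
  have -> : G = (fun t => cR 0 * kc 0 z + \sum_(i < M) kc i.+1 z * cR (cos (a i * t)) + kc 0 z * cR 1).
    by apply/funext => s; rewrite GE cR0 mul0r add0r cR1 mulr1 addrC.
  rewrite -[X in is_cderive _ _ X]addr0; apply: is_cderiveD; last first.
    rewrite -(mulr0 (kc 0 z)); apply: is_cderiveZ.
    by apply: is_cderive_cR; exact: is_derive_cst.
  rewrite (_ : (fun _ => _) = (fun t => \sum_(i < M) kc i.+1 z * cR (cos (a i * t)))); last first.
    by apply/funext => s; rewrite cR0 mul0r add0r.
  apply: (is_cderive_bigsum M (f := fun i t => kc i.+1 z * cR (cos (a i * t)))
    (d := fun i => kc i.+1 z * cR (- (a i * sin (a i * t))))) => i.
  by apply: is_cderiveZ; apply: is_cderive_cR; exact: is_derive_cosZ.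
have cG : ccontinuous G := is_cderive_continuous dG.
have dFP t : is_cderive F t (dF t).
  apply: is_cderiveD => //; apply: is_cderiveN; apply: is_cderiveZ.
  by apply: is_cderive_cR; exact: is_derive_quad.
have ddFP t : is_cderive dF t (- z ^+ 2 * G t).
  have -> : - z ^+ 2 * G t = \sum_(i < M) kc i.+1 z * cR (- (a i * (a i * cos (a i * t))))
     - c * cR (\sum_(i < M) (-1) ^+ i.+1 * cos (a i * t) + 2^-1).
    have hk i : kc i.+1 z * cR (- (a i * (a i * cos (a i * t)))) =
       - z ^+ 2 * (kc i.+1 z * cR (cos (a i * t))) + c * cR ((-1) ^+ i.+1 * cos (a i * t)).
      have := kc_mul i z; rewrite -/c !(cRN, cRM) cR_sign /a cRn => h.
      have -> : kc i.+1 z * - (i.+1%:R * (i.+1%:R * cR (cos (i.+1%:R * t)))) =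
        (kc i.+1 z * (z ^+ 2 - i.+1%:R ^+ 2)) * cR (cos (i.+1%:R * t)) - z ^+ 2 * (kc i.+1 z * cR (cos (i.+1%:R * t))).
        by ring.
      by rewrite h; ring.
    under [in RHS]eq_bigr => i _ do rewrite hk.
    rewrite big_split /= -!mulr_sumr GE.
    rewrite cRD (cR_sum M (fun i => (-1) ^+ i.+1 * cos (a i * t))) cRV.
    have -> : cR (2 : R) = 2 by exact: (cRn 2).
    have h0 : z ^+ 2 * kc 0 z = z * spi z by rewrite -kc0_mul; ring.
    rewrite !mulrDr [- z ^+ 2 * kc 0 z]mulNr h0 /c; by field.
  apply: is_cderiveD.
    apply: (is_cderive_bigsum M (f := fun i t => kc i.+1 z * cR (- (a i * sin (a i * t))))
      (d := fun i => kc i.+1 z * cR (- (a i * (a i * cos (a i * t)))))) => i.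
    apply: is_cderiveZ; apply: is_cderive_cR.
    exact: is_deriveN (is_deriveZ (a i) (is_derive_sinZ (a i) t)).
  apply: is_cderiveN; apply: is_cderiveZ; apply: is_cderive_cR; exact: is_derive_osc.
have cF : ccontinuous F := is_cderive_continuous dFP.
have cdF : ccontinuous dF := is_cderive_continuous ddFP.
have cf : ccontinuous f.
  by apply: ccontinuousZ; apply: is_cderive_continuous => t; apply: is_cderive_cR; exact: is_derive_quad.
have dF0 : dF 0 = 0.
  rewrite /dF osc_sum0 cR0 mulr0 subr0 big1// => i _.
  by rewrite mulr0 sin0 mulr0 oppr0 cR0 mulr0.
have F0 : F 0 = G 0 by rewrite /F quad_sum0 cR0 mulr0 subr0.
have H1 x : 0 <= x <= pi -> F x = G 0 + cint dF 0 x.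
  by move=> /andP[x0 _]; rewrite (cint_FTC x0 cdF dFP) F0 addrC subrK.
have H2 x : 0 <= x <= pi -> dF x = 0 + cint (fun t => f t - z ^+ 2 * F t) 0 x.
  move=> /andP[x0 _]; rewrite (@eq_cint _ _ _ (fun t => - z ^+ 2 * G t)); last first.
    by move=> t _; rewrite /f /F; ring.
  by rewrite (cint_FTC x0 (ccontinuousZ _ cG) ddFP) dF0 subr0 add0r.
have V := variation_of_constants (ccontinuous_cbmeas pi cF) (ccontinuous_cbmeas pi cdF)
  (cbmeas_cintble (ccontinuous_cbmeas pi cf)) H1 H2.
have err (g : R -> C) (x b : R) : 0 <= x <= pi -> ccontinuous g ->
    (forall t, 0 <= t <= pi -> N1 (g t) <= b) -> b <= `|B| + `|B'| ->
    N1 (cint (fun t => f t * g (x - t)) 0 x) <= A / M%:R.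
  move=> /andP[x0 xpi] cg hg bB.
  have bfg : cbmeas x (fun t => f t * g (x - t)).
    by apply: cbmeasM; apply: ccontinuous_cbmeas => //; exact: ccontinuous_rev.
  apply: (@le_trans _ _ (Rintegral (@lebesgue_measure R) `[0%R, x] (fun=> A / M%:R / pi))).
    apply: N1_cint_le; [exact: cbmeas_cintble|exact/bmeas_intble/bmeas_cst|].
    move=> t /andP[t0 tx]; apply: le_trans (N1M _ _) _.
    have -> : A / M%:R / pi = (N1 (- z ^+ 2 * c) * (2 / M%:R)) * (`|B| + `|B'|).
      by rewrite /A mulrAC mulfK ?gt_eqF//; ring.
    apply: ler_pM; rewrite ?N1_ge0//.
      rewrite /f mulrC N1_cRM mulrC; apply: ler_wpM2l; first exact: N1_ge0.
      by apply: quad_sum_bound; rewrite ?t0 ?(le_trans tx).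
    apply: le_trans bB; apply: hg; rewrite subr_ge0 tx /=.
    by apply: le_trans xpi; rewrite gerBl.
  rewrite Int_cst// mulrAC ler_pdivrMr// ler_wpM2l// mulr_ge0//.
split.
  have ppi : 0 <= @pi R <= @pi R by apply/andP; split.
  have [_ hd] := V pi ppi.
  (* At [pi] every sine in [dF] vanishes and [osc_sum] equals pi / 2, so F'(pi) is known exactly.
     Comparison with the derivative of G(0) cos (z t) at [pi] yields G(0) = 1 up to O(1 / M). *)
  have dFpi : dF pi = - (z * cR pi * spi z).
    rewrite /dF big1 ?sub0r.
      rewrite osc_sum_pi cRM cRV; have -> : cR (2 : R) = 2 by exact: (cRn 2).
      by rewrite /c; field.
    by move=> i _; rewrite /a [_ * pi]mulrC sin_pin mulr0 oppr0 cR0 mulr0.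
  have hs : z ^+ 2 * sn z pi = z * cR pi * spi z.
    rewrite expr2 -mulrA mul_sn /spi mulrC; rewrite [z * cR pi]mulrC; field; exact: cpi_neq0.
  rewrite dFpi hs mul0r addr0 in hd.
  have -> : z * cR pi * spi z * (cos_sum M.+1 z 0 - 1) =
     cint (fun t => f t * ccos (z * cR (pi - t))) 0 pi.
    by rewrite -[cint _ _ _](addKr (- (z * cR pi * spi z * G 0))) -hd /G; ring.
  apply: le_trans (err (fun t => ccos (z * cR t)) pi B' _ _ hB' _) _.
  - by rewrite lexx p0'.
  - exact: ccontinuous_cos.
  - by apply: le_trans (ler_norm _) _; rewrite lerDr.
  - by apply: ler_wpM2r => //; rewrite lerDl mulr_ge0// N1_ge0.
move=> t tpi; have [hF _] := V t tpi.
have -> : cos_sum M.+1 z t - cos_sum M.+1 z 0 * ccos (z * cR t) =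
   cint (fun u => f u * sn z (t - u)) 0 t + cR (quad_sum M t) * c.
  rewrite -/(G t) -/(G 0); have -> : G t = F t + cR (quad_sum M t) * c by rewrite /F; ring.
  by rewrite hF; ring.
apply: le_trans (N1D _ _) _; rewrite mulrDl; apply: lerD.
  apply: (err (sn z) t B) => //; first exact: ccontinuous_sn.
  by apply: le_trans (ler_norm _) _; rewrite lerDl.
rewrite N1_cRM mulrAC; apply: ler_wpM2r; first exact: N1_ge0.
exact: quad_sum_bound.
Qed.

(** The hyperbolic cosine is positive, so the real part forces sin (pi a) = 0. Then cos (pi a) is +1
    or -1, and the imaginary part forces b = 0. *)
Lemma spi_eq0 z : spi z = 0 -> exists m, z = m%:R \/ z = - m%:R.
Proof.
have p0 := @pi_gt0 R.
rewrite /spi => /eqP; rewrite mulf_eq0 invr_eq0 (negPf cpi_neq0) orbF.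
case: z => a b; rewrite mulrC mul_cR /csin eq_complex /=.
have coshp t : 0 < coshR t by rewrite /coshR divr_gt0// addr_gt0// expR_gt0.
move=> /andP[+ hb]; rewrite mulf_eq0 (gt_eqF (coshp _)) orbF => /eqP s0.
have c1 := sin0cos1 s0.
have b0 : b = 0.
  have cn0 : (cos (a * pi) == 0) = false.
    by apply/negbTE; rewrite -normr_gt0 c1.
  move: hb; rewrite mulf_eq0 cn0 /= /sinhR mulf_eq0 invr_eq0 pnatr_eq0 orbF subr_eq0.
  move/eqP/expR_inj => h; have : b * pi = 0 by move: h; clear; lra.
  by move/eqP; rewrite mulf_eq0 (gt_eqF p0) orbF => /eqP.
have sa : sin (pi * `|a|) = 0.
  by case: ler0P => _; rewrite ?mulrN ?sinN mulrC s0 ?oppr0.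
pose m := Num.truncn `|a|.
have /andP[ma am] := truncn_itv (normr_ge0 a); rewrite -/m in ma am.
have aE : `|a| = m%:R.
  apply/eqP; rewrite eq_le ma andbT leNgt; apply/negP => lt.
  have : 0 < sin (pi * (`|a| - m%:R)).
    apply: sin_gt0_pi; rewrite mulr_gt0 ?subr_gt0//=.
    by rewrite gtr_pMr// ltrBlDr nat1r.
  by rewrite mulrBr sinB sin_pin sa mul0r mulr0 subrr ltxx.
exists m; rewrite -!cRn -aE b0; case: (ler0P a) => _; rewrite ?cRN ?opprK; by [right|left].
Qed.

Lemma cos_sum_nat m N t : (m < N)%N -> cos_sum N m%:R t = cR (cos (m%:R * t)).
Proof.
move=> mN; rewrite /cos_sum (bigD1 (Ordinal mN)) //= big1 ?addr0.
  rewrite /kc; case: eqVneq => [->|m0].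
    by rewrite csinc_nat mul1r.
  rewrite subrr -natrD !csinc_nat (_ : csinc 0 = 1); last by rewrite /csinc eqxx.
  by rewrite addn_eq0 (negPf m0) addr0 mul1r.
move=> i im; suff -> : kc i m%:R = 0 by rewrite mul0r.
have {im} : (i : nat) != m by [].
case: (i : nat) => [|n] nm.
  by rewrite /kc /= csinc_nat eq_sym (negPf nm).
have h := kc_mul n (m%:R : C); rewrite spi_nat !mulr0 in h.
apply/eqP; move/eqP: h; rewrite mulf_eq0 => /orP[//|].
by rewrite subr_eq0 -!natrX eqr_nat eqn_exp2r// eq_sym (negPf nm).
Qed.

Lemma cos_sumN N z t : cos_sum N (- z) t = cos_sum N z t.
Proof. by apply: eq_bigr => i _; rewrite kcN. Qed.

(** Off the integers one divides by [z * cR pi * spi z] in [cos_sum_error]. At z = m or z = - m this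
    factor vanishes, but the kernels are Kronecker symbols and the sum is exact from m + 1 terms on.
    The index depends on [z], and the constant degenerates near the integers. *)
Lemma cos_sum_cvg z e : 0 < e -> exists N0, forall N, (N0 <= N)%N -> forall t, 0 <= t <= pi ->
  N1 (cos_sum N z t - ccos (z * cR t)) <= e.
Proof.
move=> e0; have [s0|s0] := eqVneq (spi z) 0.
  have [m hm] := spi_eq0 s0; exists m.+1 => N mN t _.
  have -> : cos_sum N z t = cR (cos (m%:R * t)).
    by case: hm => ->; rewrite ?cos_sumN cos_sum_nat.
  have -> : ccos (z * cR t) = cR (cos (m%:R * t)).
    by case: hm => ->; rewrite ?mulNr ?ccosN -cRn -cRM ccos_cR.
  by rewrite subrr N10 ltW.
have z0 : z != 0 by apply: contraNneq s0 => ->; rewrite spi0.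
have [K K0 hK] := cos_sum_error z.
set c := z * cR pi * spi z in hK.
have c0 : c != 0 := mulf_neq0 (mulf_neq0 z0 cpi_neq0) s0.
have [B hB] := cbmeas_bound (ccontinuous_cbmeas pi (ccontinuous_cos z)).
pose K' := K + N1 c^-1 * K * `|B|.
have [k hk] := inv_nat_small K' e0.
exists k.+2 => -[//|M]; rewrite ltnS => kM t tpi.
have M0 : (0 < M)%N by exact: leq_trans kM.
have [h1 h2] := hK M M0.
have K'0 : 0 <= K'.
  by apply: addr_ge0 => //; apply: mulr_ge0 => //; apply: mulr_ge0 => //; exact: N1_ge0.
apply: le_trans (_ : K' / M%:R <= e); last first.
  apply: le_trans (ltW hk); apply: ler_wpM2l => //.
  by rewrite lef_pV2 ?posrE ?ltr0n// ler_nat.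
have -> : cos_sum M.+1 z t - ccos (z * cR t) = (cos_sum M.+1 z t - cos_sum M.+1 z 0 * ccos (z * cR t))
   + c^-1 * (c * (cos_sum M.+1 z 0 - 1)) * ccos (z * cR t).
  by rewrite mulKf//; ring.
apply: le_trans (N1D _ _) _; rewrite /K' mulrDl; apply: lerD; first exact: h2.
apply: le_trans (N1M _ _) _.
rewrite [leRHS]mulrAC; apply: ler_pM; rewrite ?N1_ge0//; last first.
  by apply: le_trans (hB _ tpi) (ler_norm _).
apply: le_trans (N1M _ _) _; rewrite -[leRHS]mulrA; apply: ler_wpM2l; first exact: N1_ge0.
exact: h1.
Qed.

Lemma cabsM z w : cabs (z * w) = cabs z * cabs w.
Proof.
case: z w => [a b] [c d]; rewrite /cabs /= -sqrtrM ?addr_ge0 ?sqr_ge0//.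
by congr Num.sqrt; ring.
Qed.

Lemma cabsD z w : cabs (z + w) <= cabs z + cabs w.
Proof.
have h u : cR (cabs u) = `|u| by rewrite normc_def; case: u.
have := ler_normD z w; rewrite -!h -cRD lecE /=; by case/andP.
Qed.

Lemma cabsN z : cabs (- z) = cabs z.
Proof. by case: z => a b; rewrite /cabs /= !sqrrN. Qed.

Lemma cabs_cR t : cabs (cR t) = `|t|.
Proof. by rewrite /cabs /= expr0n addr0 sqrtr_sqr. Qed.

Lemma Im_le_cabs z : `|complex.Im z| <= cabs z.
Proof. by case: z => a b; rewrite /cabs /= -sqrtr_sqr ler_wsqrtr// lerDr sqr_ge0. Qed.

Lemma N1_csin_le z : N1 (csin z) <= 2 * expR `|complex.Im z|.
Proof.
case: z => a b; rewrite /N1 /csin /=.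
have e1 := expR_ge0 b; have e2 := expR_ge0 (- b).
have h1 : expR b <= expR `|b| by rewrite ler_expR ler_norm.
have h2 : expR (- b) <= expR `|b| by rewrite ler_expR -normrN ler_norm.
rewrite (normrM (sin a)) (normrM (cos a)) mulr_natl mulr2n; apply: lerD; rewrite -[leRHS]mul1r; apply: ler_pM => //.
- exact: sin_max.
- by rewrite /coshR ger0_norm ?divr_ge0 ?addr_ge0//; move: h1 h2; clear; lra.
- exact: cos_max.
- by rewrite /sinhR ler_norml; apply/andP; split; move: h1 h2 e1 e2; clear; lra.
Qed.

(** In [kc_mul] the numerator is bounded on the disc, while |z^2 - n^2| >= n^2 / 2 as soon as n >= 2
    r. *)
Lemma kc_bound r : 0 <= r -> exists K n0, [/\ 0 <= K, (0 < n0)%N & forall z n, cabs z <= r ->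
  (n0 <= n)%N -> N1 (kc n z) <= K * n%:R ^- 2].
Proof.
move=> r0; have p0 := @pi_gt0 R.
pose S := 2 * expR (pi * r) / pi.
have S0 : 0 <= S by apply: divr_ge0; rewrite ?ltW// mulr_gt0// expR_gt0.
have [m hm] : exists m, 2 * r <= m%:R.
  exists (Num.bound (2 * r)); apply/ltW/archi_boundP.
  exact: mulr_ge0.
exists (8 * r * S), m.+1; split => //; first by apply: mulr_ge0 => //; apply: mulr_ge0.
move=> z [//|n] zr; rewrite ltnS => mn.
set c : R := n.+1%:R.
have c0 : 0 < c by rewrite ltr0n.
have rc : 2 * r <= c by apply: le_trans hm _; rewrite ler_nat ltnW.
have hs : cabs (spi z) <= S.
  have pi0 : 0 <= (@pi R)^-1 by rewrite invr_ge0 ltW.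
  have -> : cabs (spi z) = cabs (csin (cR pi * z)) / pi.
    by rewrite /spi cabsM -cRV cabs_cR ger0_norm.
  apply: ler_wpM2r => //.
  apply: le_trans (cabs_le_N1 _) _; apply: le_trans (N1_csin_le _) _.
  rewrite ler_wpM2l// ler_expR mulrC mul_cR /= normrM (gtr0_norm p0) mulrC.
  by apply: ler_wpM2l; [exact: ltW|exact: le_trans (Im_le_cabs z) zr].
have e : cabs (kc n.+1 z) * cabs (z ^+ 2 - n.+1%:R ^+ 2) = cabs 2 * cabs z * cabs (spi z).
  rewrite -cabsM kc_mul -cR_sign cabsM cabs_cR normrX normrN normr1 expr1n mul1r.
  by rewrite (cabsM (2 * z)) (cabsM 2).
have c2 : cabs 2 = 2 :> R by rewrite -(cRn 2) cabs_cR ger0_norm.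
have low : c ^+ 2 / 2 <= cabs (z ^+ 2 - n.+1%:R ^+ 2).
  have : cabs (n.+1%:R ^+ 2) <= cabs (z ^+ 2 - n.+1%:R ^+ 2) + cabs (z ^+ 2).
    rewrite -[X in X <= _]cabsN.
    have := cabsD (z ^+ 2 - n.+1%:R ^+ 2) (- z ^+ 2).
    by rewrite (cabsN (z ^+ 2)) (_ : z ^+ 2 - n.+1%:R ^+ 2 - z ^+ 2 = - n.+1%:R ^+ 2)//; ring.
  have -> : cabs (n.+1%:R ^+ 2) = c ^+ 2.
    by rewrite -(cRn n.+1) expr2 -cRM cabs_cR -expr2 ger0_norm// exprn_ge0// ltW.
  have h1 : cabs (z ^+ 2) <= r ^+ 2 by rewrite !expr2 cabsM ler_pM ?cabs_ge0.
  have h2 : 4 * r ^+ 2 <= c ^+ 2.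
    have -> : 4 * r ^+ 2 = (2 * r) ^+ 2 by ring.
    by rewrite ler_pXn2r ?nnegrE ?mulr_ge0// (ltW c0).
  move: h1 h2 (sqr_ge0 r); clear; set X := cabs _; set Y := cabs _; move: (c ^+ 2) (r ^+ 2) => u v.
  by lra.
apply: le_trans (N1_le_cabs _) _.
rewrite ler_pdivlMr ?exprn_gt0//.
have k0 := cabs_ge0 (kc n.+1 z).
have hz : cabs z * cabs (spi z) <= r * S by rewrite ler_pM ?cabs_ge0.
have h3 : cabs (kc n.+1 z) * (c ^+ 2 / 2) <= 2 * (r * S).
  apply: le_trans (ler_wpM2l k0 low) _; rewrite e c2 -mulrA.
  by rewrite ler_wpM2l.
by move: h3; clear; set u := cabs _; move: (c ^+ 2) => v; nra.
Qed.

(** The convergence of [cos_sum_cvg] is not uniform in [z], but the tails are, by [kc_bound]. The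
    partial sum is compared with a much longer one, whose length may depend on [z], and only the
    tail between them is charged. *)
Lemma cos_expansion r e : 0 <= r -> 0 < e -> exists N0, forall N, (N0 <= N)%N -> forall z t,
  cabs z <= r -> 0 <= t <= pi -> N1 (cos_sum N z t - ccos (z * cR t)) <= e.
Proof.
move=> r0 e0; have [K [n0 [K0 n00 hK]]] := kc_bound r0.
have [k hk] := inv_nat_small K e0.
exists (n0 + k).+2 => -[//|N]; rewrite ltnS => hN z t zr tpi.
have N0 : (0 < N)%N by exact: leq_ltn_trans hN.
apply: ler_inv_eps => d d0.
have d20 : 0 < d / 2 by rewrite divr_gt0.
have [M hM] := cos_sum_cvg z d20.
exists (d / 2); first by rewrite ltr_pdivrMr// ltr_pMr// ltr1n.
have {}hM := hM (N.+1 + M)%N (leq_addl _ _) t tpi.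
have -> : cos_sum N.+1 z t - ccos (z * cR t)
  = (cos_sum (N.+1 + M) z t - ccos (z * cR t)) - (cos_sum (N.+1 + M) z t - cos_sum N.+1 z t) by ring.
apply: le_trans (N1B _ _) _; rewrite addrC; apply: lerD => //.
rewrite {1}/cos_sum big_split_ord /= addrAC subrr add0r.
apply: le_trans (N1_sum M (fun i => kc (N.+1 + i) z * cR (cos ((N.+1 + i)%:R * t)))) _.
apply: (@le_trans _ _ (\sum_(i < M) K * (N + i).+1%:R ^- 2)).
  apply: ler_sum => i _; rewrite mulrC N1_cRM -[leRHS]mul1r; apply: ler_pM => //; rewrite ?N1_ge0//.
    exact: cos_max.
  apply: hK => //; apply: leq_trans (leq_addr _ _).
  exact: leq_trans (leq_addr k n0) (leqW (ltnW hN)).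
rewrite -mulr_sumr; apply: le_trans (ltW hk); apply: ler_wpM2l => //.
apply: le_trans (inv_sqr_tail M N0) _.
apply: (@le_trans _ _ (N%:R^-1)); first by rewrite gerBl.
rewrite lef_pV2 ?posrE ?ltr0n// ler_nat.
by apply: leq_trans hN; rewrite ltnS leq_addl.
Qed.

End CosineExpansion.

(** * Sampling of functionals of cosines *)

Section CosineBounded.
Context {R : realType}.
Local Notation C := R[i].
Local Notation mu := (@lebesgue_measure R).
Local Notation Int x f := (Rintegral mu `[0%R, x] f).
Implicit Types (z rho : C) (x t s e r tau K : R) (F : C -> C).

(** The nodes are arbitrary complex numbers because one of them will be the point at which the
    series is evaluated. Cosines with |s| <= tau belong to this class, which is stable under linear
    combinations and under integration against [q]. *)
Definition cos_bounded K tau F := forall J (b r : nat -> C) e, 0 <= e ->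
  (forall s, `|s| <= tau -> N1 (\sum_(j < J) b j * ccos (r j * cR s)) <= e) ->
  N1 (\sum_(j < J) b j * F (r j)) <= K * e.

Lemma cos_bounded_ext K tau F G : F =1 G -> cos_bounded K tau F -> cos_bounded K tau G.
Proof. by move=> FG; rewrite (funext FG). Qed.

Lemma cos_bounded_cos tau s : `|s| <= tau -> cos_bounded 1 tau (fun rho => ccos (rho * cR s)).
Proof. by move=> hs J b r e _ h; rewrite mul1r; exact: h. Qed.

Lemma cos_boundedD K K' tau F G : cos_bounded K tau F -> cos_bounded K' tau G ->
  cos_bounded (K + K') tau (fun rho => F rho + G rho).
Proof.
move=> hF hG J b r e e0 h.
have -> : \sum_(j < J) b j * (F (r j) + G (r j)) =
   \sum_(j < J) b j * F (r j) + \sum_(j < J) b j * G (r j).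
  by rewrite -big_split; apply: eq_bigr => j _; rewrite mulrDr.
by apply: le_trans (N1D _ _) _; rewrite mulrDl; apply: lerD; [exact: hF|exact: hG].
Qed.

Lemma cos_boundedZ K tau F c : cos_bounded K tau F -> cos_bounded (N1 c * K) tau (fun rho => c * F rho).
Proof.
move=> hF J b r e e0 h.
have -> : \sum_(j < J) b j * (c * F (r j)) = c * \sum_(j < J) b j * F (r j).
  by rewrite mulr_sumr; apply: eq_bigr => j _; rewrite mulrCA.
apply: le_trans (N1M _ _) _; rewrite -mulrA.
by apply: ler_wpM2l; [exact: N1_ge0|exact: hF].
Qed.

Lemma cos_boundedB K K' tau F G : cos_bounded K tau F -> cos_bounded K' tau G ->
  cos_bounded (K + N1 (-1) * K') tau (fun rho => F rho - G rho).
Proof.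
move=> hF hG; have := cos_boundedD hF (cos_boundedZ (-1) hG).
by apply: cos_bounded_ext => rho; rewrite mulN1r.
Qed.

Lemma cos_boundedW K K' tau F : K <= K' -> cos_bounded K tau F -> cos_bounded K' tau F.
Proof.
move=> KK' hF J b r e e0 h; apply: le_trans (hF J b r e e0 h) _.
exact: ler_wpM2r.
Qed.

Lemma cos_bounded_sn tau w : 0 <= w <= tau -> cos_bounded w tau (fun rho => sn rho w).
Proof.
move=> /andP[w0 wt] J b r e e0 h; rewrite mulrC; apply: sum_sn_le => // v /andP[v0 vw].
by apply: h; rewrite ger0_norm// (le_trans vw).
Qed.

Lemma cos_bounded_cint K tau x (q : R -> C) (F : R -> C -> C) : 0 <= K -> cintble x q ->
  (forall rho, cbmeas x (fun t => F t rho)) ->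
  (forall t, 0 <= t <= x -> cos_bounded K tau (F t)) ->
  cos_bounded (K * Int x (fun t => N1 (q t))) tau (fun rho => cint (fun t => q t * F t rho) 0 x).
Proof.
move=> K0 hq hF h J b r e e0 hb.
have ii j : cintble x (fun t => b j * (q t * F t (r j))) by apply/cintbleZ/cintbleM.
have -> : \sum_(j < J) b j * cint (fun t => q t * F t (r j)) 0 x =
    cint (fun t => q t * \sum_(j < J) b j * F t (r j)) 0 x.
  rewrite (@eq_cint _ _ _ (fun t => \sum_(j < J) b j * (q t * F t (r j)))); last first.
    by move=> t _; rewrite mulr_sumr; apply: eq_bigr => j _; rewrite mulrCA.
  rewrite (@cint_sum _ x J (fun j t => b j * (q t * F t (r j)))) => [|j _]; last exact: ii.
  by apply: eq_bigr => j _; rewrite cintZ//; exact: cintbleM.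
have hqn := intble_N1 hq.
rewrite mulrAC -IntZ//; apply: N1_cint_le.
- apply: cintbleM => //.
  by apply: (@cbmeas_sum _ x J (fun j t => b j * F t (r j))) => j _; apply: cbmeasM => //; exact: cbmeas_cst.
- exact: intbleZ.
- move=> t tx; apply: le_trans (N1M _ _) _; rewrite mulrC; apply: ler_wpM2r; first exact: N1_ge0.
  exact: h.
Qed.

Lemma N1_ccos_real (t : R) : N1 (ccos (cR t)) <= 1.
Proof. by rewrite ccos_cR N1_cR cos_max. Qed.

Lemma cos_bounded_real K tau F t : cos_bounded K tau F -> N1 (F (cR t)) <= K.
Proof.
move=> /(_ 1%N (fun=> 1) (fun=> cR t) 1 ler01).
rewrite big_ord_recl big_ord0 addr0 mul1r mulr1; apply => s _.
by rewrite big_ord_recl big_ord0 addr0 mul1r -cRM N1_ccos_real.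
Qed.

Definition grid tau (n : nat) : C := cR (n%:R * pi / tau).

Lemma sampling K tau F : 0 < tau -> 0 <= K -> cos_bounded K tau F ->
  forall r e, 0 <= r -> 0 < e -> exists N0, forall N, (N0 <= N)%N -> forall rho, cabs rho <= r ->
    N1 (\sum_(n < N) kc n (rho * cR (tau / pi)) * F (grid tau n) - F rho) <= e.
Proof.
move=> tau0 K0 hF r e r0 e0; have p0 := @pi_gt0 R.
have K1 : 0 < K + 1 by rewrite ltr_wpDl.
have tp : 0 < tau / pi by rewrite divr_gt0.
have rt0 : 0 <= r * (tau / pi) by apply: mulr_ge0 => //; exact: ltW.
have [N0 hN0] := cos_expansion rt0 (divr_gt0 e0 K1).
exists N0 => N hN rho hrho.
set z := rho * cR (tau / pi).
have zr : cabs z <= r * (tau / pi).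
  by rewrite cabsM cabs_cR gtr0_norm//; apply: ler_wpM2r => //; exact: ltW.
(* The family consists of the grid nodes with weights [kc n z] and of [rho] with weight -1. Applied
   to F it gives the error of the sampling series; applied to cos (rho s) it gives the error of the
   cosine expansion at t = pi |s| / tau. *)
pose b n := if (n < N)%N then kc n z else -1.
pose g n := if (n < N)%N then grid tau n else rho.
have ext (G : C -> C) : \sum_(n < N.+1) b n * G (g n) = \sum_(n < N) kc n z * G (grid tau n) - G rho.
  rewrite big_ord_recr /= /b /g ltnn mulN1r; congr (_ + _).
  by apply: eq_bigr => n _; rewrite ltn_ord.
rewrite -ext; apply: le_trans (hF _ b g (e / (K + 1)) _ _) _.
- by rewrite divr_ge0 ?(ltW e0) ?(ltW K1).
- move=> s hs; rewrite (ext (fun rho => ccos (rho * cR s))).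
  have spi : 0 <= pi * `|s| / tau <= pi.
    rewrite divr_ge0 ?(ltW tau0)// ?mulr_ge0 ?(ltW p0)//=.
    by rewrite ler_pdivrMr// ler_wpM2l ?(ltW p0).
  have := hN0 N hN z _ zr spi; congr (N1 (_ - _) <= _).
    apply: eq_bigr => n _; congr (_ * _).
    rewrite /grid -cRM ccos_cR; congr cR.
    rewrite -[RHS]cos_norm normrM ger0_norm; last first.
      by rewrite divr_ge0 ?(ltW tau0)// mulr_ge0// ltW.
    by congr cos; ring.
  have -> : z * cR (pi * `|s| / tau) = rho * cR `|s|.
    have id (p : R) : 0 < p -> tau / p * (p * `|s| / tau) = `|s|.
      by move=> pp; field; rewrite !gt_eqF.
    by rewrite /z -mulrA -cRM id.
  by case: ler0P => // _; rewrite cRN mulrN ccosN.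
- rewrite mulrCA ger_pMr// ler_pdivrMr// mul1r; first by rewrite lerDl.
Qed.

Lemma solution_formula L (q : R -> C) rho y0 y1 (y dy : R -> C) : cintble L q ->
  is_solution L q rho y0 y1 y dy -> cbmeas L y /\ forall x, 0 <= x <= L ->
   y x = y0 * ccos (rho * cR x) + y1 * sn rho x + cint (fun t => q t * y t * sn rho (x - t)) 0 x /\
   dy x = - (rho ^+ 2 * sn rho x * y0) + y1 * ccos (rho * cR x)
          + cint (fun t => q t * y t * ccos (rho * cR (x - t))) 0 x.
Proof.
move=> hq [[c1 c2] [[d1 d2] h]].
have by_ : cbmeas L y by split; exact: bmeas_within.
have bdy : cbmeas L dy by split; exact: bmeas_within.
split=> // x xL; apply: (variation_of_constants by_ bdy (cintbleM hq by_)) => // t tL.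
  by have [] := h t tL.
have [_ ->] := h t tL; congr (_ + _); apply: eq_cint => u _; ring.
Qed.

End CosineBounded.

(** * Bessel's inequality for cosines and square summable sequences *)

Section Bessel.
Context {R : realType}.
Local Notation C := R[i].
Local Notation mu := (@lebesgue_measure R).
Local Notation Int x f := (Rintegral mu `[0%R, x] f).
Implicit Types (x t a : R) (k : nat -> nat) (N M n : nat).

Lemma Int_sum x n (f : nat -> R -> R) : (forall i, (i < n)%N -> intble x (f i)) ->
  Int x (fun t => \sum_(i < n) f i t) = \sum_(i < n) Int x (f i) /\
  intble x (fun t => \sum_(i < n) f i t).
Proof.
elim: n => [|n IH] h.
  rewrite big_ord0 (_ : (fun _ => _) = fun=> 0 * 0); last by apply/funext => t; rewrite big_ord0 mulr0.
  split; last exact/bmeas_intble/bmeas_cst.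
  by rewrite (IntZ 0 (bmeas_intble (bmeas_cst x 0))) mul0r.
have [IH1 IH2] := IH (fun i hi => h i (ltnW hi)).
rewrite big_ord_recr /= -IH1 -IntD//; last exact: h.
split.
  by apply: eq_Int => t _; rewrite big_ord_recr.
by apply: eq_intble (intbleD IH2 (h n (ltnSn n))) => t _; rewrite big_ord_recr.
Qed.

Lemma continuous_cosZ a : continuous (fun t : R => cos (a * t)).
Proof.
move=> t; apply: differentiable_continuous; apply/derivable1_diffP.
by have [] := is_derive_cosZ a t.
Qed.

Lemma Int_cosZ x a : 0 <= x -> a != 0 -> Int x (fun t => cos (a * t)) = sin (a * x) / a.
Proof.
move=> x0 a0.
have d (t : R) : is_derive t 1 (fun t => a^-1 * sin (a * t)) (cos (a * t)).
  apply: (is_derive_cast (is_deriveZ a^-1 (is_derive_sinZ a t))).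
  by rewrite /GRing.scale /= mulKf.
by rewrite (Int_FTC x0 (@continuous_cosZ a) d) mulr0 sin0 mulr0 subr0 mulrC.
Qed.

Lemma cos_cos a b : cos a * cos b = 2^-1 * (cos (a - b) + cos (a + b)) :> R.
Proof. by rewrite cosB cosD; field. Qed.

Lemma Int_cos_cos x (m n : nat) : 0 < x -> (0 < m)%N -> (0 < n)%N ->
  Int x (fun t => cos (m%:R * pi / x * t) * cos (n%:R * pi / x * t)) = (m == n)%:R * (x / 2).
Proof.
move=> x0 m0 n0; have p0 := @pi_gt0 R; have x0' := ltW x0.
have pn : @pi R != 0 by rewrite gt_eqF.
have xn : x != 0 by rewrite gt_eqF.
pose A : R := (m%:R - n%:R) * pi / x; pose B : R := (m + n)%:R * pi / x.
have iA a : intble x (fun t => cos (a * t)) by apply/bmeas_intble/bmeas_continuous/continuous_cosZ.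
rewrite (@eq_Int _ _ _ (fun t => 2^-1 * (cos (A * t) + cos (B * t)))); last first.
  move=> t _; rewrite cos_cos /A /B natrD; congr (_ * (cos _ + cos _)); ring.
rewrite IntZ ?IntD//; last exact: intbleD.
have B0 : B != 0 by rewrite !mulf_neq0 ?invr_eq0// pnatr_eq0 addn_eq0 negb_and -!lt0n m0.
rewrite (Int_cosZ x0' B0).
have -> : sin (B * x) = 0 by rewrite /B divfK// mulrC sin_pin.
rewrite mul0r addr0; have [mn|mn] := eqVneq m n.
  rewrite (@eq_Int _ _ _ (fun=> 1)); last by move=> t _; rewrite /A mn subrr !mul0r cos0.
  by rewrite Int_cst// !mul1r mulrC.
have A0 : A != 0 by rewrite !mulf_neq0 ?invr_eq0// subr_eq0 eqr_nat.
rewrite (Int_cosZ x0' A0).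
have -> : sin (A * x) = 0.
  by rewrite /A divfK// mulrBl sinB ![_%:R * pi]mulrC !sin_pin mul0r mulr0 subrr.
by rewrite mul0r mulr0 mul0r.
Qed.

(** Expand 0 <= Int (f - g)^2 for the projection [g] of [f] on the chosen cosines; the factor 2 / x
    normalizes Int cos^2 = x / 2. The injection [k] makes it possible to pick the even or the odd
    frequencies only. *)
Lemma bessel_cos x (f : R -> R) k : 0 < x -> intble x f -> intble x (fun t => f t ^+ 2) ->
  injective k -> (forall i, (0 < k i)%N) -> forall M,
  \sum_(i < M) (Int x (fun t => f t * cos ((k i)%:R * pi / x * t))) ^+ 2 <= x / 2 * Int x (fun t => f t ^+ 2).
Proof.
move=> x0 hf hf2 kinj k0 M.
pose c i t := cos ((k i)%:R * pi / x * t).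
pose b i := Int x (fun t => f t * c i t).
rewrite -/(b _); pose g t := \sum_(i < M) (2 / x * b i) * c i t.
have bc i : bmeas x (c i) by apply/bmeas_continuous/continuous_cosZ.
have hfc i : intble x (fun t => (2 / x * b i) * (f t * c i t)) by apply/intbleZ/intbleM.
have [E1 I1] := @Int_sum x M (fun i t => (2 / x * b i) * (f t * c i t)) (fun i _ => hfc i).
have hcc i j : intble x (fun t => (2 / x * b i) * ((2 / x * b j) * (c i t * c j t))).
  by apply/intbleZ/intbleZ/bmeas_intble/bmeasM.
pose G i t := \sum_(j < M) (2 / x * b i) * ((2 / x * b j) * (c i t * c j t)).
have hG i := @Int_sum x M (fun j t => (2 / x * b i) * ((2 / x * b j) * (c i t * c j t))) (fun j _ => hcc i j).
have [E2 I2] := @Int_sum x M G (fun i _ => proj2 (hG i)).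
have xn : x != 0 by rewrite gt_eqF.
have ccE i j : Int x (fun t => c i t * c j t) = (k i == k j)%:R * (x / 2) := Int_cos_cos x0 (k0 i) (k0 j).
pose B := \sum_(i < M) b i ^+ 2.
have E1' : Int x (fun t => f t * g t) = 2 / x * B.
  rewrite (@eq_Int _ _ _ (fun t => \sum_(i < M) 2 / x * b i * (f t * c i t))); last first.
    by move=> t _; rewrite /g mulr_sumr; apply: eq_bigr => i _; ring.
  rewrite E1 /B mulr_sumr; apply: eq_bigr => i _.
  by rewrite IntZ ?expr2 ?mulrA//; exact: intbleM.
have E2' : Int x (fun t => g t ^+ 2) = 2 / x * B.
  rewrite (@eq_Int _ _ _ (fun t => \sum_(i < M) G i t)); last first.
    move=> t _; rewrite expr2 /g mulr_suml; apply: eq_bigr => i _.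
    by rewrite mulr_sumr; apply: eq_bigr => j _; ring.
  rewrite E2 /B mulr_sumr; apply: eq_bigr => i _; rewrite (proj1 (hG i)).
  rewrite (bigD1 i)//= big1 ?addr0.
    rewrite !IntZ; try by apply/bmeas_intble/bmeasM.
      by rewrite ccE eqxx mul1r; move: (b i) => u; field.
    by apply/intbleZ/bmeas_intble/bmeasM.
  move=> j ji; rewrite !IntZ; try by apply/bmeas_intble/bmeasM.
    rewrite ccE (_ : (k i == k j) = false) ?mul0r ?mulr0//.
    by apply/negbTE; apply: contra ji => /eqP/kinj/val_inj ->.
  by apply/intbleZ/bmeas_intble/bmeasM.
have bg : intble x (fun t => g t ^+ 2).
  apply: eq_intble I2 => t _; rewrite expr2 /g mulr_suml; apply: eq_bigr => i _.
  by rewrite mulr_sumr; apply: eq_bigr => j _; ring.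
have bfg : intble x (fun t => f t * g t).
  apply: eq_intble I1 => t _; rewrite /g mulr_sumr; apply: eq_bigr => i _; ring.
have : 0 <= Int x (fun t => (f t - g t) ^+ 2) by apply: Rintegral_ge0 => t _; exact: sqr_ge0.
rewrite (@eq_Int _ _ _ (fun t => f t ^+ 2 + ((-2) * (f t * g t) + g t ^+ 2))); last first.
  by move=> t _; ring.
rewrite IntD//; last by apply: intbleD => //; exact: intbleZ.
rewrite IntD//; last exact: intbleZ.
rewrite IntZ// E1' E2' => h.
have {h} : 2 / x * B <= Int x (fun t => f t ^+ 2) by move: h; clear; lra.
rewrite -ler_pdivlMl ?divr_gt0//; congr (_ <= _).
by rewrite invf_div.
Qed.

Definition sq_bounded (a : nat -> C) := exists B, forall N, \sum_(n < N) N1 (a n) ^+ 2 <= B.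

Lemma N1_sqr (z : C) : N1 z ^+ 2 <= 2 * (complex.Re z ^+ 2 + complex.Im z ^+ 2).
Proof.
case: z => a b; rewrite /N1 /= -(real_normK (num_real a)) -(real_normK (num_real b)).
move: `|a| `|b| => u v; rewrite -subr_ge0.
have -> : 2 * (u ^+ 2 + v ^+ 2) - (u + v) ^+ 2 = (u - v) ^+ 2 by ring.
exact: sqr_ge0.
Qed.

Lemma cint_cos_sq_bounded x (q : R -> C) k : 0 < x -> cintble x q ->
  intble x (fun t => N1 (q t) ^+ 2) -> injective k -> (forall i, (0 < k i)%N) ->
  sq_bounded (fun n => cint (fun t => q t * cR (cos ((k n)%:R * pi / x * t))) 0 x).
Proof.
move=> x0 [q1 q2] hq2 kinj k0.
have part (p : C -> R) : (forall z, `|p z| <= N1 z) -> intble x (fun t => p (q t)) ->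
    intble x (fun t => p (q t) ^+ 2).
  move=> pN hp; apply: (le_integrable _ _ _ hq2) => //.
    apply/measurable_EFinP/measurable_funX; apply/measurable_EFinP.
    by case/integrableP : hp.
  move=> t _; rewrite lee_fin !normrX ler_pXn2r ?nnegrE//.
  by rewrite (ger0_norm (N1_ge0 _)) pN.
have h1 := bessel_cos x0 q1 (part _ _ q1) kinj k0.
have h2 := bessel_cos x0 q2 (part _ _ q2) kinj k0.
exists (2 * (x / 2 * Int x (fun t => complex.Re (q t) ^+ 2) + x / 2 * Int x (fun t => complex.Im (q t) ^+ 2))).
move=> N; apply: le_trans (ler_sum _ (fun i _ => N1_sqr _)) _.
rewrite -mulr_sumr ler_wpM2l// big_split /=; apply: lerD.
  apply: le_trans (h1 _ N); last by move=> z; rewrite /N1 lerDl.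
  apply: ler_sum => i _; rewrite le_eqVlt; apply/orP; left; apply/eqP; congr (_ ^+ 2).
  by apply: eq_Int => t _; rewrite mul_cR.
apply: le_trans (h2 _ N); last by move=> z; rewrite /N1 lerDr.
apply: ler_sum => i _; rewrite le_eqVlt; apply/orP; left; apply/eqP; congr (_ ^+ 2).
by apply: eq_Int => t _; rewrite mul_cR.
Qed.

(** Only positive indices are compared; the term of index 0 enters the bound as a constant. The
    number 2 multiplying [2 * K ^+ 2] bounds the sum of the inverse squares. *)
Lemma sq_bounded_le (a b : nat -> C) K : sq_bounded b ->
  (forall n, N1 (a n.+1) <= K / n.+1%:R + N1 (b n.+1)) -> sq_bounded a.
Proof.
move=> [B hB] h.
have K0 : 0 <= `|K| by [].
have hi n : \sum_(i < n) (i.+1%:R ^- 2 : R) <= 2.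
  case: n => [|n]; first by rewrite big_ord0.
  rewrite big_ord_recl /= expr1n invr1; have := @inv_sqr_tail R 1 n (ltnSn 0).
  rewrite invr1 => /le_trans; move=> /(_ 1); rewrite gerBl invr_ge0 ler0n => /(_ isT) h1.
  have -> : 2 = 1 + 1 :> R by [].
  by rewrite lerD2l.
exists (N1 (a 0%N) ^+ 2 + (2 * K ^+ 2 * 2 + 2 * B)) => -[|N].
  have B0 : 0 <= B by apply: le_trans (hB 0%N); rewrite big_ord0.
  rewrite big_ord0; apply: addr_ge0; first exact: sqr_ge0.
  apply: addr_ge0; last exact: mulr_ge0.
  by apply: mulr_ge0 => //; apply: mulr_ge0 => //; exact: sqr_ge0.
rewrite big_ord_recl /= lerD2l.
apply: (@le_trans _ _ (\sum_(i < N) (2 * K ^+ 2 * i.+1%:R ^- 2 + 2 * N1 (b i.+1) ^+ 2))).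
  apply: ler_sum => i _; rewrite /bump /= add1n.
  have hn := h i; have h0 := N1_ge0 (a i.+1).
  apply: (@le_trans _ _ ((K / i.+1%:R + N1 (b i.+1)) ^+ 2)).
    by rewrite ler_pXn2r ?nnegrE// (le_trans h0).
  have -> : 2 * K ^+ 2 * i.+1%:R ^- 2 = 2 * (K / i.+1%:R) ^+ 2 by rewrite -mulrA expr_div_n.
  move: (K / _) (N1 _) => u v; rewrite -subr_ge0.
  have -> : 2 * u ^+ 2 + 2 * v ^+ 2 - (u + v) ^+ 2 = (u - v) ^+ 2 by ring.
  exact: sqr_ge0.
rewrite big_split /= -!mulr_sumr; apply: lerD.
  by apply: ler_wpM2l; [rewrite mulr_ge0// sqr_ge0|exact: hi].
rewrite ler_wpM2l//; apply: le_trans (hB N.+1).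
by rewrite big_ord_recl /= lerDr sqr_ge0.
Qed.

End Bessel.

(** * The remainders of S' and phi' *)

Section Solutions.
Context {R : realType}.
Local Notation C := R[i].
Local Notation mu := (@lebesgue_measure R).
Local Notation Int x f := (Rintegral mu `[0%R, x] f).
Implicit Types (z rho : C) (t s e r tau K : R) (F : C -> C).

Variables (L x : R) (q : R -> C) (h : C) (S dS phi dphi : C -> R -> C).
Hypotheses (L0 : 0 < L) (hq : cintble L q) (hq2 : intble L (fun t => N1 (q t) ^+ 2)).
Hypotheses (hS : forall rho, is_solution L q rho 0 1 (S rho) (dS rho)).
Hypotheses (hphi : forall rho, is_solution L q rho 1 h (phi rho) (dphi rho)).
Hypotheses (x0 : 0 < x) (xL : x <= L).

Local Notation w := (omega q x).

(** The solution formula contributes h cos (rho x) and the integral, and subtracting (h + w) (cos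
    (rho x) - sn / x), which is the j_1 term, leaves the last two summands. The term in [sn]
    vanishes at the nonzero nodes, and - w cos (rho x) compensates the mean part of the integral. *)
Definition dphi_rem rho := cint (fun t => q t * (phi rho t * ccos (rho * cR (x - t)))) 0 x
   + ((h + w) / cR x * sn rho x - w * ccos (rho * cR x)).

(** This is 2 rho sin (rho x) times the rest of S', expanded by product-to-sum formulas; it makes
    sense also where rho sin (rho x) = 0. Every piece has the form rho S(t) sin (rho s) with t + s
    <= 2 x, or is a cosine. *)
Definition dS_rem rho := cint (fun t => q t * (rho * S rho t * csin (rho * cR (2 * x - t))
      + rho * S rho t * csin (rho * cR t))) 0 x
   - w * (1 - ccos (rho * cR (2 * x))).

Lemma hqx : cintble x q. Proof. exact: cintbleW hq. Qed.
Lemma hxx : 0 <= x <= L. Proof. by rewrite (ltW x0). Qed.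

Lemma dphi_rem_formula rho : dphi rho x = - rho * csin (rho * cR x)
    - (h + w) * rho * cR x * cj1 (rho * cR x) + dphi_rem rho.
Proof.
have [_ /(_ x hxx) [_ ->]] := solution_formula hq (hphi rho).
have xn0 : cR x != 0 by rewrite cR_eq0 gt_eqF.
have j1E : rho * cR x * cj1 (rho * cR x) = sn rho x / cR x - ccos (rho * cR x).
  rewrite /cj1; case: eqVneq => [e|n0].
    rewrite e mul0r ccos0 /sn.
    move/eqP: e; rewrite mulf_eq0 (negPf xn0) orbF => ->.
    by rewrite mulfV// subrr.
  rewrite mulf_eq0 negb_or in n0; have /andP[r0 _] := n0.
  by rewrite /sn (negPf r0); field; rewrite r0 xn0.
have e1 c : (h + w) * rho * cR x * c = (h + w) * (rho * cR x * c) by ring.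
have e2 : rho ^+ 2 * sn rho x = rho * csin (rho * cR x) by rewrite expr2 -mulrA mul_sn.
rewrite e1 j1E e2 /dphi_rem (@eq_cint _ _ _ (fun t => q t * (phi rho t * ccos (rho * cR (x - t))))).
  by ring.
by move=> t _; rewrite mulrA.
Qed.

Lemma csinM rho a b : csin (rho * cR a) * csin (rho * cR b) =
  cR 2^-1 * (ccos (rho * cR (a - b)) - ccos (rho * cR (a + b))).
Proof.
rewrite !cRD !mulrDr !ccosD cRN mulrN ccosN csinN cRV (cRn 2).
by field.
Qed.

Lemma bmS rho : cbmeas x (S rho).
Proof. by have [/(cbmeasW xL)] := solution_formula hq (hS rho). Qed.

Lemma bmphi rho : cbmeas x (phi rho).
Proof. by have [/(cbmeasW xL)] := solution_formula hq (hphi rho). Qed.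

(** The factored form shows the zeros of the remainder and its relation to S'; the expanded form in
    the definition is the one that can be bounded by cosines. *)
Lemma dS_remE rho : dS_rem rho =
  (2 * rho * csin (rho * cR x)) * cint (fun t => q t * S rho t * ccos (rho * cR (x - t))) 0 x
     - w * (2 * csin (rho * cR x) ^+ 2).
Proof.
have bc : cbmeas x (fun t => ccos (rho * cR (x - t))).
  exact: (ccontinuous_cbmeas x (ccontinuous_rev x (ccontinuous_cos rho))).
rewrite /dS_rem -cintZ; last by apply: cintbleM => //; apply: cintbleM; [exact: hqx|exact: bmS].
congr (_ - _ * _).
  apply: eq_cint => t _.
  have -> : csin (rho * cR (2 * x - t)) = csin (rho * cR x) * ccos (rho * cR (x - t))
      + ccos (rho * cR x) * csin (rho * cR (x - t)).
    by rewrite -csinD -mulrDr -cRD; congr (csin (_ * cR _)); ring.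
  have -> : csin (rho * cR t) = csin (rho * cR x) * ccos (rho * cR (x - t))
      - ccos (rho * cR x) * csin (rho * cR (x - t)).
    rewrite -mulrN -csinN -[ccos (rho * cR (x - t))]ccosN -csinD -mulrN -cRN -mulrDr -cRD.
    by congr (csin (_ * cR _)); ring.
  by ring.
have -> : 2 * x = x + x by ring.
by rewrite cRD mulrDr ccosD -[X in X - _](ccos2Dcsin2 (rho * cR x)); ring.
Qed.

Lemma dS_rem_formula rho : rho != 0 -> csin (rho * cR x) != 0 ->
  dS rho x = ccos (rho * cR x) + w / rho * csin (rho * cR x) + dS_rem rho / (2 * rho * csin (rho * cR x)).
Proof.
move=> r0 s0.
have [_ /(_ x hxx) [_ ->]] := solution_formula hq (hS rho).
rewrite dS_remE mulr0 oppr0 add0r mul1r; field.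
by rewrite r0 s0.
Qed.

Lemma family_bounded y0 y1 (y dy : C -> R -> C) tau :
  (forall rho, is_solution L q rho y0 y1 (y rho) (dy rho)) ->
  exists2 K, 0 <= K & forall t s, 0 <= t <= L -> t + `|s| <= tau ->
    cos_bounded K tau (fun rho => y rho t * ccos (rho * cR s)).
Proof.
move=> hy.
have [K K0 hK] := @functional_bound R L q y0 y1 y tau L0 hq hq2
  (fun rho => proj1 (solution_formula hq (hy rho)))
  (fun rho x xL => proj1 (proj2 (solution_formula hq (hy rho)) x xL)).
by exists K => // t s tL ts J b r e e0 hb; exact: hK.
Qed.

Lemma dphi_rem_bounded : exists2 K, 0 <= K & cos_bounded K x dphi_rem.
Proof.
have [K K0 hK] := family_bounded x hphi.
have x0' := ltW x0.
have B1 := @cos_bounded_cint R K x x q (fun t rho => phi rho t * ccos (rho * cR (x - t))) K0 hqx.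
have {}B1 := B1 (fun rho => cbmeasM (bmphi rho) (ccontinuous_cbmeas x (ccontinuous_rev x (ccontinuous_cos rho)))).
have {}B1 : cos_bounded _ _ _ := B1 _.
have sx : 0 <= x <= x by rewrite x0' lexx.
have ax : `|x| <= x by rewrite ger0_norm.
have B2 := cos_boundedB (cos_boundedZ ((h + w) / cR x) (cos_bounded_sn sx)) (cos_boundedZ w (cos_bounded_cos ax)).
eexists; last apply: (cos_boundedD (B1 _) B2).
  rewrite !addr_ge0 ?mulr_ge0 ?N1_ge0//.
  by apply: Rintegral_ge0 => t _; exact: N1_ge0.
move=> t /andP[t0 tx]; apply: hK; first by rewrite t0 (le_trans tx).
by rewrite ger0_norm ?subr_ge0// addrC subrK.
Qed.

(** [family_bounded] has no room for the factor rho. The Volterra equation turns rho S(t) into sin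
    (rho t) plus an integral of q S(u) sin (rho (t - u)), where rho has been absorbed. A product of
    two sines is a difference of cosines, and the shifts satisfy u + |t - u +- s| <= t + s. *)
Lemma rho_S_sin_bounded tau : exists2 K, 0 <= K & forall t s, 0 <= t <= L -> 0 <= s -> t + s <= tau ->
  cos_bounded K tau (fun rho => rho * S rho t * csin (rho * cR s)).
Proof.
have [K K0 hK] := family_bounded tau hS.
have Iq0 : 0 <= Int L (fun t => N1 (q t)) by apply: Rintegral_ge0 => t _; exact: N1_ge0.
pose K1 : R := N1 (cR 2^-1) * (1 + N1 (-1) * 1); pose K2 := N1 (cR 2^-1) * (K + N1 (-1) * K).
have K10 : 0 <= K1 by rewrite mulr_ge0 ?addr_ge0 ?mulr_ge0 ?N1_ge0.
have K20 : 0 <= K2 by rewrite mulr_ge0 ?addr_ge0 ?mulr_ge0 ?N1_ge0.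
exists (K1 + K2 * Int L (fun t => N1 (q t))); first by rewrite addr_ge0// mulr_ge0.
move=> t s /andP[t0 tL] s0 ts.
have iq := cintbleW tL hq.
have bS rho : cbmeas t (S rho) by have [/(cbmeasW tL)] := solution_formula hq (hS rho).
have bs rho : cbmeas t (fun u => csin (rho * cR (t - u))).
  apply/ccontinuous_cbmeas/(@ccontinuous_rev _ (fun u => csin (rho * cR u))).
  by apply: is_cderive_continuous => u; exact: is_cderive_sin.
pose F u rho := S rho u * (csin (rho * cR (t - u)) * csin (rho * cR s)).
have A1 : cos_bounded K1 tau (fun rho => csin (rho * cR t) * csin (rho * cR s)).
  have h1 : `|t - s| <= tau.
    by apply: le_trans (ler_normB _ _) _; rewrite !ger0_norm.
  have h2 : `|t + s| <= tau by rewrite ger0_norm ?addr_ge0.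
  have := cos_boundedZ (cR 2^-1) (cos_boundedB (cos_bounded_cos h1) (cos_bounded_cos h2)).
  by apply: cos_bounded_ext => rho; rewrite csinM.
have A2 u : 0 <= u <= t -> cos_bounded K2 tau (F u).
  move=> /andP[u0 ut].
  have uL : 0 <= u <= L by rewrite u0 (le_trans ut).
  have tu : 0 <= t - u by rewrite subr_ge0.
  have h1 : u + `|t - u - s| <= tau.
    have := ler_normB (t - u) s; rewrite (ger0_norm tu) (ger0_norm s0) => hh.
    by move: hh ts; lra.
  have h2 : u + `|t - u + s| <= tau.
    rewrite (ger0_norm (addr_ge0 tu s0)); have -> : u + (t - u + s) = t + s by ring.
    exact: ts.
  have := cos_boundedZ (cR 2^-1) (cos_boundedB (hK _ _ uL h1) (hK _ _ uL h2)).
  by apply: cos_bounded_ext => rho; rewrite /F csinM; ring.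
have A3 := cos_bounded_cint K20 iq (fun rho => cbmeasM (bS rho) (cbmeasM (bs rho) (cbmeas_cst t (csin (rho * cR s))))) A2.
apply: (@cos_boundedW R (K1 + K2 * Int t (fun u => N1 (q u)))).
  rewrite lerD2l ler_wpM2l//; apply: le_Int_itv => //; first exact: intble_N1.
  by move=> u; exact: N1_ge0.
have := cos_boundedD A1 A3; apply: cos_bounded_ext => rho.
have tL' : 0 <= t <= L by rewrite t0.
have [_ /(_ t tL') [-> _]] := solution_formula hq (hS rho).
have bsn : cbmeas t (fun u => sn rho (t - u)).
  exact: (ccontinuous_cbmeas t (ccontinuous_rev t (ccontinuous_sn rho))).
rewrite mul0r add0r mul1r mulrDr mul_sn mulrDl; congr (_ + _).
rewrite -cintZ; last by apply: cintbleM => //; exact: cintbleM.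
rewrite [RHS]mulrC -cintZ; last by apply: cintbleZ; apply: cintbleM => //; exact: cintbleM.
by apply: eq_cint => u _; rewrite /F -mul_sn; ring.
Qed.

Lemma dS_rem_bounded : exists2 K, 0 <= K & cos_bounded K (2 * x) dS_rem.
Proof.
have [K K0 hK] := rho_S_sin_bounded (2 * x).
have x0' := ltW x0.
have b2 a b rho : cbmeas x (fun t => rho * S rho t * csin (rho * cR (a - b * t))).
  apply: cbmeasM; first by apply: cbmeasM; [exact: cbmeas_cst|exact: bmS].
  apply: ccontinuous_cbmeas.
  apply: (@ccontinuous_comp _ (fun u => csin (rho * cR u)) (fun t => a - b * t)).
    by apply: is_cderive_continuous => u; exact: is_cderive_sin.
  by move=> t; apply: cvgB; [exact: cvg_cst|apply: cvgM; [exact: cvg_cst|exact: cvg_id]].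
have bF rho : cbmeas x (fun t => rho * S rho t * csin (rho * cR (2 * x - t))
      + rho * S rho t * csin (rho * cR t)).
  apply: cbmeasD.
    by have := b2 (2 * x) 1 rho; congr cbmeas; apply/funext => t; rewrite mul1r.
  by have := b2 0 (-1) rho; congr cbmeas; apply/funext => t; rewrite mulN1r opprK add0r.
have B1 : forall t, 0 <= t <= x -> cos_bounded (K + K) (2 * x) (fun rho => rho * S rho t * csin (rho * cR (2 * x - t))
      + rho * S rho t * csin (rho * cR t)).
  move=> t /andP[t0 tx]; have tL : 0 <= t <= L by rewrite t0 (le_trans tx).
  apply: cos_boundedD; apply: hK => //.
  - by rewrite subr_ge0; move: t0 tx; lra.
  - by rewrite addrC subrK.
  - by move: tx; lra.
have B2 := cos_bounded_cint (addr_ge0 K0 K0) hqx bF B1.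
have a2 : `|2 * x| <= 2 * x by rewrite ger0_norm// mulr_ge0.
(* The constant 1 in [dS_rem] is treated as the cosine with s = 0. *)
have a0 : `|0 : R| <= 2 * x by rewrite normr0 mulr_ge0.
have B3 := cos_boundedZ w (cos_boundedB (cos_bounded_cos a0) (cos_bounded_cos a2)).
eexists; last first.
  apply: cos_bounded_ext (cos_boundedB B2 B3) => rho.
  by rewrite /dS_rem cR0 mulr0 ccos0.
rewrite !addr_ge0 ?mulr_ge0 ?addr_ge0 ?mulr_ge0 ?N1_ge0//.
by apply: Rintegral_ge0 => t _; exact: N1_ge0.
Qed.

Lemma cint_mul_le (f g : R -> C) t M : cintble t f -> cbmeas t g ->
  (forall u, 0 <= u <= t -> N1 (g u) <= M) ->
  N1 (cint (fun u => f u * g u) 0 t) <= M * Int t (fun u => N1 (f u)).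
Proof.
move=> hf hg hM; have hfn := intble_N1 hf.
rewrite -IntZ//; apply: N1_cint_le; [exact: cintbleM|exact: intbleZ|].
move=> u ut; apply: le_trans (N1M _ _) _; rewrite mulrC.
by apply: ler_wpM2r; [exact: N1_ge0|exact: hM].
Qed.

Lemma Int_N1_le f t : t <= L -> cintble L f -> Int t (fun u => N1 (f u)) <= Int L (fun u => N1 (f u)).
Proof. by move=> tL hf; apply: le_Int_itv => //; [exact: intble_N1|move=> u; exact: N1_ge0]. Qed.

Lemma Int_N1_ge0 f t : 0 <= Int t (fun u => N1 (f u)).
Proof. by apply: Rintegral_ge0 => u _; exact: N1_ge0. Qed.

Lemma sn_cR r v : 0 < r -> sn (cR r) v = cR (sin (r * v) / r).
Proof. by move=> r0; rewrite /sn cR_eq0 gt_eqF// -cRM csin_cR -cRV -cRM. Qed.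

Lemma N1_sn_cR r v : 0 < r -> N1 (sn (cR r) v) <= r^-1.
Proof.
move=> r0; have ri : 0 <= r^-1 by rewrite invr_ge0 ltW.
rewrite sn_cR// N1_cR normrM (ger0_norm ri).
by apply: ler_piMl => //; exact: sin_max.
Qed.

Lemma N1_csin_cR (t : R) : N1 (csin (cR t)) <= 1.
Proof. by rewrite csin_cR N1_cR sin_max. Qed.

Lemma family_real_bounded y0 y1 (y dy : C -> R -> C) :
  (forall rho, is_solution L q rho y0 y1 (y rho) (dy rho)) ->
  exists2 K, 0 <= K & forall r t, 0 <= t <= L -> N1 (y (cR r) t) <= K.
Proof.
move=> /(family_bounded L) [K K0 hK]; exists K => // r t tL.
have tt : t + `|0 : R| <= L by rewrite normr0 addr0; case/andP: tL.
have := cos_bounded_real r (hK t 0 tL tt).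
by rewrite cR0 mulr0 ccos0 mulr1.
Qed.

Lemma phi_decay : exists2 K, 0 <= K & forall r t, 0 < r -> 0 <= t <= L ->
  N1 (phi (cR r) t - ccos (cR r * cR t)) <= K / r.
Proof.
have [K K0 hK] := family_real_bounded hphi.
exists (N1 h + K * Int L (fun t => N1 (q t))).
  by rewrite addr_ge0 ?N1_ge0// mulr_ge0// Int_N1_ge0.
move=> r t r0 tL; have [t0 tL'] := andP tL.
have [/(cbmeasW tL') bphi /(_ t tL) [-> _]] := solution_formula hq (hphi (cR r)).
have iq := cintbleW tL' hq.
rewrite mul1r addrAC [_ - ccos _]addrAC subrr add0r mulrDl.
have r0' := ltW r0; have ri : 0 <= r^-1 by rewrite invr_ge0.
apply: le_trans (N1D _ _) _; apply: lerD.
  by apply: le_trans (N1M _ _) _; apply: ler_wpM2l; [exact: N1_ge0|exact: N1_sn_cR].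
rewrite (@eq_cint _ _ _ (fun u => q u * (phi (cR r) u * sn (cR r) (t - u)))); last first.
  by move=> u _; rewrite mulrA.
apply: le_trans (@cint_mul_le _ _ _ (K * r^-1) iq _ _) _.
- apply: cbmeasM => //.
  exact: (ccontinuous_cbmeas t (ccontinuous_rev t (ccontinuous_sn (cR r)))).
- move=> u /andP[u0 ut]; apply: le_trans (N1M _ _) _; apply: ler_pM; rewrite ?N1_ge0//.
    by apply: hK; rewrite u0 (le_trans ut).
  exact: N1_sn_cR.
- rewrite mulrAC; apply: ler_wpM2r => //; apply: ler_wpM2l => //; exact: Int_N1_le.
Qed.

(** The Volterra equation is used twice: [hS1] gives S = O(1 / r), and then r S - sin (r t), an
    integral of q S sin, is O(1 / r) as well. *)
Lemma S_decay : exists2 K, 0 <= K & forall r t, 0 < r -> 0 <= t <= L ->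
  N1 (cR r * S (cR r) t - csin (cR r * cR t)) <= K / r.
Proof.
have [K K0 hK] := family_real_bounded hS.
pose I := Int L (fun t => N1 (q t)); have I0 : 0 <= I := Int_N1_ge0 _ _.
have hS1 r t : 0 < r -> 0 <= t <= L -> N1 (S (cR r) t) <= (1 + K * I) / r.
  move=> r0 tL; have [t0 tL'] := andP tL.
  have [/(cbmeasW tL') bS /(_ t tL) [-> _]] := solution_formula hq (hS (cR r)).
  have iq := cintbleW tL' hq; have ri : 0 <= r^-1 by rewrite invr_ge0 ltW.
  rewrite mul0r add0r mul1r mulrDl; apply: le_trans (N1D _ _) _; apply: lerD.
    by rewrite mul1r; exact: N1_sn_cR.
  rewrite (@eq_cint _ _ _ (fun u => q u * (S (cR r) u * sn (cR r) (t - u)))); last first.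
    by move=> u _; rewrite mulrA.
  apply: le_trans (@cint_mul_le _ _ _ (K * r^-1) iq _ _) _.
  - apply: cbmeasM => //.
    exact: (ccontinuous_cbmeas t (ccontinuous_rev t (ccontinuous_sn (cR r)))).
  - move=> u /andP[u0 ut]; apply: le_trans (N1M _ _) _; apply: ler_pM; rewrite ?N1_ge0//.
      by apply: hK; rewrite u0 (le_trans ut).
    exact: N1_sn_cR.
  - by rewrite mulrAC; apply: ler_wpM2r => //; apply: ler_wpM2l => //; exact: Int_N1_le.
exists ((1 + K * I) * I); first by rewrite mulr_ge0// addr_ge0// mulr_ge0.
move=> r t r0 tL; have [t0 tL'] := andP tL.
have [/(cbmeasW tL') bS /(_ t tL) [-> _]] := solution_formula hq (hS (cR r)).
have iq := cintbleW tL' hq; have ri : 0 <= r^-1 by rewrite invr_ge0 ltW.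
have bsn : cbmeas t (fun u => sn (cR r) (t - u)).
  exact: (ccontinuous_cbmeas t (ccontinuous_rev t (ccontinuous_sn (cR r)))).
have bcs : cbmeas t (fun u => csin (cR r * cR (t - u))).
  have := cbmeasM (cbmeas_cst t (cR r)) bsn; congr cbmeas.
  by apply/funext => u; rewrite mul_sn.
rewrite mul0r add0r mul1r mulrDr mul_sn addrAC subrr add0r.
rewrite -cintZ; last by apply: cintbleM => //; exact: cintbleM.
rewrite (@eq_cint _ _ _ (fun u => q u * (S (cR r) u * csin (cR r * cR (t - u))))); last first.
  by move=> u _; rewrite -mul_sn; ring.
have c0 : 0 <= (1 + K * I) / r by rewrite mulr_ge0// addr_ge0// mulr_ge0.
apply: le_trans (@cint_mul_le _ _ _ ((1 + K * I) / r) iq _ _) _.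
- exact: cbmeasM.
- move=> u /andP[u0 ut]; apply: le_trans (N1M _ _) _; rewrite -[leRHS]mulr1.
  apply: ler_pM; rewrite ?N1_ge0//; last by rewrite -cRM N1_csin_cR.
  by apply: hS1 => //; rewrite u0 (le_trans ut).
- by rewrite [leRHS]mulrAC; apply: ler_wpM2l => //; exact: Int_N1_le.
Qed.

Lemma cintq_cos_ble a t : t <= L -> cintble t (fun u => q u * cR (cos (a * u))).
Proof.
move=> tL; apply: cintbleM; first exact: cintbleW hq.
apply: ccontinuous_cbmeas; apply: is_cderive_continuous => u; apply: is_cderive_cR.
Qed.

Lemma cRsq_sign n : cR ((-1) ^+ n : R) * cR ((-1) ^+ n) = 1.
Proof. by rewrite -cRM -expr2 sqrr_sign. Qed.

Lemma N1_sign n z : N1 (cR ((-1) ^+ n) * z) = N1 z.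
Proof. by rewrite N1_cRM normrX normrN normr1 expr1n mul1r. Qed.

(** At a node sin (r x) = 0 and cos (r x) = (-1)^m, so cos (r t) cos (r (x - t)) = (-1)^m (1 + cos
    (2 r t)) / 2. Its constant part cancels w cos (r x). There remain half of a cosine coefficient
    of [q] of even frequency and the contribution of [E], which is O(1 / r) by [phi_decay]. *)
Lemma dphi_rem_sample : exists K, forall n, N1 (dphi_rem (grid x n.+1)) <=
  K / n.+1%:R + N1 (cint (fun t => q t * cR (cos ((2 * n.+1)%:R * pi / x * t))) 0 x).
Proof.
have [K K0 hK] := phi_decay; have p0 := @pi_gt0 R.
have x0' := ltW x0.
exists (K * (x / pi) * Int x (fun t => N1 (q t))) => n.
set m := n.+1; set r : R := m%:R * pi / x.
have r0 : 0 < r by rewrite divr_gt0// mulr_gt0// ltr0n.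
have rx : r * x = pi * m%:R by rewrite /r divfK ?gt_eqF// mulrC.
have crx : cos (r * x) = (-1) ^+ m by rewrite rx cos_pin.
have srx : sin (r * x) = 0 by rewrite rx sin_pin.
pose E t := phi (cR r) t - ccos (cR r * cR t).
have bc : cbmeas x (fun t => ccos (cR r * cR (x - t))).
  exact: (ccontinuous_cbmeas x (ccontinuous_rev x (ccontinuous_cos (cR r)))).
have bct : cbmeas x (fun t => ccos (cR r * cR t)) := ccontinuous_cbmeas x (ccontinuous_cos (cR r)).
have bE : cbmeas x (fun t => E t * ccos (cR r * cR (x - t))).
  apply: cbmeasM => //; rewrite /E.
  have := cbmeasD (bmphi (cR r)) (cbmeasM (cbmeas_cst x (-1)) bct).
  by congr cbmeas; apply/funext => t; rewrite mulN1r.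
have prod t : ccos (cR r * cR t) * ccos (cR r * cR (x - t)) =
    cR 2^-1 * cR ((-1) ^+ m) * (1 + cR (cos ((2 * m)%:R * pi / x * t))).
  rewrite -!cRM !ccos_cR -cRM cos_cos.
  have -> : r * t + r * (x - t) = r * x by ring.
  have -> : r * t - r * (x - t) = (2 * m)%:R * pi / x * t - r * x by rewrite /r natrM; ring.
  rewrite cosB crx srx mulr0 addr0 -cR1 -cRD -!cRM; congr cR.
  by ring.
have iqc := cintq_cos_ble ((2 * m)%:R * pi / x) xL.
have -> : dphi_rem (grid x m) = cint (fun t => q t * (E t * ccos (cR r * cR (x - t)))) 0 x +
   cR ((-1) ^+ m) * (cR 2^-1 * cint (fun t => q t * cR (cos ((2 * m)%:R * pi / x * t))) 0 x).
  rewrite /dphi_rem /grid -/r (sn_cR x r0) srx mul0r cR0 mulr0 sub0r -cRM ccos_cR crx.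
  rewrite (@eq_cint _ _ _ (fun t => q t * (E t * ccos (cR r * cR (x - t))) +
     cR 2^-1 * cR ((-1) ^+ m) * (q t + q t * cR (cos ((2 * m)%:R * pi / x * t))))); last first.
    move=> t _; have -> : phi (cR r) t = E t + ccos (cR r * cR t) by rewrite /E subrK.
    by rewrite mulrDl mulrDr prod; ring.
  have iq2 : cintble x (fun t => q t + q t * cR (cos ((2 * m)%:R * pi / x * t))).
    by apply: cintbleD => //; exact: hqx.
  rewrite cintD; [|by apply: cintbleM => //; exact: hqx|exact: cintbleZ].
  rewrite cintZ// cintD//; last exact: hqx.
  by rewrite /omega cRV (cRn 2); ring.
apply: le_trans (N1D _ _) _; apply: lerD; last first.
  rewrite N1_sign N1_cRM ger0_norm ?invr_ge0//.
  by apply: ler_piMl; [exact: N1_ge0|rewrite invf_le1// ler1n].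
have Kr : K / r = K * (x / pi) / m%:R by rewrite /r !invfM invrK; ring.
apply: le_trans (@cint_mul_le _ _ _ (K / r) hqx bE _) _; last by rewrite Kr mulrAC.
move=> t /andP[t0 tx]; apply: le_trans (N1M _ _) _; rewrite -[leRHS]mulr1.
apply: ler_pM; rewrite ?N1_ge0//; last by rewrite -cRM N1_ccos_real.
by apply: hK => //; rewrite t0 (le_trans tx).
Qed.

(** At an odd node cos (r x) = 0 and sin (r x) = (-1)^n, so cos (r (x - t)) = (-1)^n sin (r t). The
    resulting sin^2 (r t) = (1 - cos (2 r t)) / 2 has a mean part that cancels the term in [w], and
    2 r = m pi / x is an odd frequency. *)
Lemma dS_rem_sample : exists K, forall n, N1 (dS_rem (grid (2 * x) (2 * n).+1)) <=
  K / n.+1%:R + N1 (cint (fun t => q t * cR (cos ((2 * n).+1%:R * pi / x * t))) 0 x).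
Proof.
have [K K0 hK] := S_decay; have p0 := @pi_gt0 R.
have x0' := ltW x0.
pose I := Int x (fun t => N1 (q t)); have I0 : 0 <= I := Int_N1_ge0 _ _.
exists (4 * (K * (x / pi)) * I) => n.
set m := (2 * n).+1; set r : R := m%:R * pi / (2 * x).
have m0 : (0 : R) < m%:R by rewrite ltr0n.
have r0 : 0 < r by rewrite divr_gt0// mulr_gt0.
have rx : r * x = pi * n%:R + pi / 2.
  rewrite /r /m -natr1 natrM; have xn : x != 0 by rewrite gt_eqF.
  by move: (@pi R) => p; field.
have crx : cos (r * x) = 0 by rewrite rx cosDpihalf sin_pin oppr0.
have srx : sin (r * x) = (-1) ^+ n by rewrite rx sinDpihalf cos_pin.
pose E t := cR r * S (cR r) t - csin (cR r * cR t).
have bst : cbmeas x (fun t => csin (cR r * cR t)).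
  by apply/ccontinuous_cbmeas/(is_cderive_continuous (f := fun t => cR r * ccos (cR r * cR t))) => t; exact: is_cderive_sin.
have bE : cbmeas x E.
  have := cbmeasD (cbmeasM (cbmeas_cst x (cR r)) (bmS (cR r))) (cbmeasM (cbmeas_cst x (-1)) bst).
  by congr cbmeas; apply/funext => t; rewrite mulN1r.
have bEs : cbmeas x (fun t => E t * csin (cR r * cR t)) by apply: cbmeasM.
have cost t : ccos (cR r * cR (x - t)) = cR ((-1) ^+ n) * csin (cR r * cR t).
  rewrite -!cRM ccos_cR csin_cR mulrBr cosB crx srx mul0r add0r cRM //.
have sqst t : csin (cR r * cR t) * csin (cR r * cR t) = cR 2^-1 * (1 - cR (cos (m%:R * pi / x * t))).
  rewrite csinM subrr cR0 mulr0 ccos0 -cRM ccos_cR; congr (_ * (1 - cR (cos _))).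
  by rewrite /r invfM; field; rewrite gt_eqF.
have iqc := cintq_cos_ble (m%:R * pi / x) xL.
have iqE : cintble x (fun t => q t * (E t * csin (cR r * cR t))).
  by apply: cintbleM => //; exact: hqx.
have -> : dS_rem (grid (2 * x) m) = 2 * cint (fun t => q t * (E t * csin (cR r * cR t))) 0 x
   - cint (fun t => q t * cR (cos (m%:R * pi / x * t))) 0 x.
  rewrite dS_remE /grid -/r -[cR r * cR x]cRM csin_cR srx.
  have s2 : cR ((-1) ^+ n : R) ^+ 2 = 1 by rewrite expr2 cRsq_sign.
  have iqS : cintble x (fun t => q t * S (cR r) t * ccos (cR r * cR (x - t))).
    apply: cintbleM; first by apply: cintbleM; [exact: hqx|exact: bmS].
    exact: (ccontinuous_cbmeas x (ccontinuous_rev x (ccontinuous_cos (cR r)))).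
  rewrite -(cintZ _ iqS) (@eq_cint _ _ _ (fun t => 2 * (q t * (E t * csin (cR r * cR t))) +
     (q t - q t * cR (cos (m%:R * pi / x * t))))); last first.
    move=> t _; rewrite cost.
    have -> : 2 * cR r * cR ((-1) ^+ n) * (q t * S (cR r) t * (cR ((-1) ^+ n) * csin (cR r * cR t))) =
       2 * q t * (cR r * S (cR r) t) * csin (cR r * cR t) * cR ((-1) ^+ n) ^+ 2 by ring.
    have -> : cR r * S (cR r) t = E t + csin (cR r * cR t) by rewrite /E subrK.
    rewrite s2 mulr1.
    have -> : 2 * q t * (E t + csin (cR r * cR t)) * csin (cR r * cR t) =
       2 * (q t * (E t * csin (cR r * cR t))) + 2 * q t * (csin (cR r * cR t) * csin (cR r * cR t)) by ring.
    by rewrite sqst cRV (cRn 2); field.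
  rewrite cintD; [|exact: cintbleZ|by apply: cintbleD; [exact: hqx|exact: cintbleN]].
  rewrite cintZ// cintB//; last exact: hqx.
  by rewrite s2 /omega; field.
apply: le_trans (N1B _ _) _; rewrite lerD2r -(cRn 2) N1_cRM ger0_norm//.
have Kr : K / r <= 2 * (K * (x / pi)) / n.+1%:R.
  have -> : K / r = 2 * (K * (x / pi)) / m%:R by rewrite /r !invfM !invrK; ring.
  rewrite ler_wpM2l//; first by rewrite !mulr_ge0 ?invr_ge0 ?(ltW p0).
  by rewrite lef_pV2 ?posrE ?ltr0n// ler_nat /m ltnS leq_pmull.
have Kn : 4 * (K * (x / pi)) * I / n.+1%:R = 2 * ((2 * (K * (x / pi)) / n.+1%:R) * I) by ring.
rewrite Kn; apply: ler_wpM2l => //.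
apply: cint_mul_le => //; first exact: hqx.
move=> t /andP[t0 tx]; apply: le_trans (N1M _ _) _; rewrite -[leRHS]mulr1.
apply: ler_pM; rewrite ?N1_ge0//; last by rewrite -cRM N1_csin_cR.
by apply: le_trans Kr; apply: hK => //; rewrite t0 (le_trans tx).
Qed.

(** The value at 0 is left free because the coefficient of index 0 is only half of the sample
    there. *)
Lemma sq_bounded_dphi_rem (a : nat -> C) : (forall n, a n.+1 = dphi_rem (grid x n.+1)) -> sq_bounded a.
Proof.
move=> ha; have [K hK] := dphi_rem_sample.
have hq2x := intbleW xL hq2.
pose k n := if n == 0%N then 1%N else (2 * n)%N.
have kinj : injective k.
  by move=> [|i] [|j]; rewrite /k //=; lia.
have kpos i : (0 < k i)%N by case: i.
have hb := cint_cos_sq_bounded x0 hqx hq2x kinj kpos.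
by apply: (sq_bounded_le (K := K) hb) => n; rewrite ha; exact: hK.
Qed.

Lemma sq_bounded_dS_rem : sq_bounded (fun n => dS_rem (grid (2 * x) (2 * n).+1)).
Proof.
have [K hK] := dS_rem_sample.
have hq2x := intbleW xL hq2.
have kinj : injective (fun n => (2 * n).+1).
  by move=> i j [/eqP]; rewrite eqn_pmul2l// => /eqP.
have hb := cint_cos_sq_bounded x0 hqx hq2x kinj (fun i => ltn0Sn (2 * i)).
(* The estimate at [n.+1] has the denominator [n.+2]; the absolute value of [K] allows enlarging it
   to the required [n.+1]. *)
apply: (@sq_bounded_le _ _ _ `|K| hb) => n; apply: le_trans (hK n.+1) _; rewrite lerD2r.
apply: (@le_trans _ _ (`|K| / n.+2%:R)).
  by rewrite ler_wpM2r ?ler_norm// invr_ge0.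
by rewrite ler_wpM2l// lef_pV2 ?posrE ?ltr0n// ler_nat.
Qed.

Lemma dS_rem_even n : dS_rem (grid (2 * x) (2 * n)) = 0.
Proof.
have hs : csin (grid (2 * x) (2 * n) * cR x) = 0.
  rewrite /grid -cRM csin_cR natrM.
  have -> : 2 * n%:R * pi / (2 * x) * x = pi * n%:R.
    have xn : x != 0 by rewrite gt_eqF.
    by move: (@pi R) => p; field.
  by rewrite sin_pin cR0.
by rewrite dS_remE hs mulr0 mul0r expr0n /= mulr0 mulr0 subr0.
Qed.

End Solutions.

(** * Convergence on the real line *)

Section SincSeries.
Context {R : realType}.
Local Notation C := R[i].
Local Notation mu := (@lebesgue_measure R).
Local Notation Int x f := (Rintegral mu `[0%R, x] f).
Implicit Types (t s e : R) (c : nat -> C) (m : nat -> nat) (N M K n : nat).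

Definition rsinc t : R := if t == 0 then 1 else sin (pi * t) / (pi * t).

Lemma csinc_cR t : csinc (cR t) = cR (rsinc t).
Proof.
rewrite /csinc /rsinc cR_eq0; case: ifP => // t0.
by rewrite -cRM csin_cR -cRV -cRM.
Qed.

(** Sinc as an average of cosines is the source of both its Lipschitz bound and its positive
    definiteness. *)
Lemma Int_cos_rsinc t : Int 1 (fun u => cos (pi * t * u)) = rsinc t.
Proof.
rewrite /rsinc; case: eqVneq => [->|t0].
  rewrite (@eq_Int _ _ _ (fun=> 1)); last by move=> u _; rewrite mulr0 mul0r cos0.
  by rewrite Int_cst// mulr1.
by rewrite Int_cosZ ?mulr1// mulf_neq0// gt_eqF// pi_gt0.
Qed.

Lemma rsincN t : rsinc (- t) = rsinc t.
Proof.
rewrite /rsinc oppr_eq0; case: ifP => // t0.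
by rewrite mulrN sinN invrN mulrNN.
Qed.

Lemma rsinc_nat (i j : nat) : rsinc (i%:R - j%:R) = (i == j)%:R.
Proof.
rewrite /rsinc subr_eq0 eqr_nat; case: eqVneq => // ij.
by rewrite mulrBr sinB !sin_pin mul0r mulr0 subrr mul0r.
Qed.

Lemma rsinc_lipschitz s t : `|rsinc s - rsinc t| <= pi * `|s - t|.
Proof.
have p0 := @pi_gt0 R.
have ii (a : R) : intble 1 (fun u => cos (a * u)) by apply/bmeas_intble/bmeas_continuous/continuous_cosZ.
rewrite -!Int_cos_rsinc -IntB//.
have hB : intble 1 (fun u => cos (pi * s * u) - cos (pi * t * u)).
  by apply: intbleD => //; exact: intbleN.
apply: le_trans (norm_Int hB) _.
apply: (@le_trans _ _ (Int 1 (fun=> pi * `|s - t|))); last by rewrite Int_cst// mulr1.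
apply: le_Int; [exact: intble_norm|exact/bmeas_intble/bmeas_cst|].
move=> u /andP[u0 u1].
have lip a b : `|cos a - cos b| <= `|a - b| :> R.
  wlog ab : a b / b <= a.
    by move=> H; case: (leP b a) => [/H//|/ltW /H]; rewrite distrC [`|b - a|]distrC.
  have ab0 : 0 <= a - b by rewrite subr_ge0.
  have := @mvt_bound R (fun v => cos (b + v)) (fun v => - sin (b + v)) (a - b) 1 ab0.
  rewrite addr0 (_ : b + (a - b) = a); last by ring.
  rewrite mul1r (ger0_norm ab0); apply => v _; last by rewrite normrN sin_max.
  have hv : is_derive v 1 (fun v : R => b + v) 1.
    by apply: (is_derive_cast (is_deriveD (is_derive_cst b v 1) (is_derive_id v 1))); rewrite add0r.
  apply: (is_derive_cast (@is_derive1_comp R cos (fun v => b + v) v _ _ (is_derive_cos _) hv)).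
  by rewrite mulr1.
apply: le_trans (lip _ _) _.
rewrite -mulrBl -mulrBr !normrM (ger0_norm u0) (gtr0_norm p0).
by apply: ler_piMr => //; rewrite mulr_ge0// ltW.
Qed.

(** The double sum is the integral over u in [0, 1] of the squared modulus of the sum of b_i exp (i
    pi w_i u), whose real and imaginary parts are [A] and [B]. *)
Lemma rsinc_posdef J (b w : nat -> R) :
  0 <= \sum_(i < J) \sum_(j < J) b i * b j * rsinc (w i - w j).
Proof.
pose A u := \sum_(i < J) b i * cos (pi * w i * u).
pose B u := \sum_(i < J) b i * sin (pi * w i * u).
have ii a : intble 1 (fun u => cos (a * u)) by apply/bmeas_intble/bmeas_continuous/continuous_cosZ.
have hi i j : intble 1 (fun u => b i * b j * cos (pi * (w i - w j) * u)) by exact: intbleZ.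
have hI i := @Int_sum R 1 J (fun j u => b i * b j * cos (pi * (w i - w j) * u)) (fun j _ => hi i j).
have [<- _] : Int 1 (fun u => \sum_(i < J) \sum_(j < J) b i * b j * cos (pi * (w i - w j) * u)) =
  \sum_(i < J) \sum_(j < J) b i * b j * rsinc (w i - w j) /\ True.
  split=> //.
  have [-> _] := @Int_sum R 1 J (fun i u => \sum_(j < J) b i * b j * cos (pi * (w i - w j) * u)) (fun i _ => proj2 (hI i)).
  apply: eq_bigr => i _; rewrite (proj1 (hI i)); apply: eq_bigr => j _.
  by rewrite IntZ// Int_cos_rsinc.
rewrite (@eq_Int _ _ _ (fun u => A u ^+ 2 + B u ^+ 2)); last first.
  move=> u _; rewrite /A /B !expr2 !mulr_suml -big_split /=; apply: eq_bigr => i _.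
  rewrite !mulr_sumr -big_split /=; apply: eq_bigr => j _.
  by rewrite mulrBr mulrBl cosB; ring.
by apply: Rintegral_ge0 => u _; rewrite addr_ge0// sqr_ge0.
Qed.

Lemma sum_delta J (F : nat -> nat -> R) (d : nat -> nat -> R) :
  (forall i j, d i j = (i == j)%:R) ->
  \sum_(i < J) \sum_(j < J) F i j * d i j = \sum_(i < J) F i i.
Proof.
move=> hd; apply: eq_bigr => i _; rewrite (bigD1 i)//= hd eqxx mulr1 big1 ?addr0// => j ji.
by rewrite hd (_ : (i == j :> nat) = false) ?mulr0//; apply/negbTE; rewrite eq_sym.
Qed.

(* Bessel's inequality for the orthonormal system of point evaluations: apply
   positive definiteness to the points u_i with weights a_i together with the
   points v_k with weights - P(v_k). *)
Lemma sinc_bessel N K (a u v : nat -> R) :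
  (forall i j, rsinc (u i - u j) = (i == j)%:R) ->
  (forall i j, rsinc (v i - v j) = (i == j)%:R) ->
  \sum_(k < K) (\sum_(i < N) a i * rsinc (v k - u i)) ^+ 2 <= \sum_(i < N) a i ^+ 2.
Proof.
move=> hu hv; pose P k := \sum_(i < N) a i * rsinc (v k - u i).
pose b j := if (j < N)%N then a j else - P (j - N)%N.
pose w j := if (j < N)%N then u j else v (j - N)%N.
have := rsinc_posdef (N + K) b w.
rewrite big_split_ord /=.
under eq_bigr => i _ do rewrite big_split_ord /=.
under [X in _ <= _ + X]eq_bigr => i _ do rewrite big_split_ord /=.
rewrite !big_split /=.
have bl (i : 'I_N) : b i = a i by rewrite /b ltn_ord.
have wl (i : 'I_N) : w i = u i by rewrite /w ltn_ord.
have br k : b (N + k)%N = - P k by rewrite /b ltnNge leq_addr /= addKn.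
have wr k : w (N + k)%N = v k by rewrite /w ltnNge leq_addr /= addKn.
have -> : \sum_(i < N) \sum_(j < N) b i * b j * rsinc (w i - w j) = \sum_(i < N) a i ^+ 2.
  rewrite -(@sum_delta N (fun i j => a i * a j) _ hu).
  by apply: eq_bigr => i _; apply: eq_bigr => j _; rewrite !bl !wl.
have -> : \sum_(i < N) \sum_(k < K) b i * b (N + k)%N * rsinc (w i - w (N + k)%N) = - \sum_(k < K) P k ^+ 2.
  rewrite exchange_big /= -sumrN; apply: eq_bigr => k _.
  rewrite expr2 {2}/P mulr_sumr -sumrN; apply: eq_bigr => i _.
  by rewrite bl wl br wr -rsincN opprB; ring.
have -> : \sum_(k < K) \sum_(i < N) b (N + k)%N * b i * rsinc (w (N + k)%N - w i) = - \sum_(k < K) P k ^+ 2.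
  rewrite -sumrN; apply: eq_bigr => k _.
  rewrite expr2 {2}/P mulr_sumr -sumrN; apply: eq_bigr => i _.
  by rewrite bl wl br wr; ring.
have -> : \sum_(k < K) \sum_(l < K) b (N + k)%N * b (N + l)%N * rsinc (w (N + k)%N - w (N + l)%N) = \sum_(k < K) P k ^+ 2.
  rewrite -(@sum_delta K (fun i j => P i * P j) _ hv).
  by apply: eq_bigr => k _; apply: eq_bigr => l _; rewrite !br !wr mulrNN.
by move=> h; rewrite -/(P _); move: h; clear; set X := \sum_(i < N) _; set Y := \sum_(k < K) _; lra.
Qed.

Definition kern m n t : R := rsinc (t - (m n)%:R) + rsinc (t + (m n)%:R).

Lemma sqrD_le (x y : R) : (x + y) ^+ 2 <= 2 * x ^+ 2 + 2 * y ^+ 2.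
Proof.
rewrite -subr_ge0; have -> : 2 * x ^+ 2 + 2 * y ^+ 2 - (x + y) ^+ 2 = (x - y) ^+ 2 by ring.
exact: sqr_ge0.
Qed.

(** The translates [t + k], like their opposites, are integers apart, so they form an orthonormal
    system of evaluations. By evenness of sinc the second half of [kern] is an evaluation at - (t +
    k); two applications of [sinc_bessel] and (x + y)^2 <= 2 x^2 + 2 y^2 give the factor 4. *)
Lemma kern_window m N K (a : nat -> R) t : injective m ->
  \sum_(k < K) (\sum_(n < N) a n * kern m n (t + k%:R)) ^+ 2 <= 4 * \sum_(n < N) a n ^+ 2.
Proof.
move=> minj; pose u i : R := (m i)%:R.
have hu i j : rsinc (u i - u j) = (i == j)%:R by rewrite rsinc_nat (inj_eq minj).
have hv i j : rsinc ((t + i%:R) - (t + j%:R)) = (i == j)%:R by rewrite opprD addrACA subrr add0r rsinc_nat.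
have hv' i j : rsinc (- (t + i%:R) - - (t + j%:R)) = (i == j)%:R by rewrite -opprD rsincN hv.
have h1 := @sinc_bessel N K a u (fun k => t + k%:R) hu hv.
have h2 := @sinc_bessel N K a u (fun k => - (t + k%:R)) hu hv'.
apply: (@le_trans _ _ (\sum_(k < K) (2 * (\sum_(i < N) a i * rsinc (t + k%:R - u i)) ^+ 2
   + 2 * (\sum_(i < N) a i * rsinc (- (t + k%:R) - u i)) ^+ 2))).
  apply: ler_sum => k _; apply: le_trans (sqrD_le _ _); rewrite -big_split /= le_eqVlt.
  apply/orP; left; apply/eqP; congr (_ ^+ 2); apply: eq_bigr => i _.
  by rewrite /kern -mulrDr; congr (_ * (_ + _)); rewrite -rsincN opprD.
rewrite big_split /= -!mulr_sumr; move: h1 h2; set X := \sum_(k < K) _; set Y := \sum_(k < K) _.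
set Z := \sum_(i < N) _; clear; lra.
Qed.

Lemma kern_sqr_sum m N t : injective m -> \sum_(n < N) kern m n t ^+ 2 <= 4.
Proof.
move=> minj; pose u i : R := (m i)%:R.
have hu i j : rsinc (u i - u j) = (i == j)%:R by rewrite rsinc_nat (inj_eq minj).
have one s : \sum_(n < N) rsinc (s - u n) ^+ 2 <= 1.
  have hv (i j : nat) : rsinc (s + i%:R - (s + j%:R)) = (i == j)%:R by rewrite opprD addrACA subrr add0r rsinc_nat.
  (* With coefficients equal to the values of the kernels themselves, the inequality reads A^2 <= A,
     whence A <= 1. *)
  have := @sinc_bessel N 1 (fun n => rsinc (s - u n)) u (fun k => s + k%:R) hu hv.
  rewrite big_ord_recl big_ord0 addr0 /= addr0.
  under eq_bigr => i _ do rewrite -expr2.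
  set A := \sum_(n < N) _ => hA; rewrite leNgt; apply/negP => A1.
  have A0 : 0 < A by apply: lt_trans A1.
  by move: hA; rewrite expr2 ger_pMr// leNgt A1.
apply: (@le_trans _ _ (\sum_(n < N) (2 * rsinc (t - u n) ^+ 2 + 2 * rsinc (- t - u n) ^+ 2))).
  apply: ler_sum => n _.
  have -> : kern m n t = rsinc (t - u n) + rsinc (- t - u n) by rewrite -opprD rsincN.
  exact: sqrD_le.
rewrite big_split /= -!mulr_sumr; have := one t; have := one (- t).
set X := \sum_(n < N) _; set Y := \sum_(n < N) _; clear; lra.
Qed.

Lemma cabs_sqr (z : C) : cabs z ^+ 2 = complex.Re z ^+ 2 + complex.Im z ^+ 2.
Proof. by rewrite /cabs sqr_sqrtr// addr_ge0 ?sqr_ge0. Qed.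

Lemma cRe_sum n (f : nat -> C) : complex.Re (\sum_(i < n) f i) = \sum_(i < n) complex.Re (f i).
Proof. by elim: n => [|n IH]; rewrite ?big_ord0// !big_ord_recr /= cReD IH. Qed.

Lemma cIm_sum n (f : nat -> C) : complex.Im (\sum_(i < n) f i) = \sum_(i < n) complex.Im (f i).
Proof. by elim: n => [|n IH]; rewrite ?big_ord0// !big_ord_recr /= cImD IH. Qed.

Lemma ckern_window c m N K t : injective m ->
  \sum_(k < K) cabs (\sum_(n < N) c n * cR (kern m n (t + k%:R))) ^+ 2 <= 4 * \sum_(n < N) cabs (c n) ^+ 2.
Proof.
move=> minj.
have h1 := kern_window N K (fun n => complex.Re (c n)) t minj.
have h2 := kern_window N K (fun n => complex.Im (c n)) t minj.
have -> : \sum_(n < N) cabs (c n) ^+ 2 = \sum_(n < N) complex.Re (c n) ^+ 2 + \sum_(n < N) complex.Im (c n) ^+ 2.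
  by rewrite -big_split /=; apply: eq_bigr => n _; rewrite cabs_sqr.
apply: le_trans (_ : _ <= _ + _) (_ : _ + _ <= _); last by rewrite mulrDr; exact: lerD h1 h2.
rewrite -big_split /=; apply: ler_sum => k _; rewrite cabs_sqr.
rewrite (cRe_sum N (fun n => c n * cR (kern m n (t + k%:R)))) (cIm_sum N (fun n => c n * cR (kern m n (t + k%:R)))).
rewrite le_eqVlt; apply/orP; left; apply/eqP.
by congr (_ ^+ 2 + _ ^+ 2); apply: eq_bigr => n _; rewrite mul_cR.
Qed.

Lemma sq_tail c e : sq_bounded c -> 0 < e -> exists N0, forall N, (N0 <= N)%N -> forall M,
  \sum_(i < M) cabs (c (N + i)%N) ^+ 2 <= e.
Proof.
move=> [B hB] e0; pose S N := \sum_(n < N) cabs (c n) ^+ 2.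
have SD N M : S (N + M)%N = S N + \sum_(i < M) cabs (c (N + i)%N) ^+ 2 by rewrite /S big_split_ord.
have SB N : S N <= B.
  apply: le_trans (hB N); apply: ler_sum => n _.
  by rewrite ler_pXn2r ?nnegrE ?cabs_ge0 ?N1_ge0// cabs_le_N1.
have hs : has_sup [set S N | N in [set: nat]].
  by split; [exists (S 0%N), 0%N|exists B => _ [N _ <-]].
have [_ [N0 _ <-] hN0] := sup_adherent e0 hs.
exists N0 => N NN0 M.
have h1 : S (N + M)%N <= sup [set S N | N in [set: nat]].
  by apply: ub_le_sup; [exact: hs.2|exists (N + M)%N].
have h2 : S N0 <= S N.
  rewrite -(subnKC NN0) SD lerDl; apply: sumr_ge0 => i _; exact: sqr_ge0.
by have := SD N M; move: h1 h2 hN0; clear; set s := sup _; set X := \sum_(i < M) _; lra.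
Qed.

Lemma lip_approx_continuous (g : R -> R) :
  (forall e, 0 < e -> exists V A, [/\ 0 <= A, forall s t, `|V s - V t| <= A * `|s - t|
    & forall t, `|V t - g t| <= e]) -> continuous g.
Proof.
move=> H t; apply/cvgrPdist_le => e e0.
have e30 : 0 < e / 3 by rewrite divr_gt0.
have [V [A [A0 lV hV]]] := H _ e30.
have A10 : 0 < A + 1 by rewrite ltr_wpDl.
near=> s.
have hs : `|t - s| < e / 3 / (A + 1).
  near: s; apply: (@cvgr_dist_lt _ _ _ _ _ id t); [exact: cvg_id|by rewrite divr_gt0].
have hA : A * `|t - s| <= e / 3.
  apply: (@le_trans _ _ ((A + 1) * `|t - s|)); first by rewrite ler_wpM2r// lerDl.
  by rewrite mulrC -ler_pdivlMr// ltW.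
have h1 := hV t; have h2 := hV s; have h3 := le_trans (lV t s) hA.
rewrite (_ : g t - g s = - (V t - g t) + (V t - V s) + (V s - g s)); last by ring.
apply: le_trans (ler_normD _ _) _; apply: le_trans (lerD (ler_normD _ _) (lexx _)) _.
by rewrite normrN; move: h1 h2 h3; clear; set x := `|V t - g t|; set y := `|V s - g s|; set z := `|V t - V s|; lra.
Unshelve. all: by end_near. Qed.

Lemma continuous_integrable (G : R -> R) (a b : R) : continuous G -> mu.-integrable `[a, b] (EFin \o G).
Proof.
move=> cG; apply: continuous_compact_integrable; first exact: segment_compact.
exact: continuous_subspaceT.
Qed.

(** The interval is cut into 2 n windows of length d. [V t] adds the primitives at the translates by
    t of the left ends, so its derivative is one of the sums bounded by B, while V(d) - V(0)
    telescopes to the whole integral; the mean value inequality concludes. *)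
Lemma window_Rintegral (G : R -> R) d B n : continuous G -> (forall t, 0 <= G t) -> 0 < d ->
  (forall t K, \sum_(k < K) G (t + k%:R * d) <= B) ->
  Rintegral mu `]- (n%:R * d), n%:R * d] G <= B * d.
Proof.
move=> cG G0 d0 hB.
have iG (a b : R) := continuous_integrable a b cG.
have d0' := ltW d0.
pose T n : R := n%:R * d; rewrite -/(T n).
have T0 : 0 <= T n by exact: mulr_ge0.
(* The primitive starts one unit to the left of the interval, so that the end point [- T n] is
   interior and [P] is differentiable there. *)
pose c := - T n - 1; pose P t := Rintegral mu `[c, t] G.
have dP t : c < t -> is_derive t 1 P (G t).
  move=> ct; have tt1 : t < t + 1 by rewrite ltrDl.
  have [h1 h2] := continuous_FTC1_closed tt1 (iG c (t + 1)) ct (cG t).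
  by apply: (DeriveDef h1); rewrite -derive1E h2.
have -> : Rintegral mu `]- T n, T n] G = P (T n) - P (- T n).
  rewrite /P Rintegral_itvB//; rewrite bnd_simp /c; have := T0; clear; lra.
pose V t := \sum_(k < n + n) P (- T n + k%:R * d + t).
pose dV t := \sum_(k < n + n) G (- T n + k%:R * d + t).
have hV t : 0 <= t <= d -> is_derive t 1 V (dV t).
  move=> /andP[t0 _].
  have hk k : is_derive t 1 (fun t : R => P (- T n + k%:R * d + t)) (G (- T n + k%:R * d + t)).
    pose a := - T n + k%:R * d.
    have ha : is_derive t 1 (fun t : R => a + t) 1.
      by apply: (is_derive_cast (is_deriveD (is_derive_cst a t 1) (is_derive_id t 1))); rewrite add0r.
    have hc : c < a + t.
      have : 0 <= k%:R * d by exact: mulr_ge0.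
      by rewrite /c /a; move: t0; clear; set y := k%:R * d; lra.
    by apply: (is_derive_cast (@is_derive1_comp R P (fun t => a + t) t _ _ (dP _ hc) ha)); rewrite mulr1.
  rewrite /V /dV; elim: (n + n)%N => [|j IH].
    rewrite big_ord0 (_ : (fun t => _) = cst 0); first exact: is_derive_cst.
    by apply/funext => s; rewrite big_ord0.
  rewrite big_ord_recr /= (_ : (fun t => _) = (fun t => \sum_(k < j) P (- T n + k%:R * d + t)) + (fun t => P (- T n + j%:R * d + t))).
    exact: is_deriveD.
  by apply/funext => s; rewrite big_ord_recr.
have hdV t : 0 <= t <= d -> `|dV t| <= B.
  move=> _; rewrite ger0_norm; last by apply: sumr_ge0.
  apply: le_trans (hB (- T n + t) (n + n)%N); rewrite le_eqVlt; apply/orP; left; apply/eqP.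
  by apply: eq_bigr => k _; rewrite addrAC.
have := mvt_bound d0' hV hdV; rewrite /V -sumrB.
rewrite (eq_bigr (fun k : 'I_(n + n) => P (- T n + (nat_of_ord k).+1%:R * d) - P (- T n + (nat_of_ord k)%:R * d))); last first.
  by move=> k _; rewrite addr0 -addrA -[X in _ + (_ + X)]mul1r -mulrDl -natr1.
rewrite -(big_mkord xpredT (fun k => P (- T n + k.+1%:R * d) - P (- T n + k%:R * d))) telescope_sumr//.
rewrite mul0r addr0 natrD mulrDl -/(T n) addKr.
by apply: le_trans; exact: ler_norm.
Qed.

Lemma window_integral (G : R -> R) d B : continuous G -> (forall t, 0 <= G t) -> 0 < d ->
  (forall t K, \sum_(k < K) G (t + k%:R * d) <= B) ->
  (\int[mu]_(t in [set: R]) (G t)%:E <= (B * d)%:E)%E.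
Proof.
move=> cG G0 d0 hB; pose T n : R := n%:R * d.
pose F n := `]- T n, T n]%classic.
have nd : nondecreasing_seq F.
  move=> i j ij; rewrite /F subsetEset; apply: subset_itv; rewrite bnd_simp ?lerN2.
    by rewrite ler_pM2r// ler_nat.
  by rewrite ler_pM2r// ler_nat.
have mG : measurable_fun [set: measurableTypeR R] (EFin \o G).
  by apply/measurable_EFinP; exact: continuous_measurable_fun.
have := @ge0_nondecreasing_set_cvg_integral _ (measurableTypeR R) R F (EFin \o G) (@lebesgue_measure R) nd (fun i => measurable_itv _)
  (fun i => measurable_funS measurableT (@subsetT _ _) mG) (fun i x _ => G0 x).
have -> : \bigcup_i F i = setT.
  apply/seteqP; split => // t _.
  pose n := (Num.truncn (`|t| / d)).+1.
  have ht : `|t| < T n by rewrite -ltr_pdivrMr//; exact: truncnS_gt.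
  by exists n => //; rewrite /F /= in_itv /=; move: ht; rewrite ltr_norml => /andP[-> /ltW].
move=> hc; rewrite -(cvg_lim _ hc)//; apply: lime_le; first by apply/cvg_ex; eexists; exact: hc.
apply: nearW => n; rewrite -[leLHS]fineK; last first.
  have iF : mu.-integrable (F n) (EFin \o G).
    apply: (@integrableS _ _ _ mu `[- T n, T n]%classic _ _ (measurable_itv _) (measurable_itv _)) (continuous_integrable _ _ cG).
    by move=> y; rewrite /= !in_itv /= => /andP[/ltW -> ->].
  exact: (@integrable_fin_num _ (measurableTypeR R) R (@lebesgue_measure R) (F n) (measurable_itv _) _ iF).
by rewrite lee_fin; exact: window_Rintegral.
Qed.

Lemma ge0_cvge0 (a : nat -> \bar R) : (forall n, 0 <= a n)%E ->
  (forall e, 0 < e -> exists N0, forall N, (N0 <= N)%N -> (a N <= e%:E)%E) -> a @ \oo --> 0%E.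
Proof.
move=> a0 H.
have fin N e : (a N <= e%:E)%E -> a N \is a fin_num.
  by move=> h; rewrite ge0_fin_numE//; apply: le_lt_trans h (ltry _).
apply/fine_cvgP; split.
  have [N0 hN] := H 1 ltr01.
  by exists N0 => // N /= NN; exact: fin (hN _ NN).
apply/cvgrPdist_le => e e0; have [N0 hN] := H e e0.
exists N0 => // N /= NN; rewrite sub0r normrN ger0_norm; last exact: fine_ge0.
by rewrite -lee_fin fineK; [exact: hN|exact: fin (hN _ NN)].
Qed.

(** * Series of sinc kernels with square summable coefficients *)

Section KernelSeries.
Variables (c : nat -> C) (m : nat -> nat) (l : R) (f : R -> C).
Hypotheses (cB : sq_bounded c) (minj : injective m) (l0 : 0 < l).
Let U N t := \sum_(n < N) c n * cR (kern m n (l * t)).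
Hypothesis hf : forall t e, 0 < e -> exists N0, forall N, (N0 <= N)%N -> cabs (U N t - f t) <= e.

Lemma cabsB_le_sqr (a b : C) e : cabs b <= e -> e <= 1 -> cabs (a + b) ^+ 2 <= 2 * cabs a ^+ 2 + 2 * e.
Proof.
move=> be e1; have b1 := le_trans be e1; apply: (@le_trans _ _ ((cabs a + cabs b) ^+ 2)).
  by rewrite ler_pXn2r ?nnegrE ?addr_ge0 ?cabs_ge0// cabsD.
apply: le_trans (sqrD_le _ _) _; rewrite lerD2l ler_pM2l// expr2.
apply: le_trans (_ : _ <= cabs b) be; apply: ler_piMr; [exact: cabs_ge0|exact: b1].
Qed.

(** The window bound for a block of terms N, ..., N + M0 - 1 depends on the tail of the squares only
    and not on [M0]. As the window has finitely many points, pointwise convergence permits replacing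
    [f] by a long partial sum at all of them at once. The step [l^-1] becomes 1 after scaling by
    [l]. *)
Lemma kernel_tail_window e : 0 < e -> exists N0, forall N, (N0 <= N)%N -> forall t K,
  \sum_(k < K) cabs (U N (t + k%:R * l^-1) - f (t + k%:R * l^-1)) ^+ 2 <= e.
Proof.
(* The 8 pays for the factor 4 of [ckern_window] and the factor 2 from splitting the square. *)
move=> e0; have e80 : 0 < e / 8 by rewrite divr_gt0.
have [N0 hN0] := sq_tail cB e80; exists N0 => N NN t K.
pose T k := t + k%:R * l^-1.
have simul d : 0 < d -> exists M0, forall M, (M0 <= M)%N -> forall k, (k < K)%N -> cabs (U M (T k) - f (T k)) <= d.
  move=> d0; elim: K => [|j [M0 IH]]; first by exists 0%N.
  have [M1 hM1] := hf (T j) d0; exists (maxn M0 M1) => M; rewrite geq_max => /andP[h0 h1] k.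
  by rewrite ltnS leq_eqVlt => /predU1P[->|kj]; [exact: hM1|exact: IH].
apply/ler_addgt0Pr => d d0.
(* [d1 <= 1] lets a squared error be bounded by [d1], and the K points together then cost 2 K d1 <=
   d. *)
pose d1 := Num.min 1 (d / (2 * K%:R + 1)).
have K0 : 0 < 2 * K%:R + 1 :> R by rewrite ltr_wpDl// mulr_ge0.
have d10 : 0 < d1 by rewrite lt_min ltr01 divr_gt0.
have d11 : d1 <= 1 by rewrite ge_min lexx.
have d1d : 2 * K%:R * d1 <= d.
  apply: (@le_trans _ _ ((2 * K%:R + 1) * (d / (2 * K%:R + 1)))).
    apply: ler_pM; [exact: mulr_ge0|exact: ltW|by rewrite lerDl|by rewrite ge_min lexx orbT].
  by rewrite mulrC divfK// gt_eqF.
have [M0 hM0] := simul d1 d10.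
pose a k := U (N + M0)%N (T k) - U N (T k).
have wa : \sum_(k < K) cabs (a k) ^+ 2 <= 4 * (e / 8).
  apply: le_trans (_ : _ <= 4 * \sum_(n < M0) cabs (c (N + n)%N) ^+ 2) _; last by rewrite ler_pM2l// hN0.
  have minj' : injective (fun n => m (N + n)%N) by move=> i j /minj /addnI.
  apply: le_trans (@ckern_window (fun n => c (N + n)%N) (fun n => m (N + n)%N) M0 K (l * t) minj').
  rewrite le_eqVlt; apply/orP; left; apply/eqP; apply: eq_bigr => k _.
  rewrite /a /U big_split_ord /= addrAC subrr add0r; congr (cabs _ ^+ 2); apply: eq_bigr => n _.
  by rewrite /kern /T mulrDr mulrCA divff ?mulr1// gt_eqF.
apply: (@le_trans _ _ (\sum_(k < K) (2 * cabs (a k) ^+ 2 + 2 * d1))).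
  apply: ler_sum => k _; rewrite -cabsN opprB.
  rewrite (_ : f _ - _ = a k + - (U (N + M0)%N (T k) - f (T k))); last by rewrite /a /T; ring.
  by apply: cabsB_le_sqr => //; rewrite cabsN; apply: hM0 => //; rewrite leq_addl.
rewrite big_split /= -mulr_sumr sumr_const card_ord -[_ *+ K]mulr_natl mulrCA mulrA.
by move: wa d1d; clear; set A := \sum_(k < K) _; set D := 2 * K%:R * d1; lra.
Qed.

Lemma kernel_unif e : 0 < e -> exists N0, forall N, (N0 <= N)%N -> forall t, cabs (U N t - f t) <= e.
Proof.
move=> e0; have [N0 hN] := kernel_tail_window (exprn_gt0 2 e0); exists N0 => N NN t.
have := hN N NN t 1%N; rewrite big_ord_recl big_ord0 /= mul0r !addr0.
by rewrite ler_pXn2r// nnegrE ?cabs_ge0// ltW.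
Qed.

Lemma kernel_lipschitz N : exists2 A, 0 <= A & forall s t, cabs (U N s - U N t) <= A * `|s - t|.
Proof.
have p0 : 0 <= pi :> R := ltW (@pi_gt0 R).
elim: N => [|N [A A0 IH]].
  by exists 0 => // s t; rewrite /U !big_ord0 subrr mul0r -[0]/(cR 0) cabs_cR normr0.
pose D := cabs (c N) * (pi * l + pi * l).
have pl0 : 0 <= pi * l by apply: mulr_ge0 => //; exact: ltW.
exists (A + D) => [|s t].
  by apply: addr_ge0 => //; apply: mulr_ge0; [exact: cabs_ge0|exact: addr_ge0].
rewrite /U !big_ord_recr /= -/(U N s) -/(U N t) opprD addrACA mulrDl.
apply: le_trans (cabsD _ _) _; apply: lerD => //.
rewrite -mulrBr cabsM -cRN -cRD cabs_cR -mulrA; apply: ler_wpM2l; first exact: cabs_ge0.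
rewrite /kern opprD addrACA; apply: le_trans (ler_normD _ _) _; rewrite mulrDl.
have hb b : `|rsinc (l * s + b) - rsinc (l * t + b)| <= pi * l * `|s - t|.
  apply: le_trans (rsinc_lipschitz _ _) _.
  by rewrite opprD addrACA subrr addr0 -mulrBr normrM (gtr0_norm l0) mulrA.
by apply: lerD; exact: hb.
Qed.

Lemma norm_Re_cabs (z : C) : `|complex.Re z| <= cabs z.
Proof. by rewrite /cabs -sqrtr_sqr ler_wsqrtr// lerDl sqr_ge0. Qed.

Lemma norm_Im_cabs (z : C) : `|complex.Im z| <= cabs z.
Proof. by rewrite /cabs -sqrtr_sqr ler_wsqrtr// lerDr sqr_ge0. Qed.

(** Only pointwise convergence to [f] is assumed. Continuity, on which [window_integral] relies,
    comes from [f] being a uniform limit of Lipschitz partial sums. *)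
Lemma kernel_continuous N : continuous (fun t => cabs (U N t - f t) ^+ 2).
Proof.
have cRef : continuous (fun t => complex.Re (U N t - f t)).
  apply: lip_approx_continuous => e e0; have [N0 hN] := kernel_unif e0.
  have [A1 A10 h1] := kernel_lipschitz N; have [A2 A20 h2] := kernel_lipschitz N0.
  exists (fun t => complex.Re (U N t - U N0 t)), (A1 + A2); split=> [|s t|t]; first exact: addr_ge0.
    rewrite -cReN -cReD; apply: le_trans (norm_Re_cabs _) _.
    rewrite (_ : _ - _ = (U N s - U N t) + - (U N0 s - U N0 t)); last by ring.
    by apply: le_trans (cabsD _ _) _; rewrite cabsN mulrDl lerD.
  rewrite -cReN -cReD; apply: le_trans (norm_Re_cabs _) _.
  rewrite (_ : _ - _ = - (U N0 t - f t)); last by ring.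
  by rewrite cabsN; exact: hN.
have cImf : continuous (fun t => complex.Im (U N t - f t)).
  apply: lip_approx_continuous => e e0; have [N0 hN] := kernel_unif e0.
  have [A1 A10 h1] := kernel_lipschitz N; have [A2 A20 h2] := kernel_lipschitz N0.
  exists (fun t => complex.Im (U N t - U N0 t)), (A1 + A2); split=> [|s t|t]; first exact: addr_ge0.
    rewrite -cImN -cImD; apply: le_trans (norm_Im_cabs _) _.
    rewrite (_ : _ - _ = (U N s - U N t) + - (U N0 s - U N0 t)); last by ring.
    by apply: le_trans (cabsD _ _) _; rewrite cabsN mulrDl lerD.
  rewrite -cImN -cImD; apply: le_trans (norm_Im_cabs _) _.
  rewrite (_ : _ - _ = - (U N0 t - f t)); last by ring.
  by rewrite cabsN; exact: hN.
rewrite (_ : (fun t => _) = (fun t => complex.Re (U N t - f t) ^+ 2 + complex.Im (U N t - f t) ^+ 2)); last first.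
  by apply/funext => t; rewrite cabs_sqr.
move=> t; apply: cvgD; rewrite /=; under eq_fun do rewrite expr2; rewrite expr2; apply: cvgM;
  by [exact: cRef|exact: cImf].
Qed.

Lemma kernel_real_line_cvg (u : nat -> C -> C) (F : C -> C) :
  (forall n t, u n (cR t) = c n * cR (kern m n (l * t))) -> (forall t, F (cR t) = f t) ->
  real_line_cvg u F.
Proof.
move=> hu hF.
have UE N t : \sum_(n < N) u n (cR t) = U N t by apply: eq_bigr => n _; rewrite hu.
split.
  move=> t; have [B hB] := cB; exists ((B + 4) / 2) => N.
  apply: (@le_trans _ _ (\sum_(n < N) ((N1 (c n) ^+ 2 + kern m n (l * t) ^+ 2) / 2))).
    apply: ler_sum => n _; rewrite hu cabsM cabs_cR.
    (* AM-GM: 2 |c_n k_n| <= |c_n|^2 + k_n^2 *)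
    rewrite ler_pdivlMr// -[kern _ _ _ ^+ 2]ger0_norm ?sqr_ge0// normrX -subr_ge0.
    apply: (@le_trans _ _ ((N1 (c n) - `|kern m n (l * t)|) ^+ 2)); first exact: sqr_ge0.
    rewrite -subr_ge0.
    rewrite (_ : _ - _ = 2 * `|kern m n (l * t)| * (N1 (c n) - cabs (c n))); last by ring.
    by apply: mulr_ge0; [exact: mulr_ge0|rewrite subr_ge0 cabs_le_N1].
  rewrite -mulr_suml ler_pM2r ?invr_gt0// big_split /=.
  by apply: lerD; [exact: hB|exact: kern_sqr_sum].
split.
  move=> e e0; have e20 : 0 < e / 2 by rewrite divr_gt0.
  have [N0 hN] := kernel_unif e20; exists N0 => N NN t.
  rewrite UE hF; apply: le_lt_trans (hN N NN t) _.
  by rewrite ltr_pdivrMr// ltr_pMr// ltr1n.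
apply: ge0_cvge0 => [N|e e0].
  by apply: integral_ge0 => t _; rewrite lee_fin sqr_ge0.
(* A period has length [l^-1], so a bound [e * l] on the sums over translates integrates to [e]. *)
have el0 : 0 < e * l by exact: mulr_gt0.
have [N0 hN] := kernel_tail_window el0; exists N0 => N NN.
under eq_integral => t _ do rewrite UE hF.
have li : 0 < l^-1 by rewrite invr_gt0.
have := @window_integral (fun t => cabs (U N t - f t) ^+ 2) l^-1 (e * l) (@kernel_continuous N)
  (fun t => sqr_ge0 _) li (hN N NN).
by rewrite mulfK// gt_eqF.
Qed.

End KernelSeries.

End SincSeries.

(** * Integrability of an L_2 potential, and the passage from discs to the real line *)

Section SquareIntegrable.
Context {R : realType}.
Local Notation C := R[i].
Local Notation mu := (@lebesgue_measure R).

Lemma L2_on_sqr_intble (L : R) (q : R -> C) : L2_on L q ->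
  intble L (fun t => complex.Re (q t) ^+ 2 + complex.Im (q t) ^+ 2).
Proof.
move=> [mr [mi fin]]; apply/integrableP; split.
  apply/measurable_EFinP; apply: measurable_funD; exact: measurable_funX.
apply: le_lt_trans fin; rewrite le_eqVlt; apply/orP; left; apply/eqP.
by apply: eq_integral => t _ /=; rewrite ger0_norm// addr_ge0// sqr_ge0.
Qed.

Lemma L2_on_cintble (L : R) (q : R -> C) : L2_on L q -> cintble L q.
Proof.
move=> h; have I2 := L2_on_sqr_intble h; case: h => mr [mi _].
have I1 : intble L (fun t => 1 + (complex.Re (q t) ^+ 2 + complex.Im (q t) ^+ 2)).
  by apply: intbleD => //; exact/bmeas_intble/bmeas_cst.
have le1 (a b : R) : `|a| <= `|1 + (a ^+ 2 + b ^+ 2)|.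
  have b2 := sqr_ge0 b; have a2 := sqr_ge0 a.
  rewrite [leRHS]ger0_norm; last by apply: addr_ge0 => //; exact: addr_ge0.
  rewrite -(real_normK (num_real a)); move: b2; set B := b ^+ 2.
  have := sqr_ge0 (`|a| - 1); have := normr_ge0 a.
  rewrite sqrrB1; move: `|a| => c; rewrite -mulr_natl; clear; lra.
split; apply: (le_integrable _ _ _ I1) => //.
- exact/measurable_EFinP.
- by move=> t _ /=; rewrite lee_fin.
- exact/measurable_EFinP.
- by move=> t _ /=; rewrite lee_fin [X in `|1 + X|]addrC.
Qed.

Lemma L2_on_N1_intble (L : R) (q : R -> C) : L2_on L q -> intble L (fun t => N1 (q t) ^+ 2).
Proof.
move=> h; have I2 := L2_on_sqr_intble h; have [hr hi] := L2_on_cintble h.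
have [mr mi] := (h.1, h.2.1).
apply: (le_integrable _ _ _ (intbleZ 2 I2)) => //.
  apply/measurable_EFinP/measurable_funX; apply: measurable_funD; apply: measurableT_comp => //; exact: normr_measurable.
move=> t _ /=; rewrite lee_fin ger0_norm ?sqr_ge0// ger0_norm; first exact: N1_sqr.
by apply: mulr_ge0 => //; apply: addr_ge0; exact: sqr_ge0.
Qed.

Lemma kern_real_line_cvg (c : nat -> C) (m : nat -> nat) (l : R) (u : nat -> C -> C) (F : C -> C) :
  sq_bounded c -> injective m -> 0 < l ->
  (forall n t, u n (cR t) = c n * cR (kern m n (l * t))) ->
  unif_cvg_compacts u F -> real_line_cvg u F.
Proof.
move=> cB minj l0 hu hF; apply: (@kernel_real_line_cvg _ c m l (fun t => F (cR t))) => // t e e0.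
have r0 : 0 < `|t| + 1 by rewrite ltr_wpDl.
have [N0 hN] := hF _ r0 e e0; exists N0 => N NN; apply: ltW.
rewrite -(eq_bigr _ (fun (n : 'I_N) _ => hu n t)); apply: hN => //.
by rewrite cabs_cR lerDl.
Qed.

Lemma kern_cR (m : nat -> nat) n (t : R) :
  csinc (cR t - (m n)%:R) + csinc (cR t + (m n)%:R) = cR (kern m n t).
Proof. by rewrite -!cRn -cRN -!cRD !csinc_cR -cRD. Qed.

End SquareIntegrable.

(** * The coefficients as samples of the remainders, and the two representations *)

Unset Implicit Arguments.
Set Strict Implicit.
Local Close Scope classical_set_scope.

Theorem mainTheorem6 (R : realType) (L : R) (q : R -> R[i]) (h : R[i])
  (S dS phi dphi : R[i] -> R -> R[i]) (x : R) :
  0 < L -> L2_on L q ->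
  (forall rho, is_solution L q rho 0 1 (S rho) (dS rho)) ->
  (forall rho, is_solution L q rho 1 h (phi rho) (dphi rho)) ->
  0 < x <= L ->
  let w := omega q x in
  let xc := cR x in
  let pic := cR pi in
  let s_ring (n : nat) : R[i] :=
    (-1) ^+ n * (2 * n%:R + 1) * pic / xc
      * dS ((2 * n%:R + 1) * pic / (2 * xc)) x - 2 * w in
  let uS (n : nat) (rho : R[i]) : R[i] :=
    s_ring n * (csinc (2 * rho * xc / pic - (2 * n%:R + 1))
                + csinc (2 * rho * xc / pic + (2 * n%:R + 1))) in
  let phi_ring (n : nat) : R[i] :=
    if n == 0%N then dphi 0 x / 2
    else dphi (n%:R * pic / xc) x - (-1) ^+ n * (h + w) in
  let uphi (n : nat) (rho : R[i]) : R[i] :=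
    phi_ring n * (csinc (rho * xc / pic - n%:R) + csinc (rho * xc / pic + n%:R)) in
  exists FS Fphi : R[i] -> R[i],
    unif_cvg_compacts uS FS /\ real_line_cvg uS FS /\
    unif_cvg_compacts uphi Fphi /\ real_line_cvg uphi Fphi /\
    (forall rho : R[i], rho != 0 -> csin (rho * xc) != 0 ->
       dS rho x = ccos (rho * xc) + w / rho * csin (rho * xc)
                  + FS rho / (2 * rho * csin (rho * xc))) /\
    (forall rho : R[i],
       dphi rho x = - rho * csin (rho * xc)
                    - (h + w) * rho * xc * cj1 (rho * xc) + Fphi rho).
Proof.
move=> L0 hL2 hS hphi /andP[x0 xL] w xc pic s_ring uS phi_ring uphi.
have hq := L2_on_cintble hL2; have hq2 := L2_on_N1_intble hL2.
have p0 := @pi_gt0 R.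
have pn0 : (pi : R) != 0 by rewrite gt_eqF.
have xn0 : x != 0 by rewrite gt_eqF.
have x20 : 0 < 2 * x by rewrite mulr_gt0.
have pcn0 : pic != 0 by rewrite cR_eq0.
have xcn0 : xc != 0 by rewrite cR_eq0.
pose FS := dS_rem x q S; pose Fphi := dphi_rem x q h phi.
have FSeq := dS_rem_formula hq hS x0 xL.
have Fphieq := dphi_rem_formula hq hphi x0 xL.
have oddE n : 2 * n%:R + 1 = (2 * n).+1%:R :> R[i] by rewrite -[RHS]natr1 natrM.
have gE n : n%:R * pic / xc = grid x n by rewrite /grid !cRM cRn cRV.
have g2E n : (2 * n%:R + 1) * pic / (2 * xc) = grid (2 * x) (2 * n).+1.
  by rewrite oddE /grid !cRM cRV cRM !cRn.
(* At the odd nodes the cosine is 0 and the sine is (-1)^n, so the formula for S' has no vanishing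
   denominator and can be solved for the remainder. *)
have sE n : s_ring n = FS (grid (2 * x) (2 * n).+1).
  pose r : R := (2 * n).+1%:R * pi / (2 * x).
  have rx : grid (2 * x) (2 * n).+1 * cR x = cR (pi * n%:R + pi / 2).
    rewrite /grid -cRM; congr cR; rewrite -natr1 natrM.
    by move: pn0; move: (@pi R) => p _; field.
  have sn1 : csin (grid (2 * x) (2 * n).+1 * cR x) = (-1) ^+ n.
    by rewrite rx csin_cR sinD cos_pihalf sin_pihalf mulr0 add0r mulr1 cos_pin cR_sign.
  have cs0 : ccos (grid (2 * x) (2 * n).+1 * cR x) = 0.
    by rewrite rx ccos_cR cosD cos_pihalf sin_pihalf mulr0 sin_pin mul0r subrr.
  have r0 : grid (2 * x) (2 * n).+1 != 0.
    by rewrite cR_eq0 !mulf_neq0// ?invr_eq0 ?mulf_neq0// pnatr_eq0.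
  have s0 : (-1) ^+ n != 0 :> R[i] by rewrite signr_eq0.
  have := FSeq _ r0; rewrite sn1 cs0 => /(_ s0) dE.
  rewrite /s_ring g2E dE add0r /FS.
  have -> : (-1) ^+ n * (2 * n%:R + 1) * pic / xc = (-1) ^+ n * (2 * grid (2 * x) (2 * n).+1).
    have aux (s a p y : R[i]) : y != 0 -> s * a * p / y = s * (2 * (a * p / (2 * y))) by move=> y0; field.
    by rewrite -g2E; exact: aux.
  have s2 : (-1) ^+ n * (-1) ^+ n = 1 :> R[i] by rewrite -expr2 sqrr_sign.
  have aux (g s a : R[i]) : g != 0 -> s != 0 -> s * s = 1 ->
      s * (2 * g) * (w / g * s + a / (2 * g * s)) - 2 * w = a.
    move=> g0 s0' ss; rewrite (_ : _ * (_ + _) = 2 * w * (s * s) + a); last by field; rewrite g0 s0'.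
    by rewrite ss; ring.
  exact: aux.
have phE n : phi_ring n.+1 = Fphi (grid x n.+1).
  have rx : grid x n.+1 * cR x = cR (pi * n.+1%:R).
    by rewrite /grid -cRM; congr cR; rewrite divfK// mulrC.
  rewrite /phi_ring /= gE Fphieq rx csin_cR sin_pin cR0 mulr0 add0r.
  have -> : (h + omega q x) * grid x n.+1 * cR x * cj1 (cR (pi * n.+1%:R)) = - ((h + w) * (-1) ^+ n.+1).
    have y0 : cR (pi * n.+1%:R) != 0 :> R[i] by rewrite cR_eq0 mulf_neq0// pnatr_eq0.
    rewrite -mulrA -mulrA [grid _ _ * _]mulrA rx -/w -mulrN; congr (_ * _).
    rewrite /cj1 (negPf y0) csin_cR sin_pin cR0 mul0r sub0r mulrN mulrC divfK//.
    by rewrite ccos_cR cos_pin cR_sign.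
  by rewrite opprK /Fphi mulrC; ring.
(* Both explicit terms vanish at rho = 0, so the remainder there is phi'(0, x); the two equal sincs
   of index 0 supply the factor 2. *)
have ph0 : phi_ring 0%N * 2 = Fphi 0.
  rewrite /phi_ring /= divfK ?pnatr_eq0//.
  by rewrite Fphieq oppr0 mul0r mulr0 !mul0r subr0 add0r.
have g0 : grid x 0 = 0 by rewrite /grid mul0r mul0r cR0.
have uphiE n rho : uphi n rho = kc n (rho * cR (x / pi)) * Fphi (grid x n).
  rewrite /uphi cRM cRV mulrA; case: n => [|n].
    rewrite g0 -ph0 subr0 addr0 /kc /=.
    by ring.
  by rewrite phE /kc /= mulrC.
have uSE n rho : uS n rho = kc (2 * n).+1 (rho * cR (2 * x / pi)) * FS (grid (2 * x) (2 * n).+1).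
  rewrite /uS sE mulrC /kc /= -oddE !cRM cRV cRn.
  by rewrite (_ : 2 * rho * xc / pic = rho * (2 * cR x / cR pi))//; rewrite /xc /pic; ring.
have FS2 n : FS (grid (2 * x) (2 * n)) = 0 := dS_rem_even hq hS x0 xL n.
(* N terms of the series for S' are 2 N terms of the sampling series with parameter 2 x, since the
   remainder vanishes at the even nodes. *)
have uSs N rho : \sum_(n < N) uS n rho =
    \sum_(n < 2 * N) kc n (rho * cR (2 * x / pi)) * FS (grid (2 * x) n).
  elim: N => [|N IH]; first by rewrite !big_ord0.
  rewrite mulnS addnC addn2 !big_ord_recr /= IH uSE FS2.
  by rewrite mulr0 addr0.
have uSc : unif_cvg_compacts uS FS.
  move=> r r0 e e0; have [K K0 hK] := dS_rem_bounded L0 hq hq2 hS x0 xL.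
  have [N0 hN] := sampling x20 K0 hK (ltW r0) (divr_gt0 e0 (ltr0Sn _ 1)).
  exists N0 => N NN rho hr; rewrite uSs; apply: le_lt_trans (cabs_le_N1 _) _.
  apply: le_lt_trans (hN (2 * N)%N _ rho hr) _; first by rewrite (leq_trans NN)// leq_pmull.
  by rewrite ltr_pdivrMr// ltr_pMr// ltr1n.
have uphic : unif_cvg_compacts uphi Fphi.
  move=> r r0 e e0; have [K K0 hK] := dphi_rem_bounded L0 hq hq2 hphi x0 xL.
  have [N0 hN] := sampling x0 K0 hK (ltW r0) (divr_gt0 e0 (ltr0Sn _ 1)).
  exists N0 => N NN rho hr; rewrite (eq_bigr _ (fun (n : 'I_N) _ => uphiE n rho)).
  apply: le_lt_trans (cabs_le_N1 _) _; apply: le_lt_trans (hN N NN rho hr) _.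
  by rewrite ltr_pdivrMr// ltr_pMr// ltr1n.
exists FS, Fphi; split=> //; split.
  apply: (@kern_real_line_cvg _ s_ring (fun n => (2 * n).+1) (2 * x / pi)) => //.
  - by rewrite (funext sE); exact: (sq_bounded_dS_rem L0 hq hq2 hS x0 xL).
  - by move=> i j [] /eqP; rewrite eqn_mul2l /= => /eqP.
  - by rewrite divr_gt0.
  - move=> n t; rewrite /uS oddE -kern_cR !cRM cRV (cRn 2).
    by rewrite (_ : 2 * cR t * xc / pic = 2 * cR x / cR pi * cR t)//; rewrite /xc /pic; ring.
split=> //; split=> //.
apply: (@kern_real_line_cvg _ phi_ring id (x / pi)) => //.
- exact: (sq_bounded_dphi_rem L0 hq hq2 hphi x0 xL phE).
- by rewrite divr_gt0.
- move=> n t; rewrite /uphi -kern_cR !cRM cRV.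
  by rewrite (_ : cR t * xc / pic = cR x / cR pi * cR t)//; rewrite /xc /pic; ring.
Qed.
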